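(* Let $k$ be a field and let $\Gamma$ be a cell complex with vertex set $V$. Let $\mathcal{F}^\vee=\mathbf{A}(\mathbf{D}(\mathbf{A}(\mathcal{E}[-1])))$, regarded as a cochain complex, where $\mathcal{E}=\mathcal{E}(\Gamma;k)$ is the enriched chain complex of $\Gamma$. Then for every integer $i$ there is an isomorphism of $\mathbf{N}^V$-graded $S$-modules $$H^{-i}(\mathcal{F}^\vee)\cong k^i[\Gamma].$$
   Context: Cell complexes: ''cell complex'' means a finite regular cell complex with the intersection property, i.e. a Hausdorff topological space with a finite set of closed subsets (cells or faces), each homeomorphic to a ball, such that the interiors of the cells partition the space, the boundary of each cell is a union of other cells, $\emptyset$ is a cell (of dimension $-1$), and the intersection of any two faces is a face. $V$ is the set of vertices and $n=|V|$. Enriched chain complex: $S=k[x_v : v\in V]$, graded by $\mathbf{N}^V$. For a face $f$ let $m_f$ be the product of the variables indexed by its vertices. $\mathcal{E}_i=\bigoplus_{\dim f=i}Sf$ ($f$ in multidegree of $m_f$), with differential $f\mapsto\sum_{\dim f'=i-1}\epsilon(f',f)\frac{m_f}{m_{f'}}f'$, where $\epsilon$ is a $\{-1,0,1\}$-valued incidence function of $\Gamma$ (defining its augmented oriented chain complex). The chain complex $\mathcal{E}[-1]$ has $\mathcal{E}[-1]_i=\mathcal{E}_{i-1}$, so the generators of its term in homological degree $i$ correspond to faces of dimension $i-1$. A chain complex $\mathcal{P}_\cdot$ is also viewed as a cochain complex via $\mathcal{P}^{i}=\mathcal{P}_{-i}$. Square free modules: a subset $R\subseteq V$ is identified with its characteristic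 vector in $\mathbf{N}^V$. An $\mathbf{N}^V$-graded $S$-module $M$ is square free if multiplication $M_{\mathbf b}\xrightarrow{x_v}M_{\mathbf b+e_v}$ is bijective whenever $v$ lies in the support of $\mathbf b$; it is determined by the spaces $M_R$ ($R\subseteq V$) and the maps $x_v:M_R\to M_{R\cup\{v\}}$ ($v\notin R$). The Alexander dual $M^*$ of such $M$ is the square free module with $(M^* )_R=\mathrm{Hom}_k(M_{V\setminus R},k)$, where multiplication $x_v:(M^* )_R\to(M^* )_{R\cup\{v\}}$ for $v\notin R$ is the dual of $x_v:M_{V\setminus(R\cup\{v\})}\to M_{V\setminus R}$. A free square free module is one of the form $\bigoplus_{R\subseteq V}S\otimes_kB_R$ with $B_R$ a vector space in multidegree $R$. Functors on bounded complexes of finitely generated free square free modules: $\omega_S=S(-\mathbf 1)$ is the free module with one generator in multidegree $(1,\dots,1)$; $\mathbf{D}(\mathcal{P}^\cdot)=\mathrm{Hom}_S(\mathcal{P}^\cdot,\omega_S)$, with term $\mathrm{Hom}_S(\mathcal{P}^{-i},\omega_S)$ in degree $i$; $\mathbf{A}(\mathcal{P}^\cdot)$ is the minimal free resolution of the Alexander dual complex $\mathcal{P}^{\cdot *}$ (with term $(\mathcal{P}^{-i})^*$ in degree $i$), i.e. a minimal complex $\mathcal{Q}^\cdot$ of free square free modules (differentials vanish after $k\otimes_S-$) with a morphism $\mathcal{Q}^\cdot\to\mathcal{P}^{\cdot *}$ inducing isomorphisms on cohomology. The module $k^i[\Gamma]$: the square free $S$-module with, for $F\subseteq V$, $k^i[\Gamma]_F=kF$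 (one-dimensional, with basis element $F$) if $F$ is the vertex set of some face $f$ of $\Gamma$ with $|F|=\dim f+i+1$, and $k^i[\Gamma]_F=0$ otherwise; if $F$ and $F\cup\{v\}$ ($v\notin F$) are both such vertex sets, multiplication by $x_v$ sends the basis element $F$ to the basis element $F\cup\{v\}$. *)

(* Defs.v *)
From HB Require Import structures.
From mathcomp Require Import all_boot all_order all_algebra.
From mathcomp Require Import generic_quotient ring_quotient.
From mathcomp Require Import all_classical all_reals all_analysis.
Set Implicit Arguments.
Unset Strict Implicit.
Unset Printing Implicit Defensive.
Import Order.TTheory GRing.Theory Num.Theory.
Import numFieldNormedType.Exports.
Local Open Scope classical_set_scope.
Local Open Scope ring_scope.

Section Balls.
Variables (R : realType) (m : nat).
Definition euclidean_ball : set 'rV[R]_m := [set x | \sum_j x ord0 j ^+ 2 <= 1].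
Definition open_euclidean_ball : set 'rV[R]_m :=
  [set x | \sum_j x ord0 j ^+ 2 < 1].

(* [A] is homeomorphic to the closed [m]-ball, by a homeomorphism under which
   [I] corresponds to the open ball. *)
Definition ball_cell (X : topologicalType) (A I : set X) : Prop :=
  exists (phi : 'rV[R]_m -> X) (psi : X -> 'rV[R]_m),
    [/\ {within euclidean_ball, continuous phi},
        {within A, continuous psi},
        {in euclidean_ball, cancel phi psi},
        phi @` euclidean_ball = A
      & phi @` open_euclidean_ball = I].
End Balls.

(* A finite regular cell complex with the intersection property.  The cells are
   indexed by [face]; [cint f] is the interior of the cell [cell f], i.e. the
   part of it that corresponds to the open ball. *)
Record cell_complex (R : realType) := CellComplex {
  space : topologicalType;
  face : finType;
  cell : face -> set space;
  cint : face -> set space;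
  fdim : face -> int;
  space_hausdorff : hausdorff_space space;
  cell_inj : injective cell;
  cell_closed : forall f, closed (cell f);
  cell_ball : forall f,
    [/\ cell f = set0, cint f = set0 & fdim f = -1] \/
    exists2 m : nat, fdim f = m%:Z & ball_cell R m (cell f) (cint f);
  cint_partition : forall x, exists! f, cint f x;
  cell_boundary : forall f, exists D : set face,
    ~ D f /\ cell f `\` cint f = \bigcup_(g in D) cell g;
  cell_empty : exists f, cell f = set0;
  cell_inter : forall f g, exists h, cell h = cell f `&` cell g
}.

Section CellComplexTheory.
Variables (R : realType) (G : cell_complex R).

Definition vertex : finType := {f : face G | fdim f == 0}.

Definition vset (f : face G) : {set vertex} :=
  [set v : vertex | `[< cell (val v) `<=` cell f >]].

Lemma vset_sub (f g : face G) : cell f `<=` cell g -> vset f \subset vset g.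
Proof.
move=> fg; apply/fintype.subsetP => v; rewrite !inE => vf x.
by move/vf/fg.
Qed.

(* [eps f' f] is the coefficient of [f'] in the boundary of [f], in the
   augmented oriented chain complex. *)
Record incidence := Incidence {
  eps :> face G -> face G -> int;
  eps_val : forall f' f, [|| eps f' f == -1, eps f' f == 0 | eps f' f == 1];
  eps_neq0 : forall f' f,
    eps f' f <> 0 <-> fdim f' = fdim f - 1 /\ cell f' `<=` cell f;
  eps_vertex : forall e v, cell e = set0 -> fdim v = 0 -> eps e v = 1;
  eps_eps : forall f'' f, \sum_f' eps f'' f' * eps f' f = 0
}.

End CellComplexTheory.

Definition mklin (k : fieldType) (U W : lmodType k) (f : U -> W)
  (h : linear f) : {linear U -> W} := HB.pack f (GRing.isLinear.Build k U W *:%R f h).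

Record submodule (k : fieldType) (L : lmodType k) := Submodule {
  spred :> L -> bool;
  spredP : submod_closed spred
}.
HB.instance Definition _ k L (I : @submodule k L) :=
  GRing.isSubmodClosed.Build k L I (spredP I).

Definition sub_of k L (I : @submodule k L) : Type := {x : L | spred I x}.
HB.instance Definition _ k L (I : @submodule k L) :=
  [isSub of sub_of I for @sval L (spred I)].
HB.instance Definition _ k L (I : @submodule k L) := [Choice of sub_of I by <:].
HB.instance Definition _ k L (I : @submodule k L) :=
  [SubChoice_isSubLmodule of sub_of I by <:].

Definition quot_of k L (I : @submodule k L) : Type :=
  Quotient.quot (GRing.ZmodClosed.clone L (spred I) _).
HB.instance Definition _ k L (I : @submodule k L) := GRing.Zmodule.on (quot_of I).

Section QuotLmod.
Variables (k : fieldType) (L : lmodType k) (I : submodule L).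

Definition qclass (x : L) : quot_of I := (\pi_(quot_of I) x)%qT.
Definition qrepr (q : quot_of I) : L := repr q.

Lemma qreprK q : qclass (qrepr q) = q. Proof. exact: reprK. Qed.

Lemma qclass_eq x y : (qclass x == qclass y) = (x - y \in spred I).
Proof. by rewrite -Quotient.idealrBE. Qed.

Lemma qclassD x y : qclass (x + y) = qclass x + qclass y.
Proof. by rewrite /qclass !piE. Qed.

Let qscale (a : k) (q : quot_of I) : quot_of I := qclass (a *: qrepr q).

Let qscaleE a x : qscale a (qclass x) = qclass (a *: x).
Proof.
by apply/eqP; rewrite qclass_eq -scalerBr rpredZ // -qclass_eq qreprK.
Qed.

Let qscaleA a b q : qscale a (qscale b q) = qscale (a * b) q.
Proof. by rewrite -[q]qreprK !qscaleE scalerA. Qed.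
Let qscale1 : left_id 1 qscale.
Proof. by move=> q; rewrite -[q]qreprK qscaleE scale1r. Qed.
Let qscaleDr : right_distributive qscale +%R.
Proof.
by move=> a p q; rewrite -[p]qreprK -[q]qreprK -qclassD !qscaleE scalerDr qclassD.
Qed.
Let qscaleDl q : {morph qscale^~ q : a b / a + b}.
Proof. by move=> a b; rewrite -[q]qreprK !qscaleE scalerDl qclassD. Qed.

HB.instance Definition _ := GRing.Zmodule_isLmodule.Build k (quot_of I)
  qscaleA qscale1 qscaleDr qscaleDl.

Lemma qclassZ a x : qclass (a *: x) = a *: qclass x.
Proof. by rewrite -qscaleE. Qed.

Lemma qclass_eq0 x : (qclass x == 0) = (x \in spred I).
Proof.
have -> : 0 = qclass 0 by rewrite -[0 in RHS](scale0r 0) qclassZ scale0r.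
by rewrite qclass_eq subr0.
Qed.
End QuotLmod.

Section QuotMap.
Variables (k : fieldType) (L L' : lmodType k).
Variables (I : submodule L) (I' : submodule L') (f : {linear L -> L'}).
Hypothesis fI : forall x, x \in spred I -> f x \in spred I'.

Let qf (q : quot_of I) : quot_of I' := qclass I' (f (qrepr q)).

Let qfE x : qf (qclass I x) = qclass I' (f x).
Proof.
by apply/eqP; rewrite qclass_eq -linearB; apply: fI; rewrite -qclass_eq qreprK.
Qed.

Let qf_linear : linear qf.
Proof.
move=> a p q; rewrite -[p]qreprK -[q]qreprK -qclassZ -qclassD !qfE.
by rewrite linearP qclassD qclassZ.
Qed.

Definition quot_map : {linear quot_of I -> quot_of I'} := mklin qf_linear.

Lemma quot_mapE x : quot_map (qclass I x) = qclass I' (f x).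
Proof. exact: qfE. Qed.
End QuotMap.

Section SubMap.
Variables (k : fieldType) (L L' : lmodType k).
Variables (I : submodule L) (I' : submodule L') (f : {linear L -> L'}).
Hypothesis fI : forall x, spred I x -> spred I' (f x).

Let sf (x : sub_of I) : sub_of I' := exist _ (f (sval x)) (fI (svalP x)).

Let sf_linear : linear sf.
Proof. by move=> a x y; apply: val_inj; rewrite /= linearP. Qed.

Definition sub_map : {linear sub_of I -> sub_of I'} := mklin sf_linear.

Lemma sub_mapE x : val (sub_map x) = f (val x). Proof. by []. Qed.
End SubMap.

Section DProd.
Variables (k : fieldType) (T : Type) (M : T -> lmodType k).
Definition dprod := forall t, M t.
HB.instance Definition _ := gen_eqMixin dprod.
HB.instance Definition _ := gen_choiceMixin dprod.
Let add (f g : dprod) : dprod := fun t => f t + g t.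
Let opp (f : dprod) : dprod := fun t => - f t.
Let zero : dprod := fun t => 0.
Let scale (a : k) (f : dprod) : dprod := fun t => a *: f t.
Let addA : associative add.
Proof. by move=> f g h; apply: functional_extensionality_dep => t; apply: addrA. Qed.
Let addC : commutative add.
Proof. by move=> f g; apply: functional_extensionality_dep => t; apply: addrC. Qed.
Let add0 : left_id zero add.
Proof. by move=> f; apply: functional_extensionality_dep => t; apply: add0r. Qed.
Let addN : left_inverse zero opp add.
Proof. by move=> f; apply: functional_extensionality_dep => t; apply: addNr. Qed.
HB.instance Definition _ := GRing.isZmodule.Build dprod addA addC add0 addN.
Let scaleA a b f : scale a (scale b f) = scale (a * b) f.
Proof. by apply: functional_extensionality_dep => t; apply: scalerA. Qed.
Let scale1 : left_id 1 scale.
Proof. by move=> f; apply: functional_extensionality_dep => t; apply: scale1r. Qed.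
Let scaleDr : right_distributive scale +%R.
Proof. by move=> a f g; apply: functional_extensionality_dep => t; apply: scalerDr. Qed.
Let scaleDl f : {morph scale^~ f : a b / a + b}.
Proof. by move=> a b; apply: functional_extensionality_dep => t; apply: scalerDl. Qed.
HB.instance Definition _ := GRing.Zmodule_isLmodule.Build k dprod
  scaleA scale1 scaleDr scaleDl.
Lemma dprodDE (f g : dprod) t : (f + g) t = f t + g t. Proof. by []. Qed.
Lemma dprodZE a (f : dprod) t : (a *: f) t = a *: f t. Proof. by []. Qed.
Lemma dprod0E t : (0 : dprod) t = 0. Proof. by []. Qed.
End DProd.

Section Multidegrees.
Variable V : finType.
Definition mdeg := {ffun V -> nat}.
Definition mle (b c : mdeg) : bool := [forall v, (b v <= c v)%N].
Definition madd (b c : mdeg) : mdeg := [ffun v => (b v + c v)%N].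
Definition supp (b : mdeg) : {set V} := [set v | (b v != 0)%N].
Definition charv (F : {set V}) : mdeg := [ffun v => (v \in F) : nat].
Definition madd1 (v : V) (b : mdeg) : mdeg := [ffun w => (b w + (w == v))%N].
Definition msub1 (v : V) (b : mdeg) : mdeg := [ffun w => (b w - (w == v))%N].

Implicit Types b c d : mdeg.
Lemma mleP b c : reflect (forall v, (b v <= c v)%N) (mle b c).
Proof. exact: forallP. Qed.
Lemma mle_refl b : mle b b. Proof. exact/mleP. Qed.
Lemma mle_trans b c d : mle b c -> mle c d -> mle b d.
Proof. by move=> /mleP bc /mleP cd; apply/mleP => v; apply: leq_trans (cd v). Qed.
Lemma mle_add2r a b c : mle b c -> mle (madd b a) (madd c a).
Proof. by move=> /mleP bc; apply/mleP => v; rewrite !ffunE leq_add2r. Qed.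
Lemma mle_add2l a b c : mle b c -> mle (madd a b) (madd a c).
Proof. by move=> /mleP bc; apply/mleP => v; rewrite !ffunE leq_add2l. Qed.
Lemma mle_add1 v b : mle b (madd1 v b).
Proof. by apply/mleP => w; rewrite ffunE leq_addr. Qed.
Lemma mle_sub1 v b : mle (msub1 v b) b.
Proof. by apply/mleP => w; rewrite ffunE leq_subr. Qed.
Lemma mle_charv (F F' : {set V}) : F \subset F' -> mle (charv F) (charv F').
Proof.
move=> /fintype.subsetP FF'; apply/mleP => v; rewrite !ffunE.
by case: (boolP (v \in F)) => // /FF' ->.
Qed.
Lemma mle_suppC b c : mle b c -> mle (charv (~: supp c)) (charv (~: supp b)).
Proof.
move=> /mleP bc; apply: mle_charv; apply/fintype.subsetP => v; rewrite !inE !negbK.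
by move=> /eqP cv; move: (bc v); rewrite cv leqn0.
Qed.
End Multidegrees.
Arguments charv {V}.

Section GradedModules.
Variables (k : fieldType) (V : finType).

(* An [N^V]-graded [S]-module is given by its homogeneous components and, for
   [b <= c], the multiplication by the monomial [x^(c-b)] from degree [b] to
   degree [c]. *)
Record gmod := Gmod {
  gcomp :> mdeg V -> lmodType k;
  gmul : forall b c, mle b c -> {linear gcomp b -> gcomp c};
  gmul_id : forall b (bb : mle b b) x, gmul bb x = x;
  gmul_comp : forall b c d (bc : mle b c) (cd : mle c d) (bd : mle b d) x,
    gmul cd (gmul bc x) = gmul bd x
}.

Definition xmul (M : gmod) (v : V) (b : mdeg V) : {linear M b -> M (madd1 v b)} :=
  gmul M (mle_add1 v b).

Record ghom (M N : gmod) := Ghom {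
  hcomp :> forall b, {linear M b -> N b};
  hcomp_gmul : forall b c (bc : mle b c) x,
    hcomp c (gmul M bc x) = gmul N bc (hcomp b x)
}.

Definition gisom (M N : gmod) : Prop :=
  exists f : ghom M N, forall b, bijective (f b).

Definition square_free (M : gmod) : Prop :=
  forall v b, v \in supp b -> bijective (xmul M v b).

(* [\bigoplus_j S e_j] with [e_j] in degree [deg j]: the function [u] in degree
   [b] stands for [\sum_j u_j x^(b - deg j) e_j]. *)
Section Free.
Variables (J : finType) (deg : J -> mdeg V).

Definition free_pred (b : mdeg V) (u : {ffun J -> k^o}) : bool :=
  [forall j, (u j != 0) ==> mle (deg j) b].

Lemma free_predP b (u : {ffun J -> k^o}) :
  reflect (forall j, u j != 0 -> mle (deg j) b) (free_pred b u).
Proof. by apply: (iffP forallP) => H j; [exact/implyP|apply/implyP; exact: H]. Qed.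

Lemma free_pred_closed b : submod_closed (free_pred b).
Proof.
split=> [|a u w /free_predP ub /free_predP wb]; apply/free_predP => j.
  by rewrite ffunE eqxx.
rewrite !ffunE; have [u0|/ub //] := eqVneq (u j) 0.
by rewrite u0 scaler0 add0r; apply: wb.
Qed.

Definition free_submod b := Submodule (free_pred_closed b).

Lemma free_pred_mle b c : mle b c -> forall u, free_pred b u -> free_pred c u.
Proof.
by move=> bc u /free_predP ub; apply/free_predP => j /ub jb; apply: mle_trans bc.
Qed.

Definition free_mul b c (bc : mle b c) :
    {linear sub_of (free_submod b) -> sub_of (free_submod c)} :=
  @sub_map k _ _ (free_submod b) (free_submod c) idfun (free_pred_mle bc).

Lemma free_mul_id b (bb : mle b b) x : free_mul bb x = x.
Proof. exact: val_inj. Qed.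

Lemma free_mul_comp b c d (bc : mle b c) (cd : mle c d) (bd : mle b d) x :
  free_mul cd (free_mul bc x) = free_mul bd x.
Proof. exact: val_inj. Qed.

Definition free_gmod : gmod := Gmod free_mul_id free_mul_comp.
End Free.

(* The homomorphism of free modules with matrix [a]:
   [e_j |-> \sum_j' a j' j x^(deg j - deg' j') e_j']. *)
Section FreeHom.
Variables (J J' : finType) (deg : J -> mdeg V) (deg' : J' -> mdeg V).
Variable a : J' -> J -> k.
Hypothesis aP : forall j' j, a j' j != 0 -> mle (deg' j') (deg j).

Let mx (u : {ffun J -> k^o}) : {ffun J' -> k^o} :=
  [ffun j' => \sum_j a j' j * u j].

Let mx_linear : linear mx.
Proof.
move=> c u w; apply/ffunP => j'; rewrite !ffunE scaler_sumr -big_split /=.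
apply: eq_bigr => j _; rewrite !ffunE mulrDr; congr (_ + _).
exact: mulrCA.
Qed.

Let mx_pred b u : free_submod deg b u -> free_submod deg' b (mklin mx_linear u).
Proof.
move=> /free_predP ub; apply/free_predP => j'; rewrite /= ffunE => s0.
have [[j]|s00] := pselect (exists j, a j' j * u j != 0).
  by rewrite mulf_eq0 negb_or => /andP[/aP jj' /ub]; apply: mle_trans.
case/eqP: s0; apply: big1 => j _; apply/eqP/negPn/negP => sj.
by apply: s00; exists j.
Qed.

Let mxb b : {linear free_gmod deg b -> free_gmod deg' b} := sub_map (@mx_pred b).

Let mxb_gmul b c (bc : mle b c) (x : free_gmod deg b) :
  mxb c (gmul (free_gmod deg) bc x) = gmul (free_gmod deg') bc (mxb b x).
Proof. exact: val_inj. Qed.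

Definition free_hom : ghom (free_gmod deg) (free_gmod deg') :=
  @Ghom (free_gmod deg) (free_gmod deg') mxb mxb_gmul.

Lemma free_homE b (x : free_gmod deg b) :
  val (free_hom b x) = [ffun j' => \sum_j a j' j * val x j].
Proof. by []. Qed.
End FreeHom.

Definition free_square_free (M : gmod) : Prop :=
  exists (J : finType) (F : J -> {set V}), gisom M (free_gmod (charv \o F)).

Definition omega : gmod := free_gmod (fun _ : unit => charv [set: V]).

Section GHom.
Variables M N : gmod.

Definition hom_pred (b : mdeg V)
    (f : dprod (fun a => ((M a -> N (madd a b)) : lmodType k))) : bool :=
  `[< (forall a, linear (f a)) /\
      (forall a c (ac : mle a c) x,
         f c (gmul M ac x) = gmul N (mle_add2r b ac) (f a x)) >].

Lemma hom_pred_closed b : submod_closed (@hom_pred b).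
Proof.
split=> [|t f g].
  apply/asboolP; split=> [a c x y|a c ac x].
    by rewrite -[RHS]/(c *: (0 : N (madd a b)) + 0) scaler0 addr0.
  by rewrite -[RHS]/(gmul N (mle_add2r b ac) 0) linear0.
move=> /asboolP[fl fn] /asboolP[gl gn]; apply/asboolP; split=> [a c x y|a c ac x].
  rewrite -[LHS]/(t *: f a (c *: x + y) + g a (c *: x + y)) fl gl.
  rewrite -[RHS]/(c *: (t *: f a x + g a x) + (t *: f a y + g a y)).
  by rewrite !scalerDr !scalerA mulrC -!addrA; congr (_ + _); rewrite addrCA.
rewrite -[LHS]/(t *: f c (gmul M ac x) + g c (gmul M ac x)).
rewrite fn gn -[RHS]/(gmul N (mle_add2r b ac) (t *: f a x + g a x)).
by rewrite linearP.
Qed.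

Definition hom_submod b := Submodule (@hom_pred_closed b).

Lemma hom_at0 b (f : sub_of (hom_submod b)) a : val f a 0 = 0.
Proof.
have /asboolP[fl _] := svalP f; have := fl a (-1) 0 0.
by rewrite scaler0 addr0 scaleN1r addNr.
Qed.

Let shift_fun b c (bc : mle b c)
    (f : dprod (fun a => ((M a -> N (madd a b)) : lmodType k))) :
    dprod (fun a => ((M a -> N (madd a c)) : lmodType k)) :=
  fun a x => gmul N (mle_add2l a bc) (f a x).

Let shift_linear b c (bc : mle b c) : linear (shift_fun bc).
Proof.
move=> t f g; apply: functional_extensionality_dep => a; apply/funext => x.
exact: linearP.
Qed.

Let shift_pred b c (bc : mle b c) f :
  hom_submod b f -> hom_submod c (mklin (shift_linear bc) f).
Proof.
move=> /asboolP[fl fn]; apply/asboolP; split=> [a t x y|a a' aa x] /=.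
  by rewrite /shift_fun fl linearP.
rewrite /shift_fun fn.
have le : mle (madd a b) (madd a' c).
  exact: mle_trans (mle_add2l a bc) (mle_add2r c aa).
by rewrite (gmul_comp _ _ le) (gmul_comp _ _ le).
Qed.

Definition gHom_mul b c (bc : mle b c) :
  {linear sub_of (hom_submod b) -> sub_of (hom_submod c)} :=
  sub_map (@shift_pred b c bc).

Lemma gHom_mul_id b (bb : mle b b) x : gHom_mul bb x = x.
Proof.
apply: val_inj; apply: functional_extensionality_dep => a; apply/funext => y.
exact: gmul_id.
Qed.

Lemma gHom_mul_comp b c d (bc : mle b c) (cd : mle c d) (bd : mle b d) x :
  gHom_mul cd (gHom_mul bc x) = gHom_mul bd x.
Proof.
apply: val_inj; apply: functional_extensionality_dep => a; apply/funext => y.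
exact: gmul_comp.
Qed.

(* [Hom_S(M, N)] is [Z^V]-graded; this is its part in degrees in [N^V]. *)
Definition gHom : gmod := Gmod gHom_mul_id gHom_mul_comp.
End GHom.

Section LinearDual.
Variable L : lmodType k.

Definition dual_pred (f : L -> k^o) : bool := `[< linear f >].

Lemma dual_pred_closed : submod_closed dual_pred.
Proof.
split=> [|t f g]; first by apply/asboolP => c x y;
  rewrite -[RHS]/(c *: (0 : k^o) + 0) scaler0 addr0.
move=> /asboolP fl /asboolP gl; apply/asboolP => c x y.
rewrite -[LHS]/(t *: f (c *: x + y) + g (c *: x + y)) fl gl.
rewrite -[RHS]/(c *: (t *: f x + g x) + (t *: f y + g y)).
by rewrite !scalerDr !scalerA mulrC -!addrA; congr (_ + _); rewrite addrCA.
Qed.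

Definition dual_submod := Submodule dual_pred_closed.
Definition dual : lmodType k := sub_of dual_submod.

Lemma dual_at0 (f : dual) : val f 0 = 0.
Proof.
by have /asboolP fl := svalP f; have := fl (-1) 0 0; rewrite scaler0 addr0 scaleN1r addNr.
Qed.
End LinearDual.

Section DualMap.
Variables (L L' : lmodType k) (h : {linear L -> L'}).

Let precomp (f : L' -> k^o) : L -> k^o := f \o h.

Let precomp_linear : linear precomp. Proof. by []. Qed.

Let precomp_pred f : dual_submod L' f -> dual_submod L (mklin precomp_linear f).
Proof.
by move=> /asboolP fl; apply/asboolP => c x y /=; rewrite /precomp /= linearP fl.
Qed.

Definition dual_map : {linear dual L' -> dual L} := sub_map precomp_pred.

Lemma dual_mapE f x : val (dual_map f) x = val f (h x). Proof. by []. Qed.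
End DualMap.

Section AlexanderDual.
Variable M : gmod.

Definition alex_comp (b : mdeg V) : lmodType k := dual (M (charv (~: supp b))).

Definition alex_mul b c (bc : mle b c) : {linear alex_comp b -> alex_comp c} :=
  dual_map (gmul M (mle_suppC bc)).

Lemma alex_mul_id b (bb : mle b b) x : alex_mul bb x = x.
Proof. by apply: val_inj; apply/funext => y; rewrite dual_mapE gmul_id. Qed.

Lemma alex_mul_comp b c d (bc : mle b c) (cd : mle c d) (bd : mle b d) x :
  alex_mul cd (alex_mul bc x) = alex_mul bd x.
Proof.
apply: val_inj; apply/funext => y; rewrite !dual_mapE; congr (val x _).
exact: gmul_comp.
Qed.

Definition alex : gmod := Gmod alex_mul_id alex_mul_comp.
End AlexanderDual.

Section AlexanderHom.
Variables (M N : gmod) (f : ghom M N).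

Let af b : {linear alex N b -> alex M b} := dual_map (f (charv (~: supp b))).

Let af_gmul b c (bc : mle b c) (x : alex N b) :
  af c (gmul (alex N) bc x) = gmul (alex M) bc (af b x).
Proof.
by apply: val_inj; apply/funext => y; rewrite !dual_mapE hcomp_gmul.
Qed.

Definition alex_hom : ghom (alex N) (alex M) := @Ghom (alex N) (alex M) af af_gmul.

Lemma alex_homE b x y : val (alex_hom b x) y = val x (f _ y).
Proof. by []. Qed.
End AlexanderHom.

Section GHomHom.
Variables (M M' N : gmod) (h : ghom M' M).

Let precomp b (f : dprod (fun a => ((M a -> N (madd a b)) : lmodType k))) :
    dprod (fun a => ((M' a -> N (madd a b)) : lmodType k)) :=
  fun a x => f a (h a x).

Let precomp_linear b : linear (@precomp b). Proof. by []. Qed.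

Let precomp_pred b f :
  hom_submod M N b f -> hom_submod M' N b (mklin (@precomp_linear b) f).
Proof.
move=> /asboolP[fl fn]; apply/asboolP.
split=> [a t x y|a a' aa x]; rewrite /= /precomp.
  by rewrite linearP fl.
by rewrite hcomp_gmul fn.
Qed.

Let gf b : {linear gHom M N b -> gHom M' N b} := sub_map (@precomp_pred b).

Let gf_gmul b c (bc : mle b c) (x : gHom M N b) :
  gf c (gmul (gHom M N) bc x) = gmul (gHom M' N) bc (gf b x).
Proof. exact: val_inj. Qed.

Definition gHom_hom : ghom (gHom M N) (gHom M' N) :=
  @Ghom (gHom M N) (gHom M' N) gf gf_gmul.

Lemma gHom_homE b x a y : val (gHom_hom b x) a y = val x a (h a y).
Proof. by []. Qed.
End GHomHom.

(* Cochain complexes; the differential [P i -> P (i + 1)] is [cdiff i (i + 1)],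
   and [cdiff i j] is zero for [j != i + 1]. *)
Record cochain := Cochain {
  cterm :> int -> gmod;
  cdiff : forall i j, ghom (cterm i) (cterm j);
  cdiff_shape : forall i j, j != i + 1 -> forall b x, cdiff i j b x = 0;
  cdiff_cdiff : forall i j l b x, cdiff j l b (cdiff i j b x) = 0
}.

Section Cohomology.
Variables (P : cochain) (i : int).

Definition cocycle_pred b (x : P i b) : bool := cdiff P i (i + 1) b x == 0.

Lemma cocycle_closed b : submod_closed (@cocycle_pred b).
Proof.
split=> [|a x y /eqP dx /eqP dy]; first by apply/eqP; rewrite linear0.
by apply/eqP; rewrite linearP dx dy scaler0 addr0.
Qed.

Definition cocycle b := Submodule (@cocycle_closed b).

Definition coboundary_pred b (z : sub_of (cocycle b)) : bool :=
  `[< exists y, cdiff P (i - 1) i b y = val z >].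

Lemma coboundary_closed b : submod_closed (@coboundary_pred b).
Proof.
split=> [|a x y]; first by apply/asboolP; exists 0; rewrite linear0.
move=> /asboolP[u ux] /asboolP[w wy]; apply/asboolP; exists (a *: u + w).
by rewrite linearP ux wy.
Qed.

Definition coboundary b := Submodule (@coboundary_closed b).

Definition cohom_comp b : lmodType k := quot_of (coboundary b).

Lemma cocycle_gmul b c (bc : mle b c) x :
  cocycle b x -> cocycle c (gmul (P i) bc x).
Proof. by move=> /eqP dx; apply/eqP; rewrite hcomp_gmul dx linear0. Qed.

Lemma coboundary_gmul b c (bc : mle b c) z :
  z \in spred (coboundary b) ->
  sub_map (cocycle_gmul bc) z \in spred (coboundary c).
Proof.
move=> /asboolP[y yz]; apply/asboolP; exists (gmul _ bc y).
by rewrite hcomp_gmul yz.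
Qed.

Definition cohom_mul b c (bc : mle b c) : {linear cohom_comp b -> cohom_comp c} :=
  quot_map (coboundary_gmul bc).

Lemma cohom_mul_id b (bb : mle b b) x : cohom_mul bb x = x.
Proof.
rewrite -[x]qreprK quot_mapE; congr qclass; apply: val_inj; exact: gmul_id.
Qed.

Lemma cohom_mul_comp b c d (bc : mle b c) (cd : mle c d) (bd : mle b d) x :
  cohom_mul cd (cohom_mul bc x) = cohom_mul bd x.
Proof.
rewrite -[x]qreprK; move: (qrepr x) => y; rewrite [cohom_mul bc _]quot_mapE !quot_mapE; congr qclass.
by apply: val_inj; exact: (gmul_comp bc cd bd).
Qed.

Definition cohom : gmod := Gmod cohom_mul_id cohom_mul_comp.
End Cohomology.

Record chom (P Q : cochain) := Chom {
  chcomp :> forall i, ghom (P i) (Q i);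
  chcomp_diff : forall i j b x,
    chcomp j b (cdiff P i j b x) = cdiff Q i j b (chcomp i b x)
}.

Section CohomologyMap.
Variables (P Q : cochain) (f : chom P Q) (i : int).

Lemma chom_cocycle b x : cocycle P i b x -> cocycle Q i b (f i b x).
Proof. by move=> /eqP dx; apply/eqP; rewrite -chcomp_diff dx linear0. Qed.

Lemma chom_coboundary b z :
  z \in spred (coboundary P i b) ->
  sub_map (@chom_cocycle b) z \in spred (coboundary Q i b).
Proof.
move=> /asboolP[y yz]; apply/asboolP; exists (f _ b y).
by rewrite -chcomp_diff yz.
Qed.

Definition cohom_map b : {linear cohom P i b -> cohom Q i b} :=
  quot_map (@chom_coboundary b).
End CohomologyMap.

Definition quasi_iso (P Q : cochain) (f : chom P Q) : Prop :=
  forall i b, bijective (cohom_map f i b).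

Definition bounded_free_square_free (P : cochain) : Prop :=
  (exists n : nat, forall i : int, (n < `|i|)%N -> forall b (x : P i b), x = 0) /\
  forall i, free_square_free (P i).

(* [y] lies in [m M], where [m = (x_v : v in V)] *)
Definition in_maximal (M : gmod) b (y : M b) : Prop :=
  exists z : forall v : V, M (msub1 v b),
    y = \sum_(v in supp b) gmul M (mle_sub1 v b) (z v).

(* The differentials of [k (x)_S P = P / m P] vanish. *)
Definition minimal_complex (P : cochain) : Prop :=
  forall i j b x, in_maximal (cdiff P i j b x).

Section DualComplexes.
Variable P : cochain.

Let oppS (i j : int) : j != i + 1 -> - i != - j + 1.
Proof.
by apply: contraNN => /eqP ij; rewrite -[i]opprK ij opprD opprK addrNK.
Qed.

Let alex_diff (i j : int) : ghom (alex (P (- i))) (alex (P (- j))) :=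
  alex_hom (cdiff P (- j) (- i)).

Let alex_shape (i j : int) : j != i + 1 -> forall b x, alex_diff i j b x = 0.
Proof.
move=> ij b x; apply: val_inj; apply/funext => y; rewrite alex_homE.
by rewrite cdiff_shape ?oppS // dual_at0.
Qed.

Let alex_dd (i j l : int) b x : alex_diff j l b (alex_diff i j b x) = 0.
Proof.
apply: val_inj; apply/funext => y; by rewrite !alex_homE cdiff_cdiff dual_at0.
Qed.

Definition alex_complex : cochain := Cochain alex_shape alex_dd.

Let Dterm (i : int) : gmod := gHom (P (- i)) omega.

Let Ddiff (i j : int) : ghom (Dterm i) (Dterm j) := gHom_hom omega (cdiff P (- j) (- i)).

Let Dshape (i j : int) : j != i + 1 -> forall b x, Ddiff i j b x = 0.
Proof.
move=> ij b x; apply: val_inj; apply: functional_extensionality_dep => a.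
by apply/funext => y; rewrite gHom_homE cdiff_shape ?oppS // hom_at0.
Qed.

Let Ddd (i j l : int) b x : Ddiff j l b (Ddiff i j b x) = 0.
Proof.
apply: val_inj; apply: functional_extensionality_dep => a.
by apply/funext => y; rewrite !gHom_homE cdiff_cdiff hom_at0.
Qed.

(* D(P) = Hom_S(P, omega_S).  Nothing is lost by the restriction to degrees in
   [N^V]: Hom_S(S(-F), S(-1)) = S(-(V \ F)). *)
Definition D_complex : cochain := Cochain Dshape Ddd.

(* P[-1]: a chain complex has P[-1]_i = P_(i-1), so here P[-1]^i = P^(i+1). *)
Let shift_shape (i j : int) : j != i + 1 ->
  forall b x, cdiff P (i + 1) (j + 1) b x = 0.
Proof. by move=> ij; apply: cdiff_shape; rewrite (inj_eq (addIr _)). Qed.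

Definition shift_complex : cochain :=
  @Cochain (fun i : int => P (i + 1)) (fun i j : int => cdiff P (i + 1) (j + 1))
    shift_shape (fun i j l => @cdiff_cdiff P (i + 1) (j + 1) (l + 1)).
End DualComplexes.

(* [Q] is the minimal free resolution A(P) of P^*; it is unique up to
   isomorphism *)
Definition is_A_complex (P Q : cochain) : Prop :=
  [/\ bounded_free_square_free Q, minimal_complex Q
    & exists f : chom Q (alex_complex P), quasi_iso f].
End GradedModules.

Section Enriched.
Variables (R : realType) (k : fieldType) (G : cell_complex R) (eps : incidence G).
Let V := vertex G.

Definition faces_of_dim (j : int) : finType := {f : face G | fdim f == j}.

Definition face_deg (j : int) (f : faces_of_dim j) : mdeg V := charv (vset (val f)).

Definition incidence_mx (i j : int) (f' : faces_of_dim j) (f : faces_of_dim i) : k :=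
  (eps (val f') (val f))%:~R.

Lemma incidence_mx_neq0 i j (f' : faces_of_dim j) (f : faces_of_dim i) :
  incidence_mx f' f != 0 ->
  fdim (val f') = fdim (val f) - 1 /\ cell (val f') `<=` cell (val f).
Proof.
move=> h; apply/(eps_neq0 eps) => e0; move: h.
by rewrite /incidence_mx e0 eqxx.
Qed.

Lemma incidence_mx_deg i j (f' : faces_of_dim j) (f : faces_of_dim i) :
  incidence_mx f' f != 0 -> mle (face_deg f') (face_deg f).
Proof. by move=> /incidence_mx_neq0[_ ff]; apply/mle_charv/vset_sub. Qed.

(* As a cochain complex, [E] has in degree [i] the faces of dimension [-i]. *)
Let Eterm (i : int) : gmod k V := free_gmod k (@face_deg (- i)).

Let Ediff (i j : int) : ghom (Eterm i) (Eterm j) :=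
  free_hom (@incidence_mx_deg (- i) (- j)).

Let Eshape (i j : int) : j != i + 1 -> forall b x, Ediff i j b x = 0.
Proof.
move=> ij b x; apply: val_inj; apply/ffunP => f'; rewrite free_homE !ffunE.
apply: big1 => f _; have [->|] := eqVneq (incidence_mx f' f) 0.
  by rewrite mul0r.
move=> /incidence_mx_neq0[ff _]; case/eqP: ij; apply: oppr_inj.
by rewrite -(eqP (valP f')) ff (eqP (valP f)) opprD.
Qed.

Lemma incidence_mx_mx i j l (f'' : faces_of_dim l) (f : faces_of_dim i) :
  \sum_(f' : faces_of_dim j) incidence_mx f'' f' * incidence_mx f' f = 0.
Proof.
have [ij|ij] := eqVneq j (i - 1); last first.
  apply: big1 => f' _; have [->|] := eqVneq (incidence_mx f' f) 0.
    by rewrite mulr0.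
  by move=> /incidence_mx_neq0[]; rewrite (eqP (valP f)) (eqP (valP f')) => /eqP;
    rewrite (negPf ij).
transitivity ((\sum_(g : face G) eps (val f'') g * eps g (val f))%:~R : k); last first.
  by rewrite eps_eps.
rewrite rmorph_sum /= (bigID (fun g : face G => fdim g == j)) /=.
rewrite [X in _ = _ + X]big1 ?addr0; last first.
  move=> g gj; suff -> : eps g (val f) = 0 by rewrite mulr0.
  apply/eqP/negPn/negP => /eqP/(eps_neq0 eps)[] gd _; case/eqP: gj.
  by rewrite gd (eqP (valP f)) ij.
rewrite (reindex_omap (val : faces_of_dim j -> face G) insub); last first.
  by move=> g gj; rewrite (insubT (fun g : face G => fdim g == j)).
apply: eq_big => [f'|f' _]; last by rewrite rmorphM.
by rewrite valK eqxx andbT (valP f').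
Qed.

Let Edd (i j l : int) b x : Ediff j l b (Ediff i j b x) = 0.
Proof.
apply: val_inj; apply/ffunP => f''; rewrite !free_homE !ffunE.
under eq_bigr do rewrite ffunE mulr_sumr.
rewrite exchange_big /= big1 // => f _.
under eq_bigr do rewrite mulrA.
by rewrite -mulr_suml incidence_mx_mx mul0r.
Qed.

Definition enriched : cochain k V := Cochain Eshape Edd.

Definition is_iface (i : int) (F : {set V}) : bool :=
  [exists f : face G, (vset f == F) && (#|F|%:Z == fdim f + i + 1)].

(* [K] is [k^i[Gamma]]: the square free module determined, up to isomorphism, by
   its components in the degrees [F] and the products [x_v e F]. *)
Definition is_k_module (i : int) (K : gmod k V) : Prop :=
  square_free K /\
  exists e : forall F : {set V}, K (charv F),
    [/\ forall F, is_iface i F ->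
          e F != 0 /\ forall x : K (charv F), exists a, x = a *: e F,
        forall F, ~~ is_iface i F -> forall x : K (charv F), x = 0
      & forall F v (FvF : mle (charv F) (charv (v |: F)%SET)), v \notin F ->
          is_iface i F -> is_iface i (v |: F)%SET ->
          gmul K FvF (e F) = e (v |: F)%SET].
End Enriched.

(* Main.v *)
(* For B a set of vertices, let T_B be the part in degree B of the dual of D(P).
   As P is free, T_B is P_V divided by the images of the P_(V - v), v in B, hence
   quasi-isomorphic to the total complex of the cube of the P_(V - A), A a subset
   of B.  As P resolves the dual of E[-1], P_(V - A) may be replaced in that cube
   by the cochains of the faces with vertices in A; the restriction maps of this
   cube are surjective, so that its total complex is, up to a shift by |B|, the
   complex of cochains on the faces with vertex set exactly B.  There is at most
   one such face, which gives the dimension of H(T_B).  The kernel of the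
   surjection T_F -> T_(F + v) is compared in the same way with the cochains on
   the faces with vertex set F or F + v; when both sets are faces of consecutive
   dimensions that complex is acyclic, so x_v : H(T_F) -> H(T_(F + v)) is
   injective.  A basis compatible with all these maps is obtained by removing from
   F all its apexes w (those for which F - w is also in the support of k^i),
   choosing a basis vector there and multiplying back.

   This uses that a maximal proper face of a face f has dimension dim f - 1,
   which is a consequence of the invariance of dimension. *)
Require Import Defs.
From mathcomp Require Import all_boot all_order all_algebra.
From mathcomp Require Import all_classical all_reals all_analysis.
From mathcomp Require Import ring lra zify.
Set Implicit Arguments.
Unset Strict Implicit.
Unset Printing Implicit Defensive.
Import Order.TTheory GRing.Theory Num.Theory.
Local Open Scope ring_scope.

(** * A cubical Sperner lemma *)

(** A cell complex relates the dimensions of a face and its subfaces only through the balls, and an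
    incidence function sees only pairs of faces whose dimensions differ by one. Topology must
    therefore exclude larger gaps. Two embeddings of open sets, one in each direction, do so once no
    open set of R^a embeds in R^b with b < a; this comes from a combinatorial statement on labelled
    cubes, which avoids the homology of spheres. Purity and [eps_eps] then show that vertex sets
    determine faces. On the algebraic side the obstacle is that quotients and kernels formed from P
    do not respect the quasi-isomorphism with the dual of E[-1], whereas mapping cones do. All
    complexes are therefore functors of a vertex set A, so that cones can be taken one vertex at a
    time and iterated. At A empty they compute H(T_F), and the same construction at A = {v} yields
    the kernel of x_v. Only acyclicity and one-dimensionality have to be carried along the resulting
    zigzag. *)

Lemma addF2 (x : 'F_2) : x + x = 0.
Proof. by rewrite -mulr2n -[x]mulr1 -mulrnAr pchar_Zp ?mulr0. Qed.

Lemma oppF2 (x : 'F_2) : - x = x.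
Proof. by apply/eqP; rewrite eq_sym -addr_eq0 addF2. Qed.

Section CupProduct.
Variables (a : nat).
Local Notation pt := (mdeg 'I_a).
Implicit Types (x y : pt) (J K : {set 'I_a}) (w : pt -> {set 'I_a} -> 'F_2).

(** In characteristic 2 the terms of (i, j) and (j, i) cancel. *)
Lemma sum_offdiag J (g : 'I_a -> 'I_a -> 'F_2) : (forall i j, g i j = g j i) ->
  \sum_(j in J) \sum_(i in J :\ j) g i j = 0.
Proof.
move=> gC.
transitivity (\sum_(j in J) (\sum_(i in J | (i < j)%N) g i j
                             + \sum_(i in J | (j < i)%N) g i j)).
  apply: eq_bigr => j jJ; rewrite (bigID (fun i : 'I_a => (i < j)%N)) /=.
  congr (_ + _); apply: eq_bigl => i; rewrite !inE -val_eqE /=; lia.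
rewrite big_split /= [X in _ + X](exchange_big_dep (mem J)) /=; last first.
  by move=> i j _ /andP[].
rewrite -[RHS](addF2 (\sum_(j in J) \sum_(i in J | (i < j)%N) g i j)).
congr (_ + _); apply: eq_bigr => j jJ; apply: eq_big => [i|i _]; rewrite ?jJ //.
Qed.

(** A cochain mod 2 on the unit cubes of the lattice: [w x J] is its value on the cube with lowest
    vertex [x] and directions [J]. Each direction contributes the two opposite facets. *)
Definition cobd w x J : 'F_2 :=
  \sum_(j in J) (w (madd1 j x) (J :\ j) + w x (J :\ j)).

Lemma madd1C i j x : madd1 i (madd1 j x) = madd1 j (madd1 i x).
Proof. by apply/ffunP => k; rewrite !ffunE; lia. Qed.

Lemma eq_cobd w w' : w =2 w' -> cobd w =2 cobd w'.
Proof. by move=> ww x J; apply: eq_bigr => j _; rewrite !ww. Qed.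

Lemma cobd_cobd w x J : cobd (cobd w) x J = 0.
Proof.
rewrite {1}/cobd -[RHS](@sum_offdiag J (fun i j =>
  w (madd1 i (madd1 j x)) (J :\ j :\ i) + w (madd1 j x) (J :\ j :\ i)
  + (w (madd1 i x) (J :\ j :\ i) + w x (J :\ j :\ i)))); last first.
  move=> i j; rewrite madd1C.
  have -> : J :\ i :\ j = J :\ j :\ i by rewrite !finset.setDDl finset.setUC.
  set A := w _ _; set B := w _ _; set C := w _ _; ring.
by apply: eq_bigr => j _; rewrite /cobd -big_split.
Qed.

Variable l : 'I_a -> pt -> 'F_2.

(* The cup product of the coboundaries of the [l i], [i] in [s], evaluated on
   the sum of the simplices of the cube with lowest vertex [x] and directions
   [J] in its standard triangulation. *)
Fixpoint cup (s : seq 'I_a) x J : 'F_2 :=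
  if s is i :: s' then
    \sum_(j in J) (l i (madd1 j x) + l i x) * cup s' (madd1 j x) (J :\ j)
  else 1.

(** The Leibniz rule: the difference of the two sides is [l i x] times the coboundary of [cup s],
    which vanishes. *)
Lemma cup_cobd i s : (forall x J, cobd (cup s) x J = 0) ->
  cup (i :: s) =2 cobd (fun x J => l i x * cup s x J).
Proof.
move=> ds x J; rewrite /= /cobd.
transitivity (cobd (fun x J => l i x * cup s x J) x J + l i x * cobd (cup s) x J).
  rewrite /cobd mulr_sumr -big_split /=.
  apply: eq_bigr => j _; rewrite mulrDl mulrDr -!addrA; congr (_ + _).
  by rewrite addrCA addF2 addr0.
by rewrite ds mulr0 addr0.
Qed.

Lemma cobd_cup s x J : cobd (cup s) x J = 0.
Proof.
elim: s x J => [|i s IHs] x J; first by rewrite /cobd big1 // => j _; rewrite addF2.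
by rewrite (eq_cobd (cup_cobd i IHs)) cobd_cobd.
Qed.

Definition in_cube x J y : Prop :=
  forall i, (x i <= y i <= x i + (i \in J))%N.

Lemma in_cube_madd1 x J j y : j \in J ->
  in_cube (madd1 j x) (J :\ j) y -> in_cube x J y.
Proof.
move=> jJ xy i; move: (xy i); rewrite ffunE !inE.
by case: eqVneq => [->|_] /=; rewrite ?jJ; lia.
Qed.

Lemma in_cube_self x J : in_cube x J x. Proof. by move=> i; lia. Qed.

Lemma in_cube_step x J j : j \in J -> in_cube x J (madd1 j x).
Proof. by move=> jJ; apply: (in_cube_madd1 jJ); apply: in_cube_self. Qed.

(** A nonzero term of the expanded product is a monotone path of edges in the cube, along which the
    labels of [s] change one after the other. *)
Lemma cup_neq0 s x J i : cup s x J != 0 -> i \in s ->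
  exists y y', [/\ in_cube x J y, in_cube x J y' & l i y != l i y'].
Proof.
elim: s x J => [//|i0 s IHs] x J /= h.
have [j jJ] : exists2 j, j \in J &
    (l i0 (madd1 j x) + l i0 x) * cup s (madd1 j x) (J :\ j) != 0.
  apply/exists_inP; apply: contraNT h; rewrite negb_exists_in => /forall_inP h.
  by rewrite big1 // => j /h /negPn/eqP.
rewrite mulf_eq0 negb_or => /andP[d0 c0]; rewrite inE => /orP[/eqP->|is_].
  exists (madd1 j x), x; split; [exact: in_cube_step|exact: in_cube_self|].
  by apply: contraNneq d0 => ->; rewrite addF2.
have [y [y' [xy xy' yy']]] := IHs _ _ c0 is_.
by exists y, y'; split=> //; apply: in_cube_madd1 jJ _.
Qed.

Section Box.
Variable N : nat.

(** The lowest vertices of the unit cubes with directions [J] in the face of [0, N]^a on which the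
    coordinates outside [J] equal [N]. *)
Definition box J (y : {ffun 'I_a -> 'I_N.+1}) : bool :=
  [forall j, (j \in J) == (y j < N)%N].

Lemma box_in J (y : {ffun 'I_a -> 'I_N.+1}) j : box J y -> j \in J -> (y j < N)%N.
Proof. by move=> /forallP/(_ j)/eqP <-. Qed.

Lemma box_out J (y : {ffun 'I_a -> 'I_N.+1}) j :
  box J y -> j \notin J -> y j = N :> nat.
Proof.
move=> /forallP/(_ j)/eqP -> /negPf yN; apply/eqP.
by rewrite eqn_leq -ltnS ltn_ord leqNgt yN.
Qed.

Definition pnt (y : {ffun 'I_a -> 'I_N.+1}) : pt := [ffun i => y i : nat].

Definition upd x j (t : nat) : pt := [ffun i => if i == j then t else x i].

(** Summation along the lines in direction [j]; each line is represented by its end point on the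
    wall where the coordinate [j] is [N]. *)
Lemma box_sum J j (F : pt -> 'F_2) : j \in J ->
  \sum_(y | box J y) F (pnt y) =
  \sum_(y | box (J :\ j) y) \sum_(0 <= t < N) F (upd (pnt y) j t).
Proof.
move=> jJ; pose up (y : {ffun 'I_a -> 'I_N.+1}) (t : 'I_N.+1) :
  {ffun 'I_a -> 'I_N.+1} := [ffun i => if i == j then t else y i].
transitivity (\sum_(y | box (J :\ j) y) \sum_(t : 'I_N.+1 | (t < N)%N)
                 F (pnt (up y t))).
  rewrite pair_big /= (reindex_onto (fun p => up p.1 p.2)
    (fun z => (up z ord_max, z j))) /=; last first.
    by move=> y _; apply/ffunP => i; rewrite !ffunE; case: eqVneq => // ->.
  apply: eq_bigl => -[y t] /=; rewrite xpair_eqE !ffunE eqxx eqxx andbT.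
  apply/andP/andP => [[/forallP by_ /eqP uy]|[/forallP by_ tN]].
    split; last by have := by_ j; rewrite jJ ffunE eqxx => /eqP <-.
    have yj : y j = ord_max by move/ffunP/(_ j): uy; rewrite !ffunE eqxx => <-.
    apply/forallP => i; have [->|ij] := eqVneq i j.
      by rewrite !inE eqxx yj /= ltnn.
    by have := by_ i; rewrite !inE ffunE (negPf ij).
  split; first apply/forallP => i.
    have [->|ij] := eqVneq i j; first by rewrite jJ ffunE eqxx tN.
    by have := by_ i; rewrite !inE ffunE (negPf ij).
  apply/eqP/ffunP => i; rewrite !ffunE; case: eqVneq => // ->.
  apply: val_inj => /=; have := by_ j; rewrite !inE eqxx /= => /eqP/esym/negbT.
  by have := ltn_ord (y j); lia.
apply: eq_bigr => y _; rewrite big_mkord (big_ord_widen N.+1 (fun t => F (upd (pnt y) j t))) //.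
apply: eq_bigr => t _; congr F; apply/ffunP => i; rewrite !ffunE; by case: eqP.
Qed.

(** Stokes' formula: along each direction [j] the sum telescopes to the walls at [N] and at 0. *)
Lemma box_cobd J w :
  \sum_(y | box J y) cobd w (pnt y) J =
  \sum_(j in J) \sum_(y | box (J :\ j) y)
     (w (pnt y) (J :\ j) + w (upd (pnt y) j 0) (J :\ j)).
Proof.
rewrite exchange_big /=; apply: eq_bigr => j jJ.
rewrite (box_sum (fun x => w (madd1 j x) (J :\ j) + w x (J :\ j)) jJ).
apply: eq_bigr => y by_.
have -> : pnt y = upd (pnt y) j N.
  apply/ffunP => i; rewrite !ffunE; case: eqVneq => // ->.
  by apply: box_out by_ _; rewrite !inE eqxx.
have uu t u : upd (upd (pnt y) j u) j t = upd (pnt y) j t.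
  by apply/ffunP => i; rewrite !ffunE; case: eqP.
transitivity (\sum_(0 <= t < N) (w (upd (pnt y) j t.+1) (J :\ j)
                                 - w (upd (pnt y) j t) (J :\ j))).
  apply: eq_bigr => t _; rewrite oppF2 !uu; congr (w _ _ + _).
  by apply/ffunP => i; rewrite !ffunE; case: eqP; lia.
by rewrite telescope_sumr // oppF2 uu.
Qed.

Hypothesis l0 : forall i x, x i = 0%N -> l i x = 0.
Hypothesis lN : forall i x, x i = N -> l i x = 1.

(** By Stokes' formula only walls contribute. On a wall in a direction [j] of [s] the label [l j] is
    constant, so the product vanishes by [cup_neq0]. In direction [i] the factor [l i] is 0 on one
    wall and 1 on the other, which leaves the sum for [s]. *)
Lemma box_cup s : uniq s ->
  \sum_(y | box [set j in s] y) cup s (pnt y) [set j in s] = 1.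
Proof.
elim: s => [_|i s IHs]; last rewrite cons_uniq => /andP[is_ us].
  rewrite (big_pred1 [ffun => ord_max]) // => y; apply/idP/eqP => [by_|->].
    apply/ffunP => j; rewrite ffunE; apply: val_inj => /=.
    by apply: box_out by_ _; rewrite inE.
  by apply/forallP => j; rewrite !inE ffunE /= ltnn.
under eq_bigr do rewrite (cup_cobd i (@cobd_cup s)).
rewrite box_cobd.
have cup0 j x K : j \in s -> j \notin K -> (x j == 0%N) || (x j == N) ->
    cup s x K = 0.
  move=> js jK xj; apply/eqP/negPn/negP => /cup_neq0 /(_ js)[y [y' [yx yx']]].
  have {yx}yj : y j = x j.
    by have := yx j; rewrite (negPf jK) addn0 andbC -eqn_leq => /eqP.
  have {yx'}yj' : y' j = x j.
    by have := yx' j; rewrite (negPf jK) addn0 andbC -eqn_leq => /eqP.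
  by case/orP: xj yj yj' => /eqP-> yj yj'; rewrite ?(l0 yj) ?(l0 yj')
    ?(lN yj) ?(lN yj') eqxx.
rewrite (bigD1 i) /=; last by rewrite !inE eqxx.
rewrite [X in _ + X]big1 ?addr0; last first.
  move=> j; rewrite !inE => /andP[/orP[->//|js] ji].
  have jJ : j \notin [set j in i :: s] :\ j by rewrite !inE eqxx.
  apply: big1 => y by_; have yj := box_out by_ jJ.
  by rewrite !(cup0 j) ?mulr0 ?addr0 // !ffunE ?eqxx ?yj ?eqxx ?orbT.
have -> : [set j in i :: s] :\ i = [set j in s].
  by apply/setP => j; rewrite !inE; case: eqVneq => // ->; rewrite (negPf is_).
rewrite -[RHS]IHs //; apply: eq_bigr => y by_.
have yi : y i = N :> nat by apply: box_out by_ _; rewrite inE.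
by rewrite lN ?mul1r ?l0 ?mul0r ?addr0 // !ffunE ?eqxx.
Qed.

Lemma cube_nonconstant : exists x,
  (forall i, x i < N)%N /\ forall i, exists y y',
    [/\ in_cube x [set: 'I_a] y, in_cube x [set: 'I_a] y' & l i y != l i y'].
Proof.
have := box_cup (enum_uniq 'I_a).
have -> : [set j in enum 'I_a] = [set: 'I_a].
  by apply/setP => j; rewrite !inE mem_enum.
move=> s1.
have [y by_ cy] : exists2 y, box [set: 'I_a] y & cup (enum 'I_a) (pnt y) [set: 'I_a] != 0.
  apply/exists_inP; apply: contraT; rewrite negb_exists_in => /forall_inP h.
  by move: s1; rewrite big1 => [/eqP|y /h /negPn/eqP //]; rewrite eq_sym oner_eq0.
exists (pnt y); split=> [i|i].
  by rewrite ffunE (box_in by_) ?inE.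
by apply: cup_neq0 cy _; rewrite mem_enum.
Qed.
End Box.
End CupProduct.

(** * Invariance of dimension *)

Section Dimension.
Import numFieldNormedType.Exports.
Local Open Scope classical_set_scope.
Variable R : realType.

Definition unit_cube a : set 'rV[R]_a := [set x | forall i, `[0, 1]%classic (x ord0 i)].

Lemma unit_cube_compact a : compact (@unit_cube a).
Proof. by apply: (@rV_compact R a (fun=> `[0, 1]%classic)) => i; exact: segment_compact. Qed.

Definition close a (x y : 'rV[R]_a) (e : R) : Prop :=
  forall i, `|x ord0 i - y ord0 i| < e.

Lemma near_rV a (x : 'rV[R]_a) e : 0 < e ->
  nbhs x [set y : 'rV[R]_a | close x y e].
Proof.
move=> e0; apply/nbhs_ballP; exists e => // y [_ xy] i.
exact: (xy ord0 i).
Qed.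

Lemma nbhs_rV a (x : 'rV[R]_a) (A : set 'rV[R]_a) : nbhs x A ->
  exists2 e, 0 < e & forall y, close x y e -> A y.
Proof.
move=> /nbhs_ballP[e e0 eA]; exists e => // y xy; apply: eA; split=> // i j.
by rewrite (ord1 i); exact: xy.
Qed.

Section Lowering.
Variables (a b : nat) (g : 'rV[R]_a -> 'I_b -> R).
Hypothesis gC : forall x, unit_cube x -> forall p, {for x, continuous (g^~ p)}.
Hypothesis gI : forall x y, unit_cube x -> unit_cube y -> g x =1 g y -> x = y.

Lemma near_g x e : unit_cube x -> 0 < e ->
  nbhs x [set y | forall p, `|g x p - g y p| < e].
Proof.
move=> Kx e0; have := @filter_forall _ 'I_b (fun p y => `|g x p - g y p| < e) (nbhs x).
apply => p.
by have /cvgrPdist_lt/(_ _ e0) := @gC x Kx p; apply: filterS.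
Qed.

Lemma unif_g e : 0 < e -> exists2 d, 0 < d & forall x y, unit_cube x ->
  close x y d -> forall p, `|g x p - g y p| < e.
Proof.
move=> e0.
have := (compact_near_coveringP _).1 (@unit_cube_compact a) R (0^'+)
  (fun d x => forall y, close x y d ->
                        forall p, `|g x p - g y p| < e) _.
case=> [x Kx|d d0 dP].
  have e20 : 0 < e / 2 by rewrite divr_gt0.
  have [r r0 rP] := nbhs_rV (near_g Kx e20).
  have r20 : 0 < r / 2 by rewrite divr_gt0.
  exists ([set y | close x y (r / 2)],
          [set d : R | d < r / 2]) => /=.
    split; first exact: near_rV.
    exact: nbhs_right_lt.
  move=> [x' d] /= [xx' dr] y x'y p.
  have h1 : `|g x p - g x' p| < e / 2.
    by apply: rP => i; have := xx' i; lra.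
  have h2 : `|g x p - g y p| < e / 2.
    apply: rP => i; have := xx' i; have := x'y i.
    have := ler_distD (x' ord0 i) (x ord0 i) (y ord0 i); lra.
  have := ler_distD (g x p) (g x' p) (g y p); rewrite (distrC (g x' p) (g x p)).
  lra.
(* The covering property gives the bound for all positive numbers below [d], hence for this one. *)
exists (d / 2); first by rewrite divr_gt0.
move=> x y Kx; apply: dP => //=; last by rewrite divr_gt0.
by rewrite sub0r normrN gtr0_norm ?divr_gt0 // ltr_pdivrMr // ltr_pMr // ltr1n.
Qed.

(** Compactness is used in [x], and for each [x] again in [y]. Near a pair with [x = y] the
    conclusion holds. Near a pair with [x != y] some coordinate of [g] has a gap, and a bound of a
    third of it contradicts the premise by the triangle inequality. *)
Lemma unif_inv e : 0 < e -> exists2 d, 0 < d & forall x y, unit_cube x ->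
  unit_cube y -> (forall p, `|g x p - g y p| < d) ->
  close x y e.
Proof.
move=> e0.
have := (compact_near_coveringP _).1 (@unit_cube_compact a) R (0^'+)
  (fun d x => forall y, unit_cube x -> unit_cube y -> (forall p, `|g x p - g y p| < d) ->
                        close x y e) _.
case=> [x Kx|d d0 dP]; last first.
  exists (d / 2); first by rewrite divr_gt0.
  move=> x y Kx; apply: dP => //=; last by rewrite divr_gt0.
  by rewrite sub0r normrN gtr0_norm ?divr_gt0 // ltr_pdivrMr // ltr_pMr // ltr1n.
have := (compact_near_coveringP _).1 (@unit_cube_compact a) ('rV[R]_a * R)%type
  (filter_prod (nbhs x) (0^'+))
  (fun xd y => unit_cube xd.1 -> (forall p, `|g xd.1 p - g y p| < xd.2) ->
               close xd.1 y e) _.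
case=> [y Ky|[A D] /= [xA dD] AD]; last first.
  by exists (A, D) => //= -[x' d] /= [Ax' Dd] y Kx' Ky; apply: (AD (x', d)).
have [<-|xy] := eqVneq x y.
  have e20 : 0 < e / 2 by rewrite divr_gt0.
  exists ([set y | close x y (e / 2)],
   [set xd : 'rV[R]_a * R | close x xd.1 (e / 2)]) => /=.
    split; first exact: near_rV.
    exists ([set y | close x y (e / 2)], setT) => /=.
      by split; [exact: near_rV|exact: filterT].
    by move=> [x' d] [].
  move=> [y' [x' d]] /= [xy' xx'] _ _ i.
  have := xy' i; have := xx' i.
  have := ler_distD (x ord0 i) (x' ord0 i) (y' ord0 i).
  rewrite (distrC (x' ord0 i) (x ord0 i)); lra.
have [p gxy] : exists p, g x p != g y p.
  apply/existsP; apply: contraT; rewrite negb_exists => /forallP h.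
  by case/eqP: xy; apply: gI => // p; apply/eqP/negPn/h.
have r0 : 0 < `|g x p - g y p| / 3 by rewrite divr_gt0 // normr_gt0 subr_eq0.
set r := _ / 3 in r0.
exists ([set y' | forall p, `|g y p - g y' p| < r],
   [set xd : 'rV[R]_a * R | (forall p, `|g x p - g xd.1 p| < r) /\ xd.2 < r]) => /=.
  split; first exact: near_g.
  exists ([set y' | forall p, `|g x p - g y' p| < r], [set d : R | d < r]) => /=.
    by split; [exact: near_g|exact: nbhs_right_lt].
  by move=> [x' d] [].
move=> [y' [x' d]] /= [yy' [xx' dr]] _ /(_ p) x'y'.
exfalso; have := yy' p; have := xx' p.
have := ler_distD (g x' p) (g x p) (g y p).
have := ler_distD (g y' p) (g x' p) (g y p).
rewrite (distrC (g y' p)).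
have : `|g x p - g y p| = 3 * r by rewrite /r mulrC divfK.
lra.
Qed.

Lemma floor_neq_between (u v z eta : R) : `|u - z| <= eta -> `|v - z| <= eta ->
  Num.floor u != Num.floor v -> exists q : int, `|z - q%:~R| <= eta.
Proof.
wlog uv : u v / Num.floor u < Num.floor v.
  move=> H uz vz uv; have [h|h|h] := ltgtP (Num.floor u) (Num.floor v).
  - exact: (H u v).
  - by apply: (H v u) => //; rewrite eq_sym.
  - by rewrite h eqxx in uv.
move=> uz vz _; exists (Num.floor v).
have : u < (Num.floor v)%:~R by rewrite -floor_lt_int.
have := floor_le v; move: uz vz; rewrite !ler_norml; lra.
Qed.

(* Suppose [b < a] and scale [g] so that points whose images lie in the same cell
   of a unit grid are at distance [< 1/2].  For each [i < a] take the grid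
   translated by [i/a] in all directions, and label [x] by whether the cell of
   [g x] contains the image of a point with [i]-th coordinate [>= 1/2].  Where all
   the labels change, every [i] has a coordinate [p < b] of [g x] within [1/(4a)]
   of a wall of the [i]-th grid; two [i] share the same [p], which is impossible
   since the walls of different grids are [1/a] apart. *)
Lemma dim_unit_cube : (a <= b)%N.
Proof.
rewrite leqNgt; apply/negP => ba.
have a0 : 0 < a%:R :> R by rewrite ltr0n; lia.
have [d d0 dP] : exists2 d, 0 < d & forall x y, unit_cube x ->
  unit_cube y -> (forall p, `|g x p - g y p| < d) ->
  close x y 2^-1 by apply: unif_inv; rewrite invr_gt0.
pose cell_of (i : 'I_a) x (p : 'I_b) := Num.floor (g x p / d - i%:R / a%:R).
pose L (i : 'I_a) (x : 'rV[R]_a) : bool :=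
  `[< exists x', [/\ unit_cube x', cell_of i x' =1 cell_of i x & 2^-1 <= x' ord0 i] >].
have cellP i x x' : unit_cube x -> unit_cube x' -> cell_of i x =1 cell_of i x' ->
    forall j, `|x ord0 j - x' ord0 j| < 2^-1.
  move=> Kx Kx' xx'; apply: dP => // p.
  have := xx' p; rewrite /cell_of => E.
  have := floor_itv (g x p / d - i%:R / a%:R).
  have := floor_itv (g x' p / d - i%:R / a%:R).
  rewrite -E intrD mulr1z; set f := (Num.floor _)%:~R => /andP[h1 h2] /andP[h3 h4].
  have : `|g x p / d - g x' p / d| < 1 by rewrite ltr_norml; lra.
  by rewrite -mulrBl normrM normfV (gtr0_norm d0) ltr_pdivrMr // mul1r.
pose eta : R := (4 * a%:R)^-1.
have eta0 : 0 < eta by rewrite invr_gt0 mulr_gt0.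
have [r r0 rP] := unif_g (mulr_gt0 eta0 d0).
(* The mesh [1 / N] is finer than [r], so within one lattice cube the coordinates of [g] divided by
   [d] move by less than [eta]. *)
pose N := (Num.truncn (r^-1)).+1.
have N0 : 0 < N%:R :> R by rewrite ltr0n.
have Nr : N%:R^-1 < r.
  rewrite -[r]invrK ltf_pV2 ?posrE ?invr_gt0 //.
  by rewrite /N; exact: truncnS_gt.
pose emb (x : mdeg 'I_a) : 'rV[R]_a := \row_i ((x i)%:R / N%:R).
(* The label is forced on the walls because [cube_nonconstant] prescribes it there at all lattice
   points, even those outside the cube. Inside the cube [L1] and [L0] show that it agrees with
   [L]. *)
have [||x [xN xP]] := @cube_nonconstant a 
  (fun i x => if L i (emb x) && (x i > 0)%N || (x i == N) then 1 else 0) N.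
- move=> i x xi; rewrite xi andbF /=; by [].
- by move=> i x ->; rewrite eqxx orbT.
have embK y : in_cube x [set: 'I_a] y -> unit_cube (emb y).
  move=> xy i; rewrite mxE /= in_itv /= divr_ge0 // ler_pdivrMr // mul1r ler_nat.
  have /andP[_ h] := xy i; apply: leq_trans h _; rewrite inE addn1; exact: xN.
have L1 y i : unit_cube (emb y) -> y i = N -> L i (emb y).
  move=> Ky yi; apply/asboolP; exists (emb y); split=> //.
  by rewrite mxE yi divff ?gt_eqF // invf_le1 // ler1n.
have L0 y i : unit_cube (emb y) -> y i = 0%N -> L i (emb y) = false.
  move=> Ky yi; apply/negP => /asboolP[x' [Kx' xx' h]].
  have := cellP i _ _ Kx' Ky xx' i; rewrite mxE yi mul0r subr0.
  by rewrite ltr_norml => /andP[_]; rewrite ltNge h.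
have near_emb y p t : in_cube x [set: 'I_a] y ->
    `|g (emb y) p / d - t - (g (emb x) p / d - t)| <= eta.
  move=> xy; rewrite ltW // opprB addrA subrK -mulrBl normrM normfV.
  rewrite (gtr0_norm d0) ltr_pdivrMr // distrC; apply: rP => [|j].
    exact: embK (in_cube_self _ _).
  apply: le_lt_trans Nr; rewrite !mxE -mulrBl normrM normfV (gtr0_norm N0).
  rewrite ler_pdivrMr // mulVf ?gt_eqF // distrC.
  have := xy j; rewrite inE => /andP[h1 h2]; rewrite -natrB // normr_nat.
  by rewrite -[1]/(1%:R) ler_nat leq_subLR.
have near_cell (i : 'I_a) : exists p, exists q : int,
    `|g (emb x) p / d - i%:R / a%:R - q%:~R| <= eta.
  have [y [y' [xy xy' yy']]] := xP i.
  have Ky := embK _ xy; have Ky' := embK _ xy'.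
  have Lyy' : L i (emb y) != L i (emb y').
    have Ly z : unit_cube (emb z) -> L i (emb z) && (z i > 0)%N || (z i == N) = L i (emb z).
      move=> Kz; case: (eqVneq (z i) N) => [/(L1 _ _ Kz)->|_]; first by rewrite orbT.
      rewrite orbF; case: (posnP (z i)) => [/(L0 _ _ Kz)->//|_]; exact: andbT.
    by apply: contraNneq yy' => E; rewrite !Ly // E.
  have [p cp] : exists p, cell_of i (emb y) p != cell_of i (emb y') p.
    apply/existsP; apply: contraT; rewrite negb_exists => /forallP h.
    case/eqP: Lyy'; apply: asbool_equiv_eq.
    have E : cell_of i (emb y) =1 cell_of i (emb y') by move=> p; apply/eqP/negPn/h.
    by split=> -[x' [Kx' xx' h']]; exists x'; split=> // p; rewrite xx' E.
  by exists p; apply: floor_neq_between cp; apply: near_emb.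
pose pf i := sval (cid (near_cell i)).
have pfP i : exists q : int, `|g (emb x) (pf i) / d - i%:R / a%:R - q%:~R| <= eta.
  exact: svalP (cid (near_cell i)).
have /leq_card : injective pf; last by rewrite !card_ord leqNgt ba.
move=> i i' pii'; have [q qP] := pfP i; have [q' q'P] := pfP i'.
rewrite -pii' in q'P.
apply/eqP/negPn/negP => ii'.
(* Multiplied by [a], this bounds the integer [i - i' + a (q - q')] by 1/2, although it is not
   divisible by [a]. *)
have : `|(i%:R - i'%:R + a%:R * (q - q')%:~R) / a%:R| <= 2 * eta :> R.
  rewrite mulrDl mulrAC divff ?gt_eqF // mul1r mulrBl intrB.
  move: qP q'P; rewrite !ler_norml; lra.
rewrite normrM normfV (gtr0_norm a0) ler_pdivrMr //.
have -> : 2 * eta * a%:R = 2^-1 by rewrite /eta; field; rewrite gt_eqF.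
have -> : i%:R - i'%:R + a%:R * (q - q')%:~R = (i%:Z - i'%:Z + a%:Z * (q - q'))%:~R :> R.
  by rewrite !rmorphB rmorphD /= rmorphB rmorphM /= rmorphB /= !pmulrn.
rewrite -intr_norm leNgt => /negP; apply.
apply: (@lt_le_trans _ _ 1); first lra.
rewrite -[1]/(1%:~R) ler_int.
have := ltn_ord i; have := ltn_ord i'; move: ii'; rewrite -val_eqE /= => h1 h2 h3.
rewrite -gtz0_ge1 normr_gt0; apply/eqP; move: (q - q') => k.
move: (nat_of_ord i) (nat_of_ord i') h1 h2 h3 => m m' /eqP mm' ma m'a E.
have [k1|[k0|k1]] : k <= -1 \/ k = 0 \/ 1 <= k by lia.
- have : a%:Z * k <= a%:Z * -1 by rewrite ler_wpM2l.
  lia.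
- by move: E; rewrite k0 mulr0; lia.
- have : a%:Z * 1 <= a%:Z * k by rewrite ler_wpM2l.
  lia.
Qed.
End Lowering.

Lemma dim_open a b (U : set 'rV[R]_a) (g : 'rV[R]_a -> 'I_b -> R) :
  open U -> U !=set0 ->
  (forall x, U x -> forall p, {for x, continuous (g^~ p)}) ->
  (forall x y, U x -> U y -> g x =1 g y -> x = y) -> (a <= b)%N.
Proof.
move=> oU [c Uc] gC gI; have [r r0 rU] := nbhs_rV (oU _ Uc).
pose A (t : 'rV[R]_a) := c + (r / 2) *: t.
have AU t : unit_cube t -> U (A t).
  move=> Kt; apply: rU => i; rewrite !mxE opprD addNKr normrN normrM.
  have /andP[t0 t1] := Kt i; rewrite !ger0_norm //; last by rewrite divr_ge0 // ltW.
  have : r / 2 * t ord0 i <= r / 2 * 1 by rewrite ler_wpM2l // divr_ge0 // ltW.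
  lra.
have AC : continuous A.
  move=> t; apply: (@continuousD _ _ _ (cst c) ( *:%R (r / 2)) t).
    exact: cst_continuous.
  exact: scaler_continuous.
apply: (@dim_unit_cube a b (g \o A)) => [x Kx p|x y Kx Ky /gI].
  apply: (@continuous_comp _ _ _ A (g^~ p)); first exact: AC.
  by apply: gC; exact: AU.
move=> /(_ (AU _ Kx) (AU _ Ky)) /addrI; apply: scalerI.
by rewrite gt_eqF // divr_gt0.
Qed.
End Dimension.

(** * Euclidean norm, radial projection and charts of cells *)

Section Continuity.
Import numFieldNormedType.Exports.
Local Open Scope classical_set_scope.
Variable R : realType.

Lemma continuous_rV (T : topologicalType) n (f : T -> 'rV[R]_n) (x : T) :
  (forall j, {for x, continuous (fun y => f y ord0 j)}) -> {for x, continuous f}.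
Proof.
move=> fj A /nbhs_rV[e e0 eA].
have : nbhs x (fun y => forall j, `|f x ord0 j - f y ord0 j| < e).
  have := @filter_forall _ 'I_n (fun j y => `|f x ord0 j - f y ord0 j| < e) (nbhs x).
  by apply=> j; have /cvgrPdist_lt/(_ _ e0) := fj j.
by apply: filterS => y h; apply: eA => j; exact: h.
Qed.

Lemma continuous_within_comp (Y X Z : topologicalType) (A : set X) (h : Y -> X)
    (f : X -> Z) (y : Y) :
  {within A, continuous f} -> {for y, continuous h} ->
  (\forall y' \near y, A (h y')) -> {for y, continuous (f \o h)}.
Proof.
move=> /subspace_continuousP fA hC hA B fB.
have := fA _ (nbhs_singleton hA) _ fB; rewrite /= /within /= => /hC h2.
by apply: filterS2 hA h2 => z /= Az; exact.
Qed.

Definition sq n (x : 'rV[R]_n) : R := \sum_j x ord0 j ^+ 2.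

Lemma sq_continuous n : continuous (@sq n).
Proof.
apply: continuous_big; first exact: add_continuous.
move=> j _ x; apply: (@continuous_comp _ _ _ (fun y : 'rV[R]_n => y ord0 j) (fun t => t ^+ 2)).
  exact: coord_continuous.
exact: exprn_continuous.
Qed.

Lemma sq_ge0 n (x : 'rV[R]_n) : 0 <= sq x.
Proof. by apply: sumr_ge0 => j _; exact: sqr_ge0. Qed.

Lemma sq0 n : sq (0 : 'rV[R]_n) = 0.
Proof. by rewrite /sq big1 // => j _; rewrite mxE expr0n. Qed.

Lemma sqZ n a (x : 'rV[R]_n) : sq (a *: x) = a ^+ 2 * sq x.
Proof. by rewrite /sq mulr_sumr; apply: eq_bigr => j _; rewrite mxE exprMn. Qed.

Definition enorm n (x : 'rV[R]_n) : R := Num.sqrt (sq x).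

Lemma enorm_continuous n : continuous (@enorm n).
Proof.
by move=> x; apply: (@continuous_comp _ _ _ (@sq n) Num.sqrt);
  [exact: sq_continuous|exact: sqrt_continuous].
Qed.

Lemma enormZ n a (x : 'rV[R]_n) : 0 <= a -> enorm (a *: x) = a * enorm x.
Proof. by move=> a0; rewrite /enorm sqZ sqrtrM ?sqr_ge0 // sqrtr_sqr ger0_norm. Qed.

Definition radial n (x : 'rV[R]_n) : 'rV[R]_n := (enorm x)^-1 *: x.

Lemma sq_radial n (x : 'rV[R]_n) : 0 < sq x -> sq (radial x) = 1.
Proof.
by move=> x0; rewrite sqZ exprVn sqr_sqrtr ?sq_ge0 // mulVf ?gt_eqF.
Qed.

Lemma radial_continuous n (x : 'rV[R]_n) : 0 < sq x ->
  {for x, continuous (@radial n)}.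
Proof.
move=> x0; apply: continuous_rV => j; rewrite /radial.
rewrite (_ : (fun y => _) = (fun y : 'rV[R]_n => (enorm y)^-1 * y ord0 j)); last first.
  by apply/funext => y; rewrite mxE.
apply: (@continuousM R _ (fun y : 'rV[R]_n => (enorm y)^-1)
  (fun y : 'rV[R]_n => y ord0 j) x); last exact: coord_continuous.
apply: continuousV; first by rewrite gt_eqF // sqrtr_gt0.
exact: enorm_continuous.
Qed.
End Continuity.

Section BallCell.
Import numFieldNormedType.Exports.
Local Open Scope classical_set_scope.
Variables (R : realType) (X : topologicalType).

Lemma ball_cell_chart m (A I : set X) : ball_cell R m A I ->
  exists (phi : 'rV[R]_m -> X) (psi : X -> 'rV[R]_m),
  [/\ {within @euclidean_ball R m, continuous phi} /\ {within A, continuous psi},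
      forall x, sq x <= 1 -> A (phi x) /\ psi (phi x) = x,
      forall y, A y -> sq (psi y) <= 1 /\ phi (psi y) = y
    & forall y, A y -> (I y <-> sq (psi y) < 1)].
Proof.
move=> [phi [psi [phiC psiC K E I_]]]; exists phi, psi.
have phiK x : sq x <= 1 -> psi (phi x) = x by move=> x1; apply: K; rewrite inE.
split=> // [x x1|y|y].
- by split; [rewrite -E; exists x|exact: phiK].
- by rewrite -E => -[x x1 <-]; rewrite phiK.
- rewrite -E -I_ => -[x x1 <-]; rewrite phiK //; split=> [[x' x'1 xx']|x1'].
    by rewrite -(phiK x) // -xx' phiK // ltW.
  by exists x.
Qed.
End BallCell.

(** * Faces of a cell complex *)

Section Cells.
Import numFieldNormedType.Exports.
Local Open Scope classical_set_scope.
Variables (R : realType) (G : cell_complex R).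
Implicit Types (f g h : face G).

Definition subface f g : bool := `[< cell f `<=` cell g >].

Lemma subfaceP f g : reflect (cell f `<=` cell g) (subface f g).
Proof. exact: asboolP. Qed.

Lemma subface_refl f : subface f f. Proof. exact/subfaceP. Qed.

Lemma subface_trans g f h : subface f g -> subface g h -> subface f h.
Proof. by move=> /subfaceP fg /subfaceP gh; apply/subfaceP => x /fg /gh. Qed.

Lemma subface_anti f g : subface f g -> subface g f -> f = g.
Proof.
by move=> /subfaceP fg /subfaceP gf; apply: (@cell_inj R G); apply/seteqP.
Qed.

(** The measure is the number of subfaces: that the dimension is monotone is itself proved by this
    induction, in [fdim_lt]. *)
Lemma face_ind (P : face G -> Prop) :
  (forall f, (forall g, subface g f -> g != f -> P g) -> P f) -> forall f, P f.
Proof.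
move=> IH f; have [n] := ubnP #|[pred g | subface g f]|.
elim: n f => // n IHn f /ltnSE fn; apply: IH => g gf gNf; apply: IHn.
apply: leq_trans fn; apply: proper_card; apply/properP; split.
  by apply/fintype.subsetP => h hg; apply: subface_trans hg gf.
exists f; first exact: subface_refl.
by apply: contraNN gNf => /(subface_anti gf) ->.
Qed.

Lemma max_proper_face f g : subface g f -> g != f ->
  exists h, [/\ subface g h, subface h f, h != f &
    forall h', subface h h' -> subface h' f -> h' != f -> h' = h].
Proof.
move=> gf gNf.
have [|h /and3P[gh hf hNf] hmax] := @arg_maxnP _ g
  (fun h => [&& subface g h, subface h f & h != f])
  (fun h => #|[pred h' | subface h' h]|); first by rewrite subface_refl gf.
exists h; split=> // h' hh' h'f h'Nf; apply: contraTeq isT => h'Nh.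
have : (#|[pred x | subface x h']| <= #|[pred x | subface x h]|)%N.
  by apply: hmax; rewrite (subface_trans gh hh') h'f.
rewrite leqNgt => /negP; case; apply: proper_card; apply/properP; split.
  by apply/fintype.subsetP => x xh; apply: subface_trans xh hh'.
exists h'; first exact: subface_refl.
by apply: contraNN h'Nh => /subface_anti/(_ hh') ->.
Qed.

Lemma cellP f : (cell f = set0 /\ fdim f = -1) \/
  exists2 m : nat, fdim f = m%:Z & ball_cell R m (cell f) (cint f).
Proof. by case: (cell_ball f) => [[]|]; [left|right]. Qed.

Lemma cint_cell f : cint f `<=` cell f.
Proof.
case: (cell_ball f) => [[_ -> _]//|[m _ [phi [psi [_ _ _ <- <-]]]]].
by move=> _ [x x1 <-]; exists x => //; apply: ltW.
Qed.

Lemma cell_cint x f : cell f x -> exists2 g, subface g f & cint g x.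
Proof.
elim/face_ind: f => f IH fx; have [D [fD bD]] := cell_boundary f.
have [fx'|fx'] := pselect (cint f x); first by exists f; rewrite ?subface_refl.
have [g Dg gx] : (\bigcup_(g in D) cell g) x by rewrite -bD.
have gf : subface g f.
  apply/subfaceP => y gy; have : (\bigcup_(g in D) cell g) y by exists g.
  by rewrite -bD => -[].
have gNf : g != f by apply/eqP => gf'; apply: fD; rewrite -gf'.
have [h hg hx] := IH g gf gNf gx.
by exists h; rewrite ?(subface_trans hg).
Qed.

Lemma cint_subface x f g : cint f x -> cell g x -> subface f g.
Proof.
move=> fx /cell_cint[h hg hx]; have [e [_ eu]] := cint_partition x.
by rewrite -(eu _ fx) (eu _ hx).
Qed.

Lemma cell_proper f g x : subface g f -> g != f -> cell g x -> ~ cint f x.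
Proof.
move=> gf gNf gx fx; case/eqP: gNf; apply: subface_anti => //.
exact: cint_subface fx gx.
Qed.

Section Purity.
Variables (f h : face G) (m m' : nat).
Hypotheses (transf_at : ball_cell R m (cell f) (cint f))
  (hm : ball_cell R m' (cell h) (cint h)).
Hypotheses (hf : subface h f) (hNf : h != f)
  (hmax : forall h', subface h h' -> subface h' f -> h' != f -> h' = h).

(* The interior of [h] is the trace on the boundary of [f] of this open set. *)
Let O : set (Defs.space G) :=
  ~` \bigcup_(g in [set g | [/\ subface g f, g != f & g != h]]) cell g.

Let openO : open O.
Proof.
apply: closed_openC; apply: closed_bigcup => [|g _]; last exact: cell_closed.
exact: finite_finset.
Qed.

Let bd_cell x : cell f x -> ~ cint f x -> O x -> cell h x.
Proof.
move=> fx fx' Ox; have [g gf gx] := cell_cint fx.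
have [<-|gh] := eqVneq g h; first exact: cint_cell.
case: Ox; exists g; last exact: cint_cell.
by split=> //; apply: contra_not_neq fx' => <-.
Qed.

Let cint_O x : cint h x -> O x.
Proof.
move=> hx [g [gf gNf gh] gx]; case/eqP: gh.
exact: hmax (cint_subface hx gx) gf gNf.
Qed.

(* [x |-> (psi_h (phi_f (x / |x|)), |x|)] embeds an open set of [R^m] in [R^(m'+1)]. *)
Lemma maximal_dim_ge : (m <= m'.+1)%N.
Proof.
have [phi [psi [[phiC psiC] phiK psiK cintE]]] := ball_cell_chart transf_at.
have [phi' [psi' [[phiC' psiC'] phiK' psiK' cintE']]] := ball_cell_chart hm.
pose q (x : 'rV[R]_m) := phi (radial x).
pose U : set 'rV[R]_m := [set x | 0 < sq x /\ O (q x)].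
pose gg (x : 'rV[R]_m) (p : 'I_m'.+1) : R :=
  if unlift ord_max p is Some j then psi' (q x) ord0 j else enorm x.
have sq_pos x : 0 < sq x -> nbhs x [set y : 'rV[R]_m | 0 < sq y].
  by move=> x0; exact: (@sq_continuous R m x _ (lt_nbhsr x0)).
have qC x : 0 < sq x -> {for x, continuous q}.
  move=> x0; apply: (continuous_within_comp phiC); first exact: radial_continuous.
  by apply: filterS (sq_pos _ x0) => y y0; rewrite /euclidean_ball /= -/(sq _) sq_radial.
have qh x : U x -> cell h (q x).
  move=> [x0 Ox]; have [r1 r2] : cell f (q x) /\ psi (q x) = radial x by apply: phiK; rewrite sq_radial.
  by apply: bd_cell => // /(cintE _ r1); rewrite r2 sq_radial // ltxx.
have oU : open U.
  rewrite openE => x [x0 Ox]; have := qC _ x0 _ (open_nbhs_nbhs (conj openO Ox)).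
  by apply: filterS2 (sq_pos _ x0) => y y0 Oy.
apply: (@dim_open R m m'.+1 U gg oU).
(* The centre of [h] lies on the boundary of [f], so its coordinate in the chart of [f] has norm 1
   and is a point of [U]. *)
- have [hy0 y0K] : cell h (phi' 0) /\ psi' (phi' 0) = 0.
    by apply: phiK'; rewrite sq0.
  have hy : cint h (phi' 0) by apply/(cintE' _ hy0); rewrite y0K sq0.
  have fy : cell f (phi' 0) by move/subfaceP: hf; apply.
  have s1 : sq (psi (phi' 0)) = 1.
    apply/eqP; rewrite eq_le (psiK _ fy).1 /= leNgt; apply/negP.
    by move/(cintE _ fy); exact: cell_proper hf hNf hy0.
  exists (psi (phi' 0)); split; rewrite /= ?s1 //.
  rewrite /q /radial /enorm s1 sqrtr1 invr1 scale1r (psiK _ fy).2.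
  exact: cint_O.
- move=> x Ux p; rewrite /gg; case: unliftP => [j _|_]; last exact: enorm_continuous.
  apply: (@continuous_comp _ _ _ (psi' \o q) (fun y : 'rV[R]_m' => y ord0 j)).
    apply: (continuous_within_comp psiC'); first by apply: qC; case: Ux.
    by apply: filterS (open_nbhs_nbhs (conj oU Ux)) => y; apply: qh.
  exact: coord_continuous.
- move=> x y Ux Uy E; have [x0 _] := Ux; have [y0 _] := Uy.
  have nE : enorm x = enorm y by have := E ord_max; rewrite /gg unlift_none.
  have : psi' (q x) = psi' (q y).
    by apply/rowP => j; have := E (lift ord_max j); rewrite /gg liftK.
  move=> /(congr1 phi'); rewrite !(psiK' _ (qh _ _)).2 // => /(congr1 psi).
  rewrite !(phiK _ _).2 ?sq_radial // /radial nE; apply: scalerI.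
  by rewrite invr_eq0 gt_eqF // sqrtr_gt0.
Qed.

(* [(u, t) |-> t psi_f (phi_h u)] embeds an open set of [R^(m'+1)] in [R^m]. *)
Lemma maximal_dim_le : (m'.+1 <= m)%N.
Proof.
have [phi [psi [[phiC psiC] phiK psiK cintE]]] := ball_cell_chart transf_at.
have [phi' [psi' [[phiC' psiC'] phiK' psiK' cintE']]] := ball_cell_chart hm.
pose u (w : 'rV[R]_(m'.+1)) : 'rV[R]_m' := \row_j w ord0 (lift ord_max j).
pose U : set 'rV[R]_(m'.+1) := [set w | sq (u w) < 1 /\ 0 < w ord0 ord_max].
pose gg (w : 'rV[R]_(m'.+1)) (p : 'I_m) : R := w ord0 ord_max * psi (phi' (u w)) ord0 p.
have uC : continuous u.
  move=> w; apply: continuous_rV => j.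
  rewrite (_ : (fun y => _) = (fun y : 'rV[R]_(m'.+1) => y ord0 (lift ord_max j))).
    exact: coord_continuous.
  by apply/funext => y; rewrite mxE.
have oU : open U.
  rewrite openE => w [w1 w0]; apply: filterI.
    have sC : {for w, continuous (@sq R m' \o u)}.
      by apply: continuous_comp; [exact: uC|exact: sq_continuous].
    exact: (sC _ (lt_nbhsl w1)).
  exact: (@coord_continuous R _ _ ord0 ord_max w _ (lt_nbhsr w0)).
have fh y : sq y < 1 -> cell f (phi' y) /\ sq (psi (phi' y)) = 1.
  move=> y1; have [hy _] := phiK' _ (ltW y1).
  have fy : cell f (phi' y) by move/subfaceP: hf; apply.
  split=> //; apply/eqP; rewrite eq_le (psiK _ fy).1 /= leNgt; apply/negP.
  by move/(cintE _ fy); exact: cell_proper hf hNf hy.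
apply: (@dim_open R m'.+1 m U gg oU).
- exists (\row_j (j == ord_max)%:R); split; rewrite /= ?mxE ?eqxx //.
  rewrite (_ : u _ = 0) ?sq0 //.
  by apply/rowP => j; rewrite !mxE eq_sym (negPf (neq_lift _ _)).
- move=> w [w1 w0] p.
  apply: (@continuousM R _ (fun w : 'rV[R]_(m'.+1) => w ord0 ord_max)
    (fun w => psi (phi' (u w)) ord0 p) w); first exact: coord_continuous.
  apply: (@continuous_comp _ _ _ (psi \o (phi' \o u)) (fun y : 'rV[R]_m => y ord0 p)).
    apply: (continuous_within_comp psiC).
      apply: (continuous_within_comp phiC'); first exact: uC.
      have := open_nbhs_nbhs (conj oU (conj w1 w0 : U w)); apply: filterS => y [y1 _]; exact: ltW.
    have := open_nbhs_nbhs (conj oU (conj w1 w0 : U w)); apply: filterS => y [y1 _] /=; exact: (fh _ y1).1.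
  exact: coord_continuous.
- move=> w w' [w1 w0] [w'1 w'0] E.
  have sE : w ord0 ord_max *: psi (phi' (u w)) = w' ord0 ord_max *: psi (phi' (u w')).
    by apply/rowP => p; have := E p; rewrite /gg !mxE.
  have tE : w ord0 ord_max = w' ord0 ord_max.
    have := congr1 (@enorm R m) sE; rewrite !enormZ ?ltW //.
    by rewrite /enorm (fh _ w1).2 (fh _ w'1).2 sqrtr1 !mulr1.
  have : psi (phi' (u w)) = psi (phi' (u w')).
    by move: sE; rewrite tE; apply: scalerI; rewrite gt_eqF.
  move=> /(congr1 phi); rewrite !(psiK _ (fh _ _).1).2 // => /(congr1 psi').
  rewrite !(phiK' _ (ltW _)).2 // => uE.
  apply/rowP => j; case: (unliftP ord_max j) => [j' ->|-> //].
  by have /rowP/(_ j') := uE; rewrite !mxE.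
Qed.
End Purity.
End Cells.

(** * Dimensions and vertex sets of faces *)

Section FaceLattice.
Variables (R : realType) (G : cell_complex R).
Implicit Types (e f g h : face G).

Lemma maximal_dim f h : subface h f -> h != f ->
  (forall h', subface h h' -> subface h' f -> h' != f -> h' = h) ->
  fdim h = fdim f - 1.
Proof.
move=> hf hNf hmax; case: (cellP f) => [[f0 _]|[m -> transf_at]].
  case/eqP: hNf; apply: subface_anti => //; apply/subfaceP.
  by rewrite f0; exact: sub0set.
case: (cellP h) => [[h0 ->]|[m' -> hm]]; last first.
  by have := maximal_dim_ge transf_at hm hf hNf hmax; have := maximal_dim_le transf_at hm hf hNf; lia.
(* Here [h] is the empty face, which settles dimension 0. In positive dimension a boundary point of
   [f] lies in a proper face, which by maximality of [h] would be empty. *)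
case: m transf_at => [//|m] transf_at; exfalso.
have [phi [psi [_ phiK psiK cintE]]] := ball_cell_chart transf_at.
pose p : 'rV[R]_(m.+1) := \row_j (j == ord0)%:R.
have p1 : sq p = 1.
  rewrite /sq (bigD1 ord0) //= big1 ?addr0 ?mxE ?eqxx ?expr1n // => j /negPf j0.
  by rewrite mxE j0 expr0n.
have [fp pK] : cell f (phi p) /\ psi (phi p) = p by apply: phiK; rewrite p1.
have [g gf gp] := cell_cint fp.
have gE : g = h.
  apply: hmax => //; first by apply/subfaceP; rewrite h0; exact: sub0set.
  by apply: contraPneq gp => -> /(cintE _ fp); rewrite pK p1 ltxx.
by move: (cint_cell gp); rewrite gE h0.
Qed.

Lemma codim1_face g f : subface g f -> g != f ->
  exists h, [/\ subface g h, subface h f & fdim h = fdim f - 1].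
Proof.
move=> gf gNf; have [h [gh hf hNf hmax]] := max_proper_face gf gNf.
by exists h; split=> //; apply: maximal_dim.
Qed.

Lemma fdim_lt g f : subface g f -> g != f -> fdim g < fdim f.
Proof.
elim/face_ind: f => f IH gf gNf.
have [h [gh hf hd]] := codim1_face gf gNf.
have hNf : h != f by apply: contra_eq_neq hd => ->; lia.
have [->|gNh] := eqVneq g h; first by rewrite hd; lia.
by have := IH h hf hNf gh gNh; rewrite hd; lia.
Qed.

Lemma subface_dim_eq g f : subface g f -> fdim g = fdim f -> g = f.
Proof.
move=> gf d; apply/eqP; apply: contraT => gNf.
by have := fdim_lt gf gNf; rewrite d ltxx.
Qed.

Lemma face_meet f g : exists h,
  [/\ subface h f, subface h g & forall e, subface e f -> subface e g -> subface e h].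
Proof.
have [h hE] := @cell_inter R G f g; exists h.
split; [apply/subfaceP|apply/subfaceP|move=> e /subfaceP ef /subfaceP eg; apply/subfaceP];
  rewrite hE; [exact: subIsetl|exact: subIsetr|].
by move=> x ex; split; [exact: ef|exact: eg].
Qed.

Lemma in_vset (v : vertex G) f : (v \in vset f) = subface (val v) f.
Proof. by rewrite inE. Qed.

Lemma subface_vset f g : subface f g -> vset f \subset vset g.
Proof. by move/subfaceP; exact: vset_sub. Qed.

Section Incidence.
Variable eps : incidence G.

Lemma eps_codim1 h f : subface h f -> fdim h = fdim f - 1 -> eps h f != 0.
Proof. by move=> /subfaceP hf hd; apply/eqP/(eps_neq0 eps). Qed.

Lemma second_facet e h f : subface e h -> subface h f ->
  fdim e = fdim h - 1 -> fdim h = fdim f - 1 ->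
  exists h', [/\ h' != h, subface e h', subface h' f & fdim h' = fdim f - 1].
Proof.
move=> eh hf ed hd; have [[h' [h'h n0]]|none] :=
    pselect (exists h', h' != h /\ eps e h' * eps h' f != 0).
  move: n0; rewrite mulf_eq0 negb_or => /andP[/eqP/(eps_neq0 eps)[_ eh']].
  by move=> /eqP/(eps_neq0 eps)[h'd h'f]; exists h'; split=> //; exact/subfaceP.
have := eps_eps eps e f; rewrite (bigD1 h) //= big1 => [|h' h'h].
  by move/eqP; rewrite addr0 mulf_eq0 !(negPf (eps_codim1 _ _)).
by apply/eqP/negPn/negP => n0; apply: none; exists h'.
Qed.

(* Let [h] be a facet of [f].  As [eps] is a complex, a facet [e] of [h] lies in
   another facet [h'] of [f]; a vertex of [h'] that is not in the smaller face
   [h /\ h'] is not in [h]. *)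
Lemma vset_proper f h : subface h f -> h != f -> exists2 v, v \in vset f & v \notin vset h.
Proof.
elim/face_ind: f h => f IH h0 h0f h0Nf.
have [h [h0h hf hd]] := codim1_face h0f h0Nf.
suff [v vf vh] : exists2 v, v \in vset f & v \notin vset h.
  by exists v => //; apply: contraNN vh; apply/fintype.subsetP/subface_vset.
have [e0 e0E] := cell_empty G.
have e0P g : subface e0 g by apply/subfaceP; rewrite e0E; exact: sub0set.
have [d0|d0] := eqVneq (fdim f) 0.
  pose v : vertex G := Sub f (introT eqP d0).
  exists v; first by rewrite in_vset subface_refl.
  rewrite in_vset; apply/negP => /subface_anti/(_ hf) fh.
  by move: hd; rewrite [val v]/= in fh *; rewrite fh; lia.
have hNe : e0 != h.
  apply: contraNneq d0 => e0h; move: hd; rewrite -e0h.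
  case: (cellP e0) => [[_ ->]|[m _ em]]; first lia.
  have [phi [psi [_ phiK _ _]]] := ball_cell_chart em.
  by have [] := phiK 0; rewrite ?sq0 // e0E.
have [e [_ eh ed]] := codim1_face (e0P h) hNe.
have [h' [h'h eh' h'f h'd]] := second_facet eh hf ed hd.
have [g [gh gh' gP]] := face_meet h h'.
have h'Nf : h' != f by apply: contra_eq_neq h'd => ->; clear; lia.
have gNh' : g != h'.
  apply: contraNneq h'h => gE; rewrite gE in gh.
  by apply/eqP; apply: subface_dim_eq => //; rewrite h'd.
have [v vh' vg] := IH h' h'f h'Nf g gh' gNh'.
exists v; first exact: (fintype.subsetP (subface_vset h'f)).
by apply: contraNN vg; move: vh'; rewrite !in_vset => a b; exact: gP.
Qed.

(** Otherwise the intersection of [f] and [g] is a proper face of [f], and by [vset_proper] it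
    misses a vertex of [f]. *)
Lemma vset_subface f g : vset f \subset vset g -> subface f g.
Proof.
move=> /fintype.subsetP fg; have [h [hf hg hP]] := face_meet f g.
have [<-//|hNf] := eqVneq h f.
have [v vf] := vset_proper hf hNf; have := fg v vf.
by move: vf; rewrite !in_vset => vf vg /negP; case; apply: hP.
Qed.

Lemma vset_inj : injective (@vset R G).
Proof. by move=> f g E; apply: subface_anti; apply: vset_subface; rewrite E. Qed.

Lemma is_ifaceP i F : reflect (exists2 f : face G, vset f = F & #|F|%:Z = fdim f + i + 1)
  (is_iface i F).
Proof.
apply: (iffP existsP) => [[f /andP[/eqP fF /eqP c]]|[f fF c]]; exists f => //.
by rewrite fF c !eqxx.
Qed.

(** If [F] itself is in the support, the face on [F :\ w] is a facet of the face on [F], which thus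
    looks like a pyramid with apex [w]. These are the [w] for which x_w arrives in degree [F] from a
    nonzero component of [k^i]. *)
Definition apexes i (F : {set vertex G}) : {set vertex G} :=
  [set w in F | is_iface i (F :\ w)].

(* The set of the vertices of [F] that are not apexes is therefore the same for
   [F] and [v |: F]. *)
Lemma apexesU1 i (F : {set vertex G}) v : v \notin F -> is_iface i F -> is_iface i (v |: F) ->
  apexes i (v |: F) = v |: apexes i F.
Proof.
move=> vF iF ivF; have /is_ifaceP[f fE fd] := iF; have /is_ifaceP[f' f'E f'd] := ivF.
rewrite cardsU1 vF in f'd.
have ff' : subface f f' by apply: vset_subface; rewrite fE f'E finset.subsetUr.
apply/setP => w; rewrite !inE; have [->|wv] := eqVneq w v.
  by rewrite /= finset.setU1K ?iF.
rewrite /=; have [wF|//] := boolP (w \in F); rewrite /=.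
have FwE : (v |: F) :\ w = v |: F :\ w.
  by apply/setP => u; rewrite !inE; case: (eqVneq u v) => [->|//]; rewrite eq_sym wv.
have cF : #|F| = (1 + #|F :\ w|)%N by rewrite (cardsD1 w F) wF.
have vFw : v \notin F :\ w by rewrite !inE negb_and vF orbT.
rewrite FwE; apply/is_ifaceP/is_ifaceP => -[g gE gd].
(* The intersection [h] of [f] and [g] has vertex set [F :\ w]. A facet of [f] that contains [h]
   cannot contain [w], or it would be [f]; so it is [h], which gives the dimension. *)
- rewrite cardsU1 vFw in gd.
  have [h [hf hg hP]] := face_meet f g.
  have hE : vset h = F :\ w.
    apply/setP => u; rewrite [in LHS]in_vset; apply/idP/idP => [uh|].
      move: (subface_trans uh hf) (subface_trans uh hg).
      rewrite -!in_vset fE gE !inE => uF.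
      by rewrite uF !andbT => /orP[/eqP uv|//]; move: vF; rewrite -uv uF.
    rewrite in_setD1 => /andP[uw uF]; apply: hP; rewrite -in_vset ?fE ?gE //.
    by rewrite !inE uw uF orbT.
  exists h => //.
  have hNf : h != f.
    apply/eqP => hfE; move: hE; rewrite hfE fE => /setP/(_ w).
    by rewrite !inE eqxx wF.
  have [e [he ef ed]] := codim1_face hf hNf.
  suff -> : h = e by clear - fd cF ed; lia.
  apply: vset_inj; apply/eqP; rewrite finset.eqEsubset subface_vset //= hE.
  apply/fintype.subsetP => u ue; rewrite !inE -fE (fintype.subsetP (subface_vset ef)) // andbT.
  apply: contraTneq ue => ->; apply/negP => we.
  have : subface f e.
    apply: vset_subface; rewrite fE; apply/fintype.subsetP => x xF.
    have [->//|xw] := eqVneq x w; apply: (fintype.subsetP (subface_vset he)).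
    by rewrite hE !inE xw.
  by move=> /(subface_anti ef) eE; move: ed; rewrite eE; clear; lia.
(* Besides [f], a second facet [h] of [f'] contains [g]. It contains [v], or it would be inside [f],
   and it misses [w], or it would contain [f]; equality of dimensions excludes both. *)
- have gf : subface g f by apply: vset_subface; rewrite gE fE finset.subsetDl.
  have [h [hNf gh hf' hd]] : exists h, [/\ h != f, subface g h, subface h f' &
      fdim h = fdim f' - 1] by apply: second_facet gf ff' _ _; clear - fd f'd gd cF; lia.
  exists h; last by rewrite cardsU1 vFw; clear - f'd hd cF; lia.
  have /fintype.subsetP gh' := subface_vset gh.
  have /fintype.subsetP hf'' := subface_vset hf'; rewrite gE in gh'; rewrite f'E in hf''.
  have vh : v \in vset h.
    apply: contraNT hNf => vh; apply/eqP/subface_dim_eq; last by clear - fd f'd hd; lia.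
    apply: vset_subface; rewrite fE; apply/fintype.subsetP => u uh.
    by have := hf'' u uh; rewrite !inE => /orP[/eqP uv|//]; rewrite -uv uh in vh.
  have wh : w \notin vset h.
    apply/negP => wh; have : subface f h.
      apply: vset_subface; rewrite fE; apply/fintype.subsetP => u uF.
      by have [->//|uw] := eqVneq u w; apply: gh'; rewrite !inE uw.
    by move=> /subface_dim_eq fh; case/eqP: hNf; rewrite fh //; clear - fd f'd hd; lia.
  apply/setP => u; rewrite in_setU1 in_setD1.
  have [->|uv] := eqVneq u v; first by rewrite vh.
  apply/idP/idP => [uh|/andP[uw uF]]; last by apply: gh'; rewrite in_setD1 uw.
  have := hf'' u uh; rewrite in_setU1 (negPf uv) /= => ->; rewrite andbT.
  by apply: contraNneq wh => <-.
Qed.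
End Incidence.
End FaceLattice.

(** * Cones and quasi-isomorphisms *)

Section ZmodIdentities.
Variable V : zmodType.
Implicit Types a b c d : V.

Lemma sub_swap a b c d : a - b = c + d -> a - c = b + d.
Proof.
move/eqP; rewrite subr_eq => /eqP ->.
by rewrite [LHS]addrC -!addrA addKr addrC.
Qed.

Lemma sub_add_cancel a b c : a - b - (a + c) = - (c + b).
Proof. by rewrite opprD addrACA subrr add0r -opprD addrC. Qed.

Lemma sub_sub_eq a b c d e : a - b - c = d + e -> a = c + d + (b + e).
Proof.
move/eqP; rewrite !subr_eq => /eqP ->.
by rewrite -!addrA [RHS]addrCA; congr (_ + _); rewrite addrC -addrA.
Qed.
End ZmodIdentities.

Section Complexes.
Variable k : fieldType.

Record kcomplex := KComplex {
  kterm :> int -> lmodType k;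
  kdiff : forall n, {linear kterm n -> kterm (n + 1)};
  kdiff_kdiff : forall n x, kdiff (n + 1) (kdiff n x) = 0
}.

Record kmap (X Y : kcomplex) := KMap {
  kmap_at :> forall n, {linear X n -> Y n};
  kmap_diff : forall n x, kmap_at (n + 1) (kdiff X n x) = kdiff Y n (kmap_at n x)
}.

(** Injectivity and surjectivity on cohomology, stated on cocycles to avoid quotients. The degree in
    question is [n + 1], so that the incoming differential is [kdiff n] without a cast; [acyclic_at]
    and [one_dim_at] follow the same convention. *)
Definition qiso (X Y : kcomplex) (f : kmap X Y) : Prop := forall n,
  (forall x : X (n + 1), kdiff X (n + 1) x = 0 ->
     (exists y, f (n + 1) x = kdiff Y n y) -> exists z, x = kdiff X n z) /\
  (forall y : Y (n + 1), kdiff Y (n + 1) y = 0 ->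
     exists x w, kdiff X (n + 1) x = 0 /\ y = f (n + 1) x + kdiff Y n w).

Section Composition.
Variables (X Y Z : kcomplex) (f : kmap X Y) (g : kmap Y Z).

Let compd n x : [the {linear _ -> _} of g (n + 1) \o f (n + 1)] (kdiff X n x) =
  kdiff Z n ([the {linear _ -> _} of g n \o f n] x).
Proof. by rewrite /= !kmap_diff. Qed.

Definition kmap_comp : kmap X Z := KMap compd.

Lemma qiso_comp : qiso f -> qiso g -> qiso kmap_comp.
Proof.
move=> qf qg n; have [fi fs] := qf n; have [gi gs] := qg n; split.
  move=> x dx [z xz]; apply: fi => //; apply: gi; last by exists z.
  by rewrite -kmap_diff dx linear0.
move=> z dz; have [y [w [dy ->]]] := gs z dz; have [x [t [dx ->]]] := fs y dy.
by exists x, (g n t + w); split=> //; rewrite !linearD /= addrA kmap_diff.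
Qed.
End Composition.

Lemma qiso_bij (X Y : kcomplex) (f : kmap X Y) : (forall n, bijective (f n)) -> qiso f.
Proof.
move=> fb n; have [g gK fK] := fb n; have [g' g'K fK'] := fb (n + 1); split.
  by move=> x dx [y xy]; exists (g y); apply: (can_inj g'K); rewrite kmap_diff fK.
move=> y dy; have [h hK hK'] := fb (n + 1 + 1); exists (g' y), 0; split.
  by apply: (can_inj hK); rewrite kmap_diff fK' dy linear0.
by rewrite fK' linear0 addr0.
Qed.

Definition kmap_id (X : kcomplex) : kmap X X :=
  @KMap X X (fun n => idfun) (fun n x => erefl).

Lemma qiso_id X : qiso (kmap_id X).
Proof. by apply: qiso_bij => n; exists id. Qed.

Definition acyclic_at (X : kcomplex) n : Prop :=
  forall x : X (n + 1), kdiff X (n + 1) x = 0 -> exists z, x = kdiff X n z.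

Definition one_dim_at (X : kcomplex) n : Prop :=
  exists x0 : X (n + 1), [/\ kdiff X (n + 1) x0 = 0, ~ (exists z, x0 = kdiff X n z) &
    forall x, kdiff X (n + 1) x = 0 -> exists a z, x = a *: x0 + kdiff X n z].

Section QisoTransport.
Variables (X Y : kcomplex) (f : kmap X Y) (qf : qiso f) (n : int).

Lemma qiso_acyclic : acyclic_at X n <-> acyclic_at Y n.
Proof.
have [fi fs] := qf n; split=> [aX y dy|aY x dx].
  have [x [w [/aX[z ->] ->]]] := fs y dy.
  by exists (f n z + w); rewrite kmap_diff linearD.
by apply: fi => //; apply: aY; rewrite -kmap_diff dx linear0.
Qed.

Lemma qiso_one_dim : one_dim_at X n <-> one_dim_at Y n.
Proof.
have [fi fs] := qf n; split=> [[x0 [dx0 nx0 Xx0]]|[y0 [dy0 ny0 Yy0]]].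
  exists (f _ x0); split=> [||y dy].
  - by rewrite -kmap_diff dx0 linear0.
  - by move=> /(fi _ dx0).
  - have [x [w [/Xx0[a [z ->]] ->]]] := fs y dy; exists a, (f n z + w).
    by rewrite !linearD linearZ /= kmap_diff addrA.
have [x0 [w [dx0 y0E]]] := fs y0 dy0; exists x0; split=> // [[z x0z]|x dx].
  by apply: ny0; exists (f n z + w); rewrite y0E x0z kmap_diff linearD.
have /Yy0[a [z fxE]] : kdiff Y (n + 1) (f (n + 1) x) = 0 by rewrite -kmap_diff dx linear0.
have [||z' xE] := fi (x - a *: x0).
- by rewrite linearB linearZ /= dx dx0 scaler0 subr0.
- exists (a *: w + z); rewrite linearP linearB linearZ /= fxE y0E scalerDr.
  by apply/eqP; rewrite subr_eq -addrA; apply/eqP; exact: addrC.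
by exists a, z'; rewrite -xE addrCA subrr addr0.
Qed.
End QisoTransport.

Section Cone.
Variables (X Y : kcomplex) (f : kmap X Y).

Definition cone_ob (n : int) : lmodType k := (X (n + 1)%R * Y n)%type.

(* With the sign on the second component only, the kernel of [f] embeds in the
   cone without sign, while the map to the cokernel anticommutes with [kdiff]. *)
Let cone_fun n (p : cone_ob n) : cone_ob (n + 1) :=
  (kdiff X (n + 1) p.1, f (n + 1) p.1 - kdiff Y n p.2).

Let cone_lin n : linear (@cone_fun n).
Proof.
move=> a p q; rewrite /cone_fun [(_ + q).1]/= [(_ + q).2]/= !linearP.
congr (_, _) => /=.
by rewrite addrACA -scalerDr.
Qed.

Let cone_dd n x : mklin (@cone_lin (n + 1)) (mklin (@cone_lin n) x) = 0.
Proof.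
rewrite /= /cone_fun /= kdiff_kdiff linearB /= kmap_diff kdiff_kdiff subr0 subrr.
by [].
Qed.

Definition cone : kcomplex := KComplex cone_dd.

Lemma cone_dE n (p : cone n) :
  kdiff cone n p = (kdiff X (n + 1) p.1, f (n + 1) p.1 - kdiff Y n p.2).
Proof. by []. Qed.
End Cone.

Section ConeMap.
Variables (X Y X' Y' : kcomplex) (f : kmap X Y) (f' : kmap X' Y').
Variables (u : kmap X X') (w : kmap Y Y').
Hypothesis wf : forall n x, w n (f n x) = f' n (u n x).

Let cmf n (p : cone f n) : cone f' n := (u (n + 1) p.1, w n p.2).

Let cmf_lin n : linear (@cmf n).
Proof. by move=> a p q; rewrite /cmf !linearP. Qed.

Let cmfd n x : mklin (@cmf_lin (n + 1)) (kdiff (cone f) n x) =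
  kdiff (cone f') n (mklin (@cmf_lin n) x).
Proof. by rewrite !cone_dE /= /cmf /= linearB /= !kmap_diff wf. Qed.

Definition cone_map : kmap (cone f) (cone f') := KMap cmfd.

(** The five lemma for the long exact sequences of the two cones, carried out on elements. *)
Lemma cone_qiso : qiso u -> qiso w -> qiso cone_map.
Proof.
move=> qu qw n; have [ui1 us1] := qu (n + 1); have [ui us] := qu n.
have [wi ws] := qw n; have [wi1 _] := qw (n + 1); split.
  move=> [a b]; rewrite cone_dE /= => -[da /eqP]; rewrite subr_eq0 => /eqP fa.
  move=> [[a' b']] /= [ua wb].
  have [|z az] := ui1 a da; first by exists a'.
  have [|x [w' [dx zE]]] := us (u _ z - a').
    by rewrite linearB /= -kmap_diff -az ua subrr.
  have [||y by_] := wi (b - f _ (z - x)).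
  - by rewrite linearB /= -kmap_diff linearB /= dx subr0 -az fa subrr.
  - exists (- (f' _ w' + b')).
    rewrite linearB /= wb wf linearB /=.
    rewrite (sub_swap zE) linearD /= kmap_diff sub_add_cancel [RHS]linearN.
    by congr (- _); rewrite linearD.
  exists (z - x, - y); rewrite ?cone_dE /= linearB /= dx subr0 -az; congr (_, _).
  by rewrite linearN opprK -by_ addrCA subrr addr0.
move=> [a' b']; rewrite cone_dE /= => -[da' /eqP]; rewrite subr_eq0 => /eqP fa'.
have [x [w' [dx a'E]]] := us1 a' da'.
have [||y fxE] := wi1 (f _ x).
- by rewrite -kmap_diff dx linear0.
- exists (b' - f' _ w'); rewrite wf linearB /= -fa' a'E linearD /= kmap_diff addrK //.
have [|y2 [v [dy2 bE]]] := ws (b' - f' _ w' - w _ y).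
  rewrite !linearB /= -fa' a'E linearD /= -!kmap_diff addrK -fxE wf subrr //.
exists (x, y + y2), (w', - v); rewrite /=; split.
  by rewrite dx linearD /= dy2 addr0 fxE subrr.
rewrite a'E; congr (_, _); rewrite /cmf /= linearD [kdiff _ _ (- v)]linearN opprK.
exact: sub_sub_eq bE.
Qed.
End ConeMap.

Section ConeOfSurjection.
Variables (K X Y : kcomplex) (f : kmap X Y) (kap : forall n, {linear K n -> X (n + 1)}).
Hypothesis f_surj : forall n y, exists x, f n x = y.
Hypothesis kap_inj : forall n, injective (kap n).
Hypothesis f_kap : forall n y, f (n + 1) (kap n y) = 0.
Hypothesis f_ker : forall n x, f (n + 1) x = 0 -> exists y, kap n y = x.
Hypothesis kapd : forall n y, kap (n + 1) (kdiff K n y) = kdiff X (n + 1) (kap n y).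

Let kf n (y : K n) : cone f n := (kap n y, 0).

Let kf_lin n : linear (@kf n).
Proof. by move=> a p q; rewrite /kf linearP; congr (_, _); rewrite /= scaler0 addr0. Qed.

Let kfd n y : mklin (@kf_lin (n + 1)) (kdiff K n y) = kdiff (cone f) n (mklin (@kf_lin n) y).
Proof. by rewrite cone_dE /= /kf /= kapd f_kap linear0 subr0. Qed.

Definition to_cone : kmap K (cone f) := KMap kfd.

Lemma to_coneE n y : to_cone n y = (kap n y, 0). Proof. by []. Qed.

(** The second component of a cone element lifts along [f]; subtracting the boundary of the lift
    moves a cocycle into the kernel. *)
Lemma to_cone_qiso : qiso to_cone.
Proof.
move=> n; split.
  move=> y dy [[a b]]; rewrite ?to_coneE cone_dE /= => -[ya /esym/eqP].
  rewrite subr_eq0 => /eqP fa; have [b' b'E] := f_surj b.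
  have [|z zE] := @f_ker n (a - kdiff X n b').
    by rewrite linearB /= kmap_diff b'E fa subrr.
  exists z; apply: kap_inj; rewrite kapd zE linearB /= kdiff_kdiff subr0; exact: ya.
move=> [a b]; rewrite cone_dE /= => -[da /eqP]; rewrite subr_eq0 => /eqP fa.
have [b' b'E] := f_surj b.
have [|y yE] := @f_ker (n + 1) (a - kdiff X (n + 1) b').
  by rewrite linearB /= kmap_diff b'E fa subrr.
exists y, (b', 0); rewrite /= linear0 subr0 b'E; split.
  by apply: kap_inj; rewrite kapd yE linearB /= kdiff_kdiff da subrr linear0.
by rewrite /kf yE; congr (_, _); rewrite /= ?subrK ?add0r.
Qed.
End ConeOfSurjection.

Section ConeOfInjection.
Variables (X Y Z : kcomplex) (f : kmap X Y) (pr : forall n, {linear Y n -> Z n}).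
Hypothesis f_inj : forall n, injective (f n).
Hypothesis pr_surj : forall n z, exists y, pr n y = z.
Hypothesis pr_f : forall n x, pr n (f n x) = 0.
Hypothesis pr_ker : forall n y, pr n y = 0 -> exists x, f n x = y.
Hypothesis prd : forall n y, pr (n + 1) (kdiff Y n y) = - kdiff Z n (pr n y).

Let pf n (p : cone f n) : Z n := pr n p.2.

Let pf_lin n : linear (@pf n).
Proof. by move=> a p q; rewrite /pf linearP. Qed.

Let pfd n y : mklin (@pf_lin (n + 1)) (kdiff (cone f) n y) = kdiff Z n (mklin (@pf_lin n) y).
Proof. by rewrite cone_dE /= /pf /= linearB /= pr_f prd sub0r opprK. Qed.

Definition of_cone : kmap (cone f) Z := KMap pfd.

(** A cocycle of the cokernel lifts to [Y]; the boundary of the lift comes from [X] and supplies the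
    first component. *)
Lemma of_cone_qiso : qiso of_cone.
Proof.
move=> n; split.
  move=> [a b]; rewrite cone_dE /= => -[da /eqP]; rewrite subr_eq0 => /eqP fa.
  rewrite /= /pf /= => -[z bz]; have [y yz] := pr_surj z.
  have [|x xE] := @pr_ker (n + 1) (b + kdiff Y n y).
    by rewrite linearD /= prd bz yz subrr.
  exists (x, y); rewrite /= xE addrK; congr (_, _).
  by apply: f_inj; rewrite kmap_diff xE linearD /= kdiff_kdiff addr0.
move=> z dz; have [b bz] := pr_surj z.
have [|a aE] := @pr_ker (n + 1 + 1) (kdiff Y (n + 1) b).
  by rewrite prd bz dz oppr0.
exists (a, b), 0; rewrite /= /pf /= bz aE subrr linear0 addr0; split=> //.
congr (_, _); apply: f_inj; by rewrite kmap_diff aE kdiff_kdiff linear0.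
Qed.
End ConeOfInjection.
End Complexes.

(** * Iterated cones of functors on vertex sets *)

Section Functors.
Variables (k : fieldType) (V : finType).
Implicit Types (A B C : {set V}) (v : V) (s : seq V).

(* A contravariant functor from the subsets of [V] to complexes; the multidegree
   corresponding to [A] is the complement of [A]. *)
Record functor := MkFunctor {
  functor_ob :> {set V} -> kcomplex k;
  functor_res : forall A B, B \subset A -> kmap (functor_ob A) (functor_ob B);
  functor_res_comp : forall A B C (BA : B \subset A) (CB : C \subset B) (CA : C \subset A) n x,
    functor_res CB n (functor_res BA n x) = functor_res CA n x
}.

Record transf (F H : functor) := MkTransf {
  transf_at :> forall A, kmap (F A) (H A);
  transf_nat : forall A B (BA : B \subset A) n x,
    transf_at B n (functor_res F BA n x) = functor_res H BA n (transf_at A n x)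
}.

Definition transf_id (F : functor) : transf F F :=
  @MkTransf F F (fun A => kmap_id (F A)) (fun A B BA n x => erefl).

Section Composition.
Variables (F H K : functor) (f : transf F H) (g : transf H K).

Let comp_nat A B (BA : B \subset A) n x :
  kmap_comp (f B) (g B) n (functor_res F BA n x) =
  functor_res K BA n (kmap_comp (f A) (g A) n x).
Proof. by rewrite /= !transf_nat. Qed.

Definition transf_comp : transf F K := MkTransf comp_nat.
End Composition.

Section FCone.
Variables (v : V) (F : functor).

Lemma sub_add1 A : A \subset (v |: A)%SET. Proof. exact: finset.subsetUr. Qed.
Lemma sub_add1S A B : B \subset A -> (v |: B)%SET \subset (v |: A)%SET.
Proof. exact: finset.setUS. Qed.

Let cob A : kcomplex k := cone (functor_res F (sub_add1 A)).

Let cres_square A B (BA : B \subset A) n x :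
  functor_res F BA n (functor_res F (sub_add1 A) n x) =
  functor_res F (sub_add1 B) n (functor_res F (sub_add1S BA) n x).
Proof.
have BvA : B \subset (v |: A)%SET := fintype.subset_trans BA (sub_add1 A).
by rewrite !(functor_res_comp _ _ BvA).
Qed.

Let cres A B (BA : B \subset A) : kmap (cob A) (cob B) :=
  cone_map (@cres_square A B BA).

Let cres_comp A B C (BA : B \subset A) (CB : C \subset B) (CA : C \subset A) n x :
  cres CB n (cres BA n x) = cres CA n x.
Proof. by case: x => a b; congr (_, _); apply: functor_res_comp. Qed.

Definition functor_cone : functor := MkFunctor cres_comp.
End FCone.

Section FConeMor.
Variables (v : V) (F H : functor) (f : transf F H).

Let cmor A : kmap (functor_cone v F A) (functor_cone v H A) :=
  cone_map (@transf_nat F H f (v |: A)%SET A (sub_add1 v A)).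

Let cmor_nat A B (BA : B \subset A) n x :
  cmor B n (functor_res (functor_cone v F) BA n x) = functor_res (functor_cone v H) BA n (cmor A n x).
Proof. by case: x => a b; congr (_, _); apply: transf_nat. Qed.

Definition transf_cone : transf (functor_cone v F) (functor_cone v H) := MkTransf cmor_nat.

Lemma transf_cone_qiso A : qiso (f (v |: A)%SET) -> qiso (f A) -> qiso (transf_cone A).
Proof. exact: cone_qiso. Qed.
End FConeMor.

(** The total complex of the cube of the values of [F] at the unions of [A] with subsets of [s],
    built one direction at a time. *)
Definition functor_cones s F : functor := foldr functor_cone F s.

Fixpoint transf_cones s F H (f : transf F H) : transf (functor_cones s F) (functor_cones s H) :=
  if s is v :: s' then transf_cone v (transf_cones s' f) else f.

Lemma transf_cones_qiso s F H (f : transf F H) :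
  (forall A, qiso (f A)) -> forall A, qiso (transf_cones s f A).
Proof.
by move=> qf; elim: s => [//|v s IHs] A; apply: transf_cone_qiso; apply: IHs.
Qed.
End Functors.

(** * Complexes of functions on based sets *)

Section Supported.
Variables (k : fieldType) (T : finType).
Implicit Types (p : pred T) (u : {ffun T -> k^o}).

Definition supported p u : bool := [forall j, (u j != 0) ==> p j].

Lemma supportedP p u : reflect (forall j, u j != 0 -> p j) (supported p u).
Proof. by apply: (iffP forallP) => H j; [exact/implyP|apply/implyP; exact: H]. Qed.

Lemma supported_closed p : submod_closed (supported p).
Proof.
split=> [|a u w /supportedP up /supportedP wp]; apply/supportedP => j.
  by rewrite ffunE eqxx.
rewrite !ffunE; have [u0|/up //] := eqVneq (u j) 0.
by rewrite u0 scaler0 add0r; apply: wp.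
Qed.

Definition masked_space p : lmodType k := sub_of (Submodule (supported_closed p)).

Lemma masked_space0 p (u : masked_space p) j : ~~ p j -> val u j = 0.
Proof. by move=> pj; apply/eqP; apply: contraNT pj; apply/supportedP/(svalP u). Qed.

Definition fmask p u : {ffun T -> k^o} := [ffun j => if p j then u j else 0].

Lemma fmask_supported p u : supported p (fmask p u).
Proof. by apply/supportedP => j; rewrite ffunE; case: (p j) => //; rewrite eqxx. Qed.

Let fcut_fun p u : masked_space p := exist _ (fmask p u) (fmask_supported p u).

Let fcut_lin p : linear (fcut_fun p).
Proof.
move=> a u w; apply: val_inj; apply/ffunP => j; rewrite /= !ffunE.
by case: (p j) => //; rewrite scaler0 addr0.
Qed.

Definition fcut p : {linear {ffun T -> k^o} -> masked_space p} := mklin (@fcut_lin p).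

Lemma fcutE p u j : val (fcut p u) j = if p j then u j else 0.
Proof. by rewrite /= ffunE. Qed.

Lemma masked_space_eq p (u w : masked_space p) : (forall j, p j -> val u j = val w j) -> u = w.
Proof.
move=> E; apply: val_inj; apply/ffunP => j; have [/E//|pj] := boolP (p j).
by rewrite !masked_space0.
Qed.

Lemma masked_spaceZ p a (u : masked_space p) j : val (a *: u) j = a * val u j.
Proof. by rewrite /= !ffunE. Qed.

Lemma masked_spaceN p (u : masked_space p) j : val (- u) j = - val u j.
Proof. by rewrite /= !ffunE. Qed.
Section Restriction.
Variables p q : pred T.

Let restr_fun (u : masked_space p) : masked_space q := fcut q (val u).

Let restr_lin : linear restr_fun.
Proof. by move=> a u w; rewrite /restr_fun !linearP. Qed.

(** Restriction if [q] is contained in [p], extension by zero if [p] is contained in [q], and in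
    general a composite of the two. *)
Definition restr : {linear masked_space p -> masked_space q} := mklin restr_lin.

Lemma restrE (u : masked_space p) j : val (restr u) j = if q j then val u j else 0.
Proof. exact: fcutE. Qed.
End Restriction.
End Supported.
Arguments restr {k T} p q.
Arguments fcut {k T} p.
Arguments masked_space k {T} p.

Section Masked.
Variables (k : fieldType) (I : int -> finType).
Variable D : forall n, I n -> I (n + 1) -> k.
Implicit Types (p q : forall n, pred (I n)) (c : k).

Let mtx n (u : {ffun I n -> k^o}) : {ffun I (n + 1) -> k^o} :=
  [ffun j' => \sum_j D j j' * u j].

Let mtx_lin n : linear (@mtx n).
Proof.
move=> a u w; apply/ffunP => j'; rewrite !ffunE scaler_sumr -big_split /=.
by apply: eq_bigr => j _; rewrite !ffunE mulrDr; congr (_ + _); exact: mulrCA.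
Qed.

Definition matop n : {linear {ffun I n -> k^o} -> {ffun I (n + 1) -> k^o}} :=
  mklin (@mtx_lin n).

Lemma matopE n u j' : matop n u j' = \sum_j D j j' * u j.
Proof. by rewrite /= ffunE. Qed.

(* The matrix [D] restricted to the indices in [p] has square zero. *)
Definition complex_mask p : Prop := forall n (j : I n) (j'' : I (n + 1 + 1)),
  p n j -> p _ j'' -> \sum_(j' | p _ j') D j j' * D j' j'' = 0.

(* Forgetting the values outside [q] commutes with the differentials. *)
Definition map_mask p q : Prop := forall n (j : I n) (j' : I (n + 1)),
  p n j -> q _ j' -> D j j' != 0 -> q n j = p _ j'.

Section Complex.
Variables (p : forall n, pred (I n)) (c : k) (pC : complex_mask p).
Arguments p : clear implicits.

Let md n (u : masked_space k (p n)) : masked_space k (p (n + 1)) := c *: fcut (p _) (matop n (val u)).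

Let md_lin n : linear (@md n).
Proof. by move=> a u w; rewrite /md !linearP /= scalerA mulrC -scalerA. Qed.

Let mdE n u j' : val (md (n := n) u) j' =
  if p _ j' then c * \sum_j D j j' * val u j else 0.
Proof.
by rewrite masked_spaceZ fcutE; case: (p _ j'); rewrite ?matopE ?mulr0.
Qed.

Let md_md n u : mklin (@md_lin (n + 1)) (mklin (@md_lin n) u) = 0.
Proof.
apply: masked_space_eq => j'' pj; rewrite [LHS]mdE pj [RHS]ffunE.
rewrite (eq_bigr (fun j' => D j' j'' *
  (if p _ j' then c * \sum_j D j j' * val u j else 0))); last first.
  by move=> j' _; congr (_ * _); exact: mdE.
rewrite (bigID (fun j' => p _ j')) /= [X in _ + X]big1 ?addr0; last first.
  by move=> j' /negPf ->; rewrite mulr0.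
rewrite (eq_bigr (fun j' => \sum_j c * (D j j' * D j' j'' * val u j))); last first.
  move=> j' ->; rewrite !mulr_sumr; apply: eq_bigr => j _.
  by rewrite mulrCA; congr (_ * _); rewrite mulrCA mulrA.
rewrite exchange_big big1 ?mulr0 //= => j _.
rewrite -mulr_sumr -mulr_suml; have [pj'|pj'] := boolP (p n j).
  by rewrite pC // mul0r mulr0.
by rewrite masked_space0 // !mulr0.
Qed.

(** The factor [c] absorbs signs: by the sign convention of the cone, passing to the cokernel of an
    inclusion turns [c] into [- c]. *)
Definition masked_complex : kcomplex k := KComplex md_md.

Lemma masked_complexE n (u : masked_complex n) j' : val (kdiff masked_complex n u) j' =
  if p _ j' then c * \sum_j D j j' * val u j else 0.
Proof. exact: mdE. Qed.
End Complex.

Section Map.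
Variables (p q : forall n, pred (I n)) (c : k).
Arguments p : clear implicits.
Arguments q : clear implicits.
Hypotheses (pC : complex_mask p) (qC : complex_mask q) (pq : map_mask p q).

Let mm n : {linear masked_space k (p n) -> masked_space k (q n)} := restr (p n) (q n).

Let mmd n u : mm (n + 1) (kdiff (masked_complex c pC) n u) =
  kdiff (masked_complex c qC) n (mm n u).
Proof.
apply: masked_space_eq => j' qj'; rewrite [LHS]restrE qj' !masked_complexE qj'.
have [pj'|pj'] := boolP (p _ j').
  congr (_ * _); apply: eq_bigr => j _; rewrite restrE.
  have [->|D0] := eqVneq (D j j') 0; first by rewrite !mul0r.
  have [pj|pj] := boolP (p _ j); last by rewrite masked_space0 // if_same.
  by rewrite (pq pj qj' D0) pj'.
rewrite big1 ?mulr0 // => j _; rewrite restrE.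
have [->|D0] := eqVneq (D j j') 0; first by rewrite !mul0r.
have [pj|pj] := boolP (p _ j); last by rewrite masked_space0 // if_same mulr0.
by rewrite (pq pj qj' D0) (negPf pj') mulr0.
Qed.

Definition masked_map : kmap (masked_complex c pC) (masked_complex c qC) :=
  @KMap k (masked_complex c pC) (masked_complex c qC) mm mmd.

Lemma masked_mapE n u : masked_map n u = restr (p n) (q n) u. Proof. by []. Qed.
End Map.

Section Functor.
Variables (V : finType) (P : {set V} -> forall n, pred (I n)) (c : k).
Arguments P : clear implicits.
Hypothesis PC : forall A, complex_mask (P A).
Hypothesis PM : forall A B : {set V}, B \subset A -> map_mask (P A) (P B).
Hypothesis Pcomp : forall A B C : {set V}, B \subset A -> C \subset B ->
  forall n j, P A n j -> P C n j -> P B n j.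

Let mres (A B : {set V}) (BA : B \subset A) := masked_map c (@PC A) (@PC B) (@PM A B BA).

Let mres_comp (A B C : {set V}) (BA : B \subset A) (CB : C \subset B) (CA : C \subset A) n x :
  mres CB n (mres BA n x) = mres CA n x.
Proof.
apply: masked_space_eq => j pj; rewrite !masked_mapE !restrE pj.
have [pA|pA] := boolP (P A n j); last by rewrite masked_space0 // if_same.
by rewrite (Pcomp BA CB).
Qed.

(** [Pcomp] makes the restrictions compose: an index present at [A] and at [C] is not cut off at the
    intermediate [B]. *)
Definition masked_functor : functor k V := MkFunctor mres_comp.

End Functor.
End Masked.

Section QuotientStep.
Variables (k : fieldType) (I : int -> finType).
Variable D : forall n, I n -> I (n + 1) -> k.
Variables (V : finType) (v : V) (P P' : {set V} -> forall n, pred (I n)) (c : k).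
Arguments P : clear implicits.
Arguments P' : clear implicits.
Hypotheses (PC : forall A, complex_mask D (P A))
  (PM : forall A B : {set V}, B \subset A -> map_mask D (P A) (P B))
  (Pcomp : forall A B C : {set V}, B \subset A -> C \subset B ->
     forall n j, P A n j -> P C n j -> P B n j).
Hypotheses (P'C : forall A, complex_mask D (P' A))
  (P'M : forall A B : {set V}, B \subset A -> map_mask D (P' A) (P' B))
  (P'comp : forall A B C : {set V}, B \subset A -> C \subset B ->
     forall n j, P' A n j -> P' C n j -> P' B n j).
Hypothesis Panti : forall A B : {set V}, B \subset A -> forall n j, P A n j -> P B n j.
Hypothesis P'E : forall A n j, P' A n j = P A n j && ~~ P (v |: A)%SET n j.

Let F := masked_functor c PC PM Pcomp.
Let F' := masked_functor (- c) P'C P'M P'comp.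

Let inc A := functor_res F (sub_add1 v A).
Let pr A n : {linear F A n -> F' A n} := restr (P A n) (P' A n).

Let incE A n x j : val (inc A n x) j = val x j.
Proof.
rewrite [LHS]restrE; have [//|pj] := boolP (P A n j).
rewrite masked_space0 //; apply: contraNN pj; apply: Panti; exact: sub_add1.
Qed.

Let inc_inj A n : injective (inc A n).
Proof. by move=> x y xy; apply: masked_space_eq => j _; rewrite -!incE xy. Qed.

Let pr_surj A n z : exists y, pr A n y = z.
Proof.
exists (restr (P' A n) (P A n) z); apply: masked_space_eq => j p'j.
by rewrite [LHS]restrE p'j restrE; move: p'j; rewrite P'E => /andP[->].
Qed.

Let pr_inc A n x : pr A n (inc A n x) = 0.
Proof.
apply: masked_space_eq => j p'j; rewrite [LHS]restrE p'j incE ffunE.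
by move: p'j; rewrite P'E => /andP[_ /masked_space0 ->].
Qed.

Let pr_ker A n y : pr A n y = 0 -> exists x, inc A n x = y.
Proof.
move=> py; exists (restr (P A n) (P (v |: A)%SET n) y).
apply: masked_space_eq => j pj; rewrite incE restrE; case: ifP => // pvj.
have p'j : P' A n j by rewrite P'E pj pvj.
have := congr1 (fun u : masked_space k _ => val u j) py.
by rewrite /= restrE p'j ffunE => ->.
Qed.

Let prd A n y : pr A (n + 1) (kdiff (F A) n y) = - kdiff (F' A) n (pr A n y).
Proof.
apply: masked_space_eq => j' p'j'; rewrite [LHS]restrE p'j' masked_spaceN !masked_complexE p'j'.
move: (p'j'); rewrite P'E => /andP[pj' pvj']; rewrite pj' mulNr opprK.
congr (_ * _); apply: eq_bigr => j _; rewrite [in RHS]restrE.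
have [->|D0] := eqVneq (D j j') 0; first by rewrite !mul0r.
have [pj|pj] := boolP (P A n j); last by rewrite masked_space0 // if_same.
rewrite P'E pj /=; case: ifP => // /negbFE pvj.
by have := PM (sub_add1 v A) pvj pj' D0; rewrite pj (negPf pvj').
Qed.

Let q_nat (A B : {set V}) (BA : B \subset A) n x :
  of_cone (@pr_inc B) (@prd B) n (functor_res (functor_cone v F) BA n x) =
  functor_res F' BA n (of_cone (@pr_inc A) (@prd A) n x).
Proof.
case: x => a b; apply: masked_space_eq => j p'j; rewrite [LHS]restrE [RHS]restrE p'j.
rewrite [LHS]restrE [RHS]restrE.
move: (p'j); rewrite P'E => /andP[pj pvj]; rewrite pj.
have [pAj|pAj] := boolP (P A n j); last by rewrite masked_space0 // if_same.
rewrite P'E pAj /=; case: ifP => // /negbFE pvAj.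
by case/negP: pvj; apply: Panti pvAj; exact: sub_add1S.
Qed.

(** By [Panti] the map from [v |: A] to [A] is an extension by zero, hence injective, and its
    cokernel is the space of functions on [P' A]. *)
Definition quotient_step : transf (functor_cone v F) F' :=
  @MkTransf k V (functor_cone v F) F' (fun A => of_cone (@pr_inc A) (@prd A)) q_nat.

Lemma quotient_step_qiso A : qiso (quotient_step A).
Proof.
exact: (of_cone_qiso (@inc_inj A) (@pr_surj A) (@pr_inc A) (@pr_ker A) (@prd A)).
Qed.
End QuotientStep.

Section KernelStep.
Variables (k : fieldType) (T : finType) (M : T -> T -> k).
Let D (n : int) : T -> T -> k := M.
Variables (V : finType) (v : V) (P P' : {set V} -> int -> pred T) (c : k).
Arguments P : clear implicits.
Arguments P' : clear implicits.
Hypotheses (PC : forall A, complex_mask D (P A))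
  (PM : forall A B : {set V}, B \subset A -> map_mask D (P A) (P B))
  (Pcomp : forall A B C : {set V}, B \subset A -> C \subset B ->
     forall n j, P A n j -> P C n j -> P B n j).
Hypotheses (P'C : forall A, complex_mask D (P' A))
  (P'M : forall A B : {set V}, B \subset A -> map_mask D (P' A) (P' B))
  (P'comp : forall A B C : {set V}, B \subset A -> C \subset B ->
     forall n j, P' A n j -> P' C n j -> P' B n j).
Hypothesis Pv : forall A n j, P A n j -> P (v |: A)%SET n j.
Hypothesis P'E : forall A n j,
  P' A n j = P (v |: A)%SET (n + 1) j && ~~ P A (n + 1) j.

Let F := masked_functor c PC PM Pcomp.
Let F' := masked_functor c P'C P'M P'comp.

Let res A := functor_res F (sub_add1 v A).
Let kap A n : {linear F' A n -> F (v |: A)%SET (n + 1)} :=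
  restr (P' A n) (P (v |: A)%SET (n + 1)).

Let kapE A n y j : val (kap A n y) j = val y j.
Proof.
rewrite [LHS]restrE; have [//|pj] := boolP (P _ _ j).
by rewrite masked_space0 // P'E (negPf pj).
Qed.

Let res_surj A n y : exists x, res A n x = y.
Proof.
exists (restr (P A n) (P (v |: A)%SET n) y).
by apply: masked_space_eq => j pj; rewrite [LHS]restrE pj restrE Pv.
Qed.

Let kap_inj A n : injective (kap A n).
Proof. by move=> x y xy; apply: masked_space_eq => j _; rewrite -!kapE xy. Qed.

Let res_kap A n y : res A (n + 1) (kap A n y) = 0.
Proof.
apply: masked_space_eq => j pj; rewrite [LHS]restrE pj kapE ffunE.
by rewrite masked_space0 // P'E pj andbF.
Qed.

Let res_ker A n x : res A (n + 1) x = 0 -> exists y, kap A n y = x.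
Proof.
move=> rx; exists (restr (P (v |: A)%SET (n + 1)) (P' A n) x).
apply: masked_space_eq => j pvj; rewrite kapE restrE P'E pvj /=; case: ifP => // /negbFE pj.
have := congr1 (fun u : masked_space k _ => val u j) rx.
by rewrite /= restrE pj ffunE => ->.
Qed.

Let kapd A n y : kap A (n + 1) (kdiff (F' A) n y) = kdiff (F (v |: A)%SET) (n + 1) (kap A n y).
Proof.
apply: masked_space_eq => j' pvj'; rewrite kapE !masked_complexE pvj' P'E pvj' /=.
case: ifP => [_|/negbFE pj'].
  by congr (_ * _); apply: eq_bigr => j _; rewrite kapE.
rewrite big1 ?mulr0 // => j _; rewrite kapE.
have [->|D0] := eqVneq (D (n + 1) j j') 0; first by rewrite !mul0r.
have [|p'j] := boolP (P' A n j); last by rewrite masked_space0 // mulr0.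
rewrite P'E => /andP[pvj pj].
by have := PM (sub_add1 v A) pvj pj' D0; rewrite pvj' (negPf pj).
Qed.

Let k_nat (A B : {set V}) (BA : B \subset A) n x :
  to_cone (@res_kap B) (@kapd B) n (functor_res F' BA n x) =
  functor_res (functor_cone v F) BA n (to_cone (@res_kap A) (@kapd A) n x).
Proof.
congr (_, _); last by rewrite linear0.
apply: masked_space_eq => j pvj; rewrite kapE [LHS]restrE [RHS]restrE pvj kapE.
have [p'j|p'j] := boolP (P' A n j); last by rewrite masked_space0 // if_same.
rewrite P'E pvj /=; case: ifP => // /negbFE pj.
move: p'j; rewrite P'E => /andP[pvAj /negP[]].
exact: (Pcomp (sub_add1 v A) BA pvAj pj).
Qed.

(** By [Pv] the map from [v |: A] to [A] is a surjective restriction with kernel the functions on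
    [P' A]. The index set [T] does not depend on the degree, so the kernel can be shifted by one
    without casts. *)
Definition kernel_step : transf F' (functor_cone v F) :=
  @MkTransf k V F' (functor_cone v F) (fun A => to_cone (@res_kap A) (@kapd A)) k_nat.

Lemma kernel_step_qiso A : qiso (kernel_step A).
Proof.
exact: (to_cone_qiso (@res_surj A) (@kap_inj A) (@res_kap A) (@res_ker A) (@kapd A)).
Qed.
End KernelStep.

Lemma disjointsU1 (T : finType) (a : T) (A B : {set T}) :
  [disjoint (a |: A)%SET & B] = (a \notin B) && [disjoint A & B].
Proof. by rewrite -disjointU1; apply: eq_disjoint => x; rewrite !inE. Qed.

Section DecreasingLabels.
Variables (k : fieldType) (V : finType) (I : int -> finType).
Variables (D : forall n, I n -> I (n + 1) -> k) (L : forall n, I n -> {set V}).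
Hypothesis D_down : forall n (j : I n) (j' : I (n + 1)), D j j' != 0 -> L j' \subset L j.
Hypothesis DD : forall n (j : I n) (j'' : I (n + 1 + 1)), \sum_j' D j j' * D j' j'' = 0.

Definition dec_mask (s : seq V) (A : {set V}) n (j : I n) : bool :=
  [disjoint L j & A] && ([set x in s] \subset L j).
Arguments dec_mask : clear implicits.

Lemma dec_mask_complex s A : complex_mask D (dec_mask s A).
Proof.
move=> n j j'' /andP[jA sj] /andP[j''A sj''].
rewrite -[RHS](DD j j'') [RHS](bigID (dec_mask s A (n + 1))) /=.
rewrite [X in _ = _ + X]big1 ?addr0 // => j' nj'; apply/eqP; apply: contraNT nj'.
rewrite mulf_eq0 negb_or => /andP[/D_down jj' /D_down j'j''].
by rewrite /dec_mask (disjointWl jj') //= (fintype.subset_trans sj'').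
Qed.

Lemma dec_mask_anti s (A B : {set V}) : B \subset A -> forall n j, dec_mask s A n j -> dec_mask s B n j.
Proof. by move=> BA n j /andP[jA sj]; rewrite /dec_mask sj (disjointWr BA). Qed.

Lemma dec_mask_map s (A B : {set V}) : B \subset A -> map_mask D (dec_mask s A) (dec_mask s B).
Proof.
move=> BA n j j' jA /andP[_ sj'] /D_down jj'; rewrite (dec_mask_anti BA jA).
by move/andP: jA => [jA _]; rewrite /dec_mask sj' (disjointWl jj').
Qed.

Lemma dec_mask_comp s (A B C : {set V}) : B \subset A -> C \subset B -> forall n j,
  dec_mask s A n j -> dec_mask s C n j -> dec_mask s B n j.
Proof. by move=> BA _ n j jA _; exact: dec_mask_anti jA. Qed.

Fixpoint dec_sign (s : seq V) : k := if s is _ :: s' then - dec_sign s' else 1.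

Lemma dec_sign_neq0 s : dec_sign s != 0.
Proof. by elim: s => [|v s IHs] /=; rewrite ?oppr_eq0 ?oner_eq0. Qed.

(* If the basis element [j] has degree [L j], its value at [A] is the part in
   degree [V - A] divided by the images of the parts in degree [V - A - v], [v] in
   [s]. *)
Definition dec_functor s : functor k V := masked_functor (dec_sign s) (@dec_mask_complex s) (@dec_mask_map s) (@dec_mask_comp s).

Lemma dec_mask_cons v s A n (j : I n) :
  dec_mask (v :: s) A n j = dec_mask s A n j && ~~ dec_mask s (v |: A)%SET n j.
Proof.
rewrite /dec_mask set_cons finset.subUset finset.sub1set.
rewrite [[disjoint L j & (v |: A)%SET]]disjoint_sym disjointsU1.
rewrite [[disjoint A & L j]]disjoint_sym.
by case: [disjoint L j & A]; case: (v \in L j); case: (_ \subset _).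
Qed.

(** Each new cone is the cone of an inclusion, so the quotient replaces it; the induction keeps this
    natural in [A] for the next direction. *)
Lemma cones_dec_functor s : exists phi : transf (functor_cones s (dec_functor [::])) (dec_functor s), forall A, qiso (phi A).
Proof.
elim: s => [|v s [phi qphi]].
  by exists (transf_id _) => A; exact: qiso_id.
pose st := quotient_step (dec_sign s) (@dec_mask_complex s) (@dec_mask_map s) (@dec_mask_comp s)
  (@dec_mask_complex (v :: s)) (@dec_mask_map (v :: s)) (@dec_mask_comp (v :: s))
  (@dec_mask_anti s) (@dec_mask_cons v s).
exists (transf_comp (transf_cone v phi) st) => A.
apply: qiso_comp; first exact: transf_cone_qiso.
exact: quotient_step_qiso.
Qed.
End DecreasingLabels.
Arguments dec_mask {V I} L s A n j.

Section IncreasingLabels.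
Variables (k : fieldType) (V T : finType) (M : T -> T -> k).
Variables (L : T -> {set V}) (gr : T -> int).
Let D (n : int) : T -> T -> k := M.
Hypothesis M_up : forall j j', M j j' != 0 -> L j \subset L j' /\ gr j' = gr j + 1.
Hypothesis MM : forall j j'', \sum_j' M j j' * M j' j'' = 0.

(** The mask is empty if [s] meets [A]: some direction of the cube is then an identity and has no
    kernel. The term [size s] is the shift accumulated by the kernel steps. *)
Definition inc_mask (s : seq V) (A : {set V}) (n : int) (j : T) : bool :=
  [&& [disjoint [set x in s] & A], [set x in s] \subset L j,
      L j \subset A :|: [set x in s] & gr j == n + (size s)%:Z].

Lemma inc_mask_complex s A : complex_mask D (inc_mask s A).
Proof.
move=> n j j'' /and4P[dA sj jA /eqP gj] /and4P[_ sj'' j''A _].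
rewrite -[RHS](MM j j'') [RHS](bigID (inc_mask s A (n + 1))) /=.
rewrite [X in _ = _ + X]big1 ?addr0 // => j' nj'; apply/eqP; apply: contraNT nj'.
rewrite mulf_eq0 negb_or => /andP[/M_up[jj' gj'] /M_up[j'j'' _]].
rewrite /inc_mask dA (fintype.subset_trans sj jj') (fintype.subset_trans j'j'' j''A) /=.
by rewrite gj' gj addrAC.
Qed.

Lemma inc_mask_map s (A B : {set V}) : B \subset A -> map_mask D (inc_mask s A) (inc_mask s B).
Proof.
move=> BA n j j' /and4P[dA sj jA gj] /and4P[dB sj' j'B gj'] /M_up[jj' _].
rewrite /inc_mask dA dB sj sj' gj gj' (fintype.subset_trans jj' j'B).
by rewrite (fintype.subset_trans j'B) // finset.setSU.
Qed.

Lemma inc_mask_comp s (A B C : {set V}) : B \subset A -> C \subset B -> forall n j,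
  inc_mask s A n j -> inc_mask s C n j -> inc_mask s B n j.
Proof.
move=> BA CB n j /and4P[dA sj _ gj] /and4P[_ _ jC _].
rewrite /inc_mask sj gj (disjointWr BA) // (fintype.subset_trans jC) //.
exact: finset.setSU.
Qed.

(* Its value at [A] is the common kernel of the restriction maps from the
   functions on the [j] with [L j] in [A + s] to those with [L j] in [A + s - v],
   [v] in [s], shifted by the size of [s]. *)
Definition inc_functor s : functor k V := masked_functor 1 (@inc_mask_complex s) (@inc_mask_map s) (@inc_mask_comp s).

Lemma inc_mask_add1 v s A n j : v \notin s -> inc_mask s A n j -> inc_mask s (v |: A)%SET n j.
Proof.
move=> vs /and4P[dA sj jA gj]; rewrite /inc_mask sj gj.
rewrite [[disjoint _ & _]]disjoint_sym disjointsU1 inE vs disjoint_sym dA /=.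
by rewrite -finset.setUA (fintype.subset_trans jA) // finset.subsetUr.
Qed.

Lemma inc_mask_cons v s A n j : v \notin s ->
  inc_mask (v :: s) A n j = inc_mask s (v |: A)%SET (n + 1) j && ~~ inc_mask s A (n + 1) j.
Proof.
move=> vs; rewrite /inc_mask.
have -> : [set x in v :: s] = (v |: [set x in s])%SET.
  by apply/setP => x; rewrite !inE.
rewrite disjointsU1 finset.subUset finset.sub1set.
have -> : gr j == n + (size (v :: s))%:Z = (gr j == n + 1 + (size s)%:Z).
  by rewrite /= -addrA -[1 + _]/(1%:Z + _) -PoszD add1n.
rewrite [[disjoint _ & (v |: A)%SET]]disjoint_sym disjointsU1 inE vs /=.
rewrite [[disjoint A & _]]disjoint_sym.
have E1 : (v |: A :|: [set x in s])%SET = (A :|: (v |: [set x in s]))%SET.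
  by rewrite finset.setUCA finset.setUA.
rewrite E1.
have [dA|] /= := boolP [disjoint [set x in s] & A]; last by rewrite andbF.
rewrite andbT; have [sj|] /= := boolP ([set x in s] \subset L j); last by rewrite !andbF.
case: (gr j == _); rewrite ?andbF // !andbT.
have [jvA|] /= := boolP (L j \subset _); last by rewrite !andbF.
rewrite andbT; have [vA|vA] /= := boolP (v \in A).
  suff -> : L j \subset A :|: [set x in s] by [].
  apply: fintype.subset_trans jvA _; apply/fintype.subsetP => x; rewrite !inE.
  by case/or3P => [->//|/eqP->|->]; rewrite ?vA ?orbT.
apply/idP/idP => [vj|].
  apply/negP => /fintype.subsetP/(_ v vj); rewrite !inE (negPf vA) (negPf vs).
  by [].
apply: contraNT => vj; apply/fintype.subsetP => x xj.
have := fintype.subsetP jvA x xj; rewrite !inE => /or3P[->//|/eqP xv|->].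
  by rewrite -xv xj in vj.
by rewrite orbT.
Qed.

Lemma inc_functor_cones s : uniq s ->
  exists phi : transf (inc_functor s) (functor_cones s (inc_functor [::])), forall A, qiso (phi A).
Proof.
elim: s => [_|v s IHs /= /andP[vs us]].
  by exists (transf_id _) => A; exact: qiso_id.
have [phi qphi] := IHs us.
pose st := kernel_step 1 (@inc_mask_complex s) (@inc_mask_map s) (@inc_mask_comp s)
  (@inc_mask_complex (v :: s)) (@inc_mask_map (v :: s)) (@inc_mask_comp (v :: s))
  (fun A n j => @inc_mask_cons v s A n j vs).
exists (transf_comp st (transf_cone v phi)) => A.
apply: qiso_comp; first by apply: kernel_step_qiso => B n j; exact: inc_mask_add1.
exact: transf_cone_qiso.
Qed.
End IncreasingLabels.

(** * Comparison of the two resolutions *)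

Section Multidegrees.
Variable V : finType.
Implicit Types (A B : {set V}).

Lemma supp_charv A : supp (charv A) = A.
Proof. by apply/setP => v; rewrite !inE ffunE eqb0 negbK. Qed.

Lemma mle_charvE A B : mle (charv A) (charv B) = (A \subset B).
Proof.
apply/idP/idP => [/mleP AB|/mle_charv //]; apply/fintype.subsetP => v vA.
by have := AB v; rewrite !ffunE vA; case: (v \in B).
Qed.
End Multidegrees.

Section DegreeComplex.
Variables (k : fieldType) (V : finType).

Definition degree_complex (M : cochain k V) (b : mdeg V) : kcomplex k :=
  @KComplex k (fun n => M n b) (fun n => cdiff M n (n + 1) b)
    (fun n x => @cdiff_cdiff k V M n (n + 1) (n + 1 + 1) b x).

Section Functor.
Variable M : cochain k V.

Lemma charvCS (A B : {set V}) : B \subset A -> mle (charv (~: A)) (charv (~: B)).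
Proof. by rewrite mle_charvE finset.setCS. Qed.

Let cres (A B : {set V}) (BA : B \subset A) :
    kmap (degree_complex M (charv (~: A))) (degree_complex M (charv (~: B))) :=
  @KMap k (degree_complex M (charv (~: A))) (degree_complex M (charv (~: B)))
    (fun n => gmul (M n) (charvCS BA))
    (fun n x => esym (hcomp_gmul (cdiff M n (n + 1)) (charvCS BA) x)).

Let cres_comp (A B C : {set V}) (BA : B \subset A) (CB : C \subset B)
  (CA : C \subset A) n x : cres CB n (cres BA n x) = cres CA n x.
Proof. exact: gmul_comp. Qed.

Definition degree_functor : functor k V := MkFunctor cres_comp.
End Functor.

Section CohomologyClasses.
Variables (M : cochain k V) (n : int) (b : mdeg V).

(** Coboundaries in degree [n + 1] come by definition from [n + 1 - 1], which equals [n] only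
    propositionally. *)
Lemma coboundaryP (z : sub_of (cocycle M (n + 1) b)) :
  reflect (exists y, val z = kdiff (degree_complex M b) n y) (z \in spred (coboundary M (n + 1) b)).
Proof.
apply: (iffP idP) => [/asboolP|h]; first by rewrite addrK => -[y <-]; exists y.
by apply/asboolP; rewrite addrK; case: h => y ->; exists y.
Qed.
End CohomologyClasses.

Lemma quasi_iso_qiso (M N : cochain k V) (f : chom M N) b n :
  bijective (cohom_map f (n + 1) b) ->
  (forall x : M (n + 1) b, kdiff (degree_complex M b) (n + 1) x = 0 ->
     (exists y, f (n + 1) b x = kdiff (degree_complex N b) n y) ->
     exists z, x = kdiff (degree_complex M b) n z) /\
  (forall y : N (n + 1) b, kdiff (degree_complex N b) (n + 1) y = 0 ->
     exists x w, kdiff (degree_complex M b) (n + 1) x = 0 /\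
       y = f (n + 1) b x + kdiff (degree_complex N b) n w).
Proof.
move=> fb; split.
  move=> x dx [y fxy]; pose X : sub_of (cocycle M (n + 1) b) := Sub x (introT eqP dx).
  have /coboundaryP[z zE] : X \in spred (coboundary M (n + 1) b); last by exists z.
  rewrite -qclass_eq0; apply/eqP; apply: (bij_inj fb).
  rewrite quot_mapE linear0; apply/eqP; rewrite qclass_eq0.
  by apply/coboundaryP; exists y.
move=> y dy; pose Y : sub_of (cocycle N (n + 1) b) := Sub y (introT eqP dy).
have [g gK fK] := fb; pose X := qrepr (g (qclass _ Y)).
have := fK (qclass _ Y); rewrite -[g _]qreprK quot_mapE => /esym/eqP.
rewrite qclass_eq => /coboundaryP[w wE]; exists (val X), w; split.
  exact/eqP/(svalP X).
by rewrite -wE /= addrCA subrr addr0.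
Qed.

Section ChainMap.
Variables (M N : cochain k V) (f : chom M N).

Let dmap A : kmap (degree_functor M A) (degree_functor N A) :=
  @KMap k (degree_functor M A) (degree_functor N A) (fun n => f n (charv (~: A)))
    (fun n x => @chcomp_diff _ _ _ _ f n (n + 1) _ x).

Let dmap_nat (A B : {set V}) (BA : B \subset A) n x :
  dmap B n (functor_res (degree_functor M) BA n x) = functor_res (degree_functor N) BA n (dmap A n x).
Proof. exact: hcomp_gmul. Qed.

Definition degree_transf : transf (degree_functor M) (degree_functor N) :=
  @MkTransf k V (degree_functor M) (degree_functor N) dmap dmap_nat.

Lemma degree_transf_qiso A : quasi_iso f -> qiso (degree_transf A).
Proof. by move=> qf n; apply: quasi_iso_qiso; exact: qf. Qed.
End ChainMap.

Section FreeElements.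
Variables (J : finType) (deg : J -> mdeg V).

Let fe_fun b (u : {ffun J -> k^o}) : free_gmod k deg b :=
  exist _ (fmask (fun j => mle (deg j) b) u)
    (fmask_supported (fun j => mle (deg j) b) u).

Let fe_lin b : linear (@fe_fun b).
Proof.
move=> a u w; apply: val_inj; apply/ffunP => j; rewrite /= !ffunE.
by case: (mle _ _) => //; rewrite scaler0 addr0.
Qed.

Definition free_elt b : {linear {ffun J -> k^o} -> free_gmod k deg b} := mklin (@fe_lin b).

Lemma free_eltE b u j : val (free_elt b u) j = if mle (deg j) b then u j else 0.
Proof. by rewrite /= ffunE. Qed.

Lemma free_val0 b (x : free_gmod k deg b) j : ~~ mle (deg j) b -> val x j = 0.
Proof.
have /free_predP xb := svalP x; move=> jb; apply/eqP.
by apply: contraNT jb; exact: xb.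
Qed.

Lemma free_linear b a (x y : free_gmod k deg b) j :
  val (a *: x + y) j = a * val x j + val y j.
Proof. by rewrite /= !ffunE. Qed.

Lemma free_eq b (x y : free_gmod k deg b) :
  (forall j, mle (deg j) b -> val x j = val y j) -> x = y.
Proof.
move=> E; apply: val_inj; apply/ffunP => j; have [/E//|jb] := boolP (mle (deg j) b).
by rewrite !free_val0.
Qed.

Definition delta (j : J) : {ffun J -> k^o} := [ffun j' => (j' == j)%:R].

Lemma free_elt_val b x : free_elt b (val x) = x.
Proof. by apply: free_eq => j jb; rewrite free_eltE jb. Qed.

Lemma delta_sum (u : {ffun J -> k^o}) : u = \sum_j u j *: delta j.
Proof.
apply/ffunP => j; rewrite sum_ffunE (bigD1 j) //= !ffunE eqxx big1 ?addr0.
  by rewrite -[RHS]/(u j * 1) mulr1.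
by move=> j' j'j; rewrite !ffunE eq_sym (negPf j'j) scaler0.
Qed.

Lemma free_elt_sum b (x : free_gmod k deg b) :
  x = \sum_j val x j *: free_elt b (delta j).
Proof.
transitivity (free_elt b (\sum_j val x j *: delta j)).
  by rewrite -delta_sum free_elt_val.
by rewrite linear_sum; apply: eq_bigr => j _; rewrite linearZ.
Qed.
End FreeElements.
End DegreeComplex.

(** * Free modules in coordinates and the double dual *)

Section FreeModule.
Variables (k : fieldType) (V : finType) (M : gmod k V).
Variables (J : finType) (R : J -> {set V}) (beta : ghom M (free_gmod k (charv \o R))).
Hypothesis beta_bij : forall b, bijective (beta b).

Let gcoord_fun b (x : M b) : {ffun J -> k^o} := val (beta b x).

Let gcoord_lin b : linear (@gcoord_fun b).
Proof. by move=> a x y; rewrite /gcoord_fun !linearP. Qed.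

Definition gcoord b : {linear M b -> {ffun J -> k^o}} := mklin (@gcoord_lin b).

Lemma gcoordP b a x y j : gcoord b (a *: x + y) j = a * gcoord b x j + gcoord b y j.
Proof. by rewrite linearP !ffunE. Qed.

Lemma gcoord_inj b : injective (gcoord b).
Proof. by move=> x y E; apply: (bij_inj (beta_bij b)); exact: val_inj. Qed.

Lemma gcoord_gmul b c (bc : mle b c) x : gcoord c (gmul M bc x) = gcoord b x.
Proof. by rewrite /= /gcoord_fun hcomp_gmul. Qed.

Lemma gcoord0 b x j : ~~ mle (charv (R j)) b -> gcoord b x j = 0.
Proof. exact: (@free_val0 k V J (charv \o R) b (beta b x) j). Qed.

Let elt_ex b u : exists x, beta b x = free_elt k (charv \o R) b u.
Proof. by have [g _ gK] := beta_bij b; exists (g (free_elt k _ b u)). Qed.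

Let elt_fun b (u : {ffun J -> k^o}) : M b := sval (cid (elt_ex b u)).

Let coord_elt_fun b u j : gcoord b (elt_fun b u) j =
  if mle (charv (R j)) b then u j else 0.
Proof.
rewrite /= /gcoord_fun; have /= -> := svalP (cid (elt_ex b u)).
by rewrite free_eltE.
Qed.

Let elt_lin b : linear (elt_fun b).
Proof.
move=> a u w; apply: gcoord_inj; apply/ffunP => j.
rewrite linearP !ffunE !coord_elt_fun.
by case: ifP => _; rewrite ?ffunE ?scaler0 ?addr0.
Qed.

Definition elt b : {linear {ffun J -> k^o} -> M b} := mklin (@elt_lin b).

Lemma gcoord_elt b u j : gcoord b (elt b u) j = if mle (charv (R j)) b then u j else 0.
Proof. exact: coord_elt_fun. Qed.

Lemma elt_gcoord b x : elt b (gcoord b x) = x.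
Proof.
apply: gcoord_inj; apply/ffunP => j; rewrite gcoord_elt.
by case: ifPn => // /gcoord0 ->.
Qed.

Lemma eltT_gcoord u : gcoord (charv [set: V]) (elt _ u) = u.
Proof. by apply/ffunP => j; rewrite gcoord_elt mle_charvE finset.subsetT. Qed.

Lemma gmul_elt b c (bc : mle b c) j : mle (charv (R j)) b ->
  gmul M bc (elt b (delta k j)) = elt c (delta k j).
Proof.
move=> jb; apply: gcoord_inj; rewrite gcoord_gmul; apply/ffunP => j'.
rewrite !gcoord_elt ffunE; have [->|_] := eqVneq j' j; last by rewrite !if_same.
by rewrite jb (mle_trans jb bc).
Qed.

Lemma elt_sum b x : x = \sum_j gcoord b x j *: elt b (delta k j).
Proof.
rewrite -{1}[x]elt_gcoord [in LHS](delta_sum (gcoord b x)) linear_sum.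
by apply: eq_bigr => j _; rewrite linearZ.
Qed.

(* As the double dual of a finite dimensional space is the space itself, the part
   of [(Hom(M, omega))^*] in degree [B] is a quotient of the part of [M] in degree
   [V]. *)
Section Tau.
Variable B : {set V}.
Let b' := charv (~: supp (charv B)).
Let H := gHom M (omega k V) b'.

Let coef_fun (h : H) (u : {ffun J -> k^o}) : k^o :=
  val (val h (charv [set: V]) (elt _ u)) tt.

Let coef_lin u : linear (coef_fun^~ u).
Proof. by move=> a h h'; rewrite /coef_fun /= !ffunE. Qed.

Let coef_pred u : dual_submod H (coef_fun^~ u).
Proof. exact/asboolP/coef_lin. Qed.

Let tau_fun u : dual H := exist _ (coef_fun^~ u) (coef_pred u).

Let tau_lin : linear tau_fun.
Proof.
move=> a u w; apply: val_inj; apply/funext => h.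
have /asboolP[hl _] := svalP h; rewrite [LHS]/= /coef_fun linearP.
by rewrite [val h _ _]hl /= !ffunE.
Qed.

Definition tau : {linear {ffun J -> k^o} -> dual H} := mklin tau_lin.

Lemma tauE u (h : H) : val (tau u) h = val (val h (charv [set: V]) (elt _ u)) tt.
Proof. by []. Qed.

Let hval (h : H) j : k := val (val h (charv (R j)) (elt _ (delta k j))) tt.

(** The value on the generator [j] lies in degree R_j + (V - B) of omega, which is zero unless this
    degree is at least 1 everywhere. *)
Let hval0 (h : H) j : ~~ (B \subset R j) -> hval h j = 0.
Proof.
move=> BR; apply: free_val0; apply: contra BR => /mleP le.
apply/fintype.subsetP => v vB; have := le v; rewrite !ffunE supp_charv !inE vB addn0.
by case: (v \in R j).
Qed.

Let h_expand (h : H) b (x : M b) : val (val h b x) tt = \sum_j gcoord b x j * hval h j.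
Proof.
have /asboolP[hl hn] := svalP h.
have hD : forall (I : finType) (F : I -> M b),
    val h b (\sum_i F i) = \sum_i val h b (F i).
  move=> I F; pose h' := mklin (hl b : linear (val h b : M b -> _)).
  exact: (linear_sum h').
have hZ a y : val h b (a *: y) = a *: val h b y.
  by have := hl b a y 0; rewrite hom_at0 !addr0.
rewrite {1}[x]elt_sum hD.
have vs : forall (I : finType) (F : I -> omega k V (madd b b')),
    val (\sum_i F i) tt = \sum_i val (F i) tt.
  move=> I F; elim/big_rec2: _ => [|i y1 y2 _ <-]; first by rewrite ffunE.
  by rewrite /= ffunE.
have vZ a (y : omega k V (madd b b')) : val (a *: y) tt = a * val y tt.
  by rewrite /= ffunE.
rewrite vs; apply: eq_bigr => j _; rewrite hZ vZ.
have [jb|/gcoord0 ->] := boolP (mle (charv (R j)) b); last by rewrite !mul0r.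
by rewrite -(@gmul_elt _ _ jb j (mle_refl _)) [val h b _]hn.
Qed.

(** The [j]-th coordinate as a homomorphism to omega; for [B \subset R j] these form the basis dual
    to the generators. *)
Let hb_fun (j : J) : dprod (fun a => ((M a -> omega k V (madd a b')) : lmodType k)) :=
  fun a x => free_elt k (fun _ : unit => charv [set: V]) (madd a b')
    [ffun _ => gcoord a x j].

Let omega_le j a (x : M a) : B \subset R j -> gcoord a x j != 0 ->
  mle (charv [set: V]) (madd a b').
Proof.
move=> /fintype.subsetP BR xj; apply/mleP => v; rewrite !ffunE supp_charv !inE.
have : mle (charv (R j)) a by apply: contraNT xj => /gcoord0 ->.
move=> /mleP/(_ v); rewrite ffunE; case: (boolP (v \in B)) => [/BR ->|_ _].
  by rewrite addn0.
by rewrite addn1.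
Qed.

Let hb_pred j : B \subset R j -> hom_submod M (omega k V) b' (hb_fun j).
Proof.
move=> BR.
apply/asboolP; split=> [a t x y|a c ac x]; apply: free_eq => -[] le.
  by rewrite [RHS]free_linear !free_eltE le !ffunE gcoordP.
rewrite free_eltE le gcoord_gmul /= !ffunE.
case: ifPn => //= le'; apply/eqP; apply: contraNT le'; exact: omega_le.
Qed.

Let hb j (BR : B \subset R j) : H := exist _ (hb_fun j) (hb_pred BR).

Let hb_val j (BR : B \subset R j) j' : hval (hb BR) j' = (j' == j)%:R.
Proof.
rewrite /hval [LHS]free_eltE ffunE gcoord_elt ffunE.
have [->|_] := eqVneq j' j; last by rewrite !if_same.
rewrite mle_refl (@omega_le j _ (elt (charv (R j)) (delta k j)) BR) //.
by rewrite gcoord_elt mle_refl ffunE eqxx oner_neq0.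
Qed.

Lemma tau_coef u (h : H) : val (tau u) h = \sum_j u j * hval h j.
Proof. by rewrite tauE h_expand eltT_gcoord. Qed.

(** With [tau_inj] and [tau_surj] this identifies the component in degree [B] with the functions on
    the generators whose degree contains [B]. *)
Lemma tau_mask u : tau (fmask (fun j => B \subset R j) u) = tau u.
Proof.
apply: val_inj; apply/funext => h; rewrite !tau_coef; apply: eq_bigr => j _.
by rewrite ffunE; case: ifPn => // /hval0 ->; rewrite !mulr0.
Qed.

Lemma tau_inj u j : tau u = 0 -> B \subset R j -> u j = 0.
Proof.
move=> u0 BR; have := congr1 (fun f : dual H => val f (hb BR)) u0.
rewrite tau_coef (bigD1 j) // big1 => [|j' j'j].
  by rewrite /= addr0 hb_val eqxx mulr1.
by rewrite hb_val (negPf j'j) mulr0.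
Qed.

Let h_eq (h h' : H) : hval h =1 hval h' -> h = h'.
Proof.
move=> E; apply: val_inj; apply: functional_extensionality_dep => a.
apply/funext => x; apply: val_inj; apply/ffunP => -[].
by rewrite !h_expand; apply: eq_bigr => j _; rewrite E.
Qed.

Let hval_linear a (h h' : H) j : hval (a *: h + h') j = a * hval h j + hval h' j.
Proof. by rewrite /hval /= !ffunE. Qed.

Let hbase j : H := if pselect (B \subset R j) is left BR then hb BR else 0.

Let hbase_val j j' : B \subset R j -> hval (hbase j) j' = (j' == j)%:R.
Proof. by rewrite /hbase; case: pselect => // BR _; exact: hb_val. Qed.

Let h_sum (h : H) : h = \sum_j hval h j *: hbase j.
Proof.
have hs (I : finType) (F : I -> H) j : hval (\sum_i F i) j = \sum_i hval (F i) j.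
  pose f (h : H) : k^o := hval h j.
  have fl : linear f by move=> a g g'; exact: hval_linear.
  exact: (linear_sum (mklin fl)).
have hZ a (g : H) j : hval (a *: g) j = a * hval g j.
  by have := hval_linear a g 0 j; rewrite addr0 => ->; rewrite /hval /= ffunE addr0.
apply: h_eq => j; rewrite hs (bigD1 j) // big1 => [|j' j'j].
  rewrite [RHS]addr0 hZ; have [BR|BR] := boolP (B \subset R j).
    by rewrite hbase_val // eqxx mulr1.
  by rewrite hval0 // mul0r.
rewrite hZ; have [BR|BR] := boolP (B \subset R j').
  by rewrite hbase_val // eq_sym (negPf j'j) mulr0.
by rewrite hval0 // mul0r.
Qed.

Lemma tau_surj (f : dual H) : exists u, tau u = f.
Proof.
exists [ffun j => val f (hbase j)]; apply: val_inj; apply/funext => h.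
have /asboolP fl := svalP f; rewrite tau_coef {2}[h]h_sum.
have -> : val f (\sum_j hval h j *: hbase j) = \sum_j val f (hval h j *: hbase j).
  exact: (linear_sum (mklin (fl : linear (val f : H -> k^o)))).
apply: eq_bigr => j _; rewrite ffunE mulrC.
by have := fl (hval h j) (hbase j) 0; rewrite dual_at0 !addr0 => /esym E; exact: E.
Qed.
End Tau.
End FreeModule.

Lemma kdiffZ (k : fieldType) (X : kcomplex k) n a x : kdiff X n (a *: x) = a *: kdiff X n x.
Proof. exact: linearZ. Qed.

Section Rescale.
Variables (k : fieldType) (I : int -> finType) (D : forall n, I n -> I (n + 1) -> k).
Variables (p : forall n, pred (I n)) (pC : complex_mask D p) (c : k).
Hypothesis c0 : c != 0.

(** A nonzero factor of the differential changes neither cocycles nor coboundaries; this disposes of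
    [dec_sign]. *)
Lemma masked_complexZ n u : kdiff (masked_complex c pC) n u = c *: kdiff (masked_complex 1 pC) n u.
Proof.
apply: masked_space_eq => j pj; rewrite [RHS]masked_spaceZ !masked_complexE pj mul1r //.
Qed.

Lemma masked_cocycleZ n u : kdiff (masked_complex c pC) n u = 0 <-> kdiff (masked_complex 1 pC) n u = 0.
Proof.
rewrite masked_complexZ; split=> [/eqP|->]; last by rewrite scaler0.
by rewrite scaler_eq0 (negPf c0) => /eqP.
Qed.

Lemma masked_coboundaryZ n x : (exists z, x = kdiff (masked_complex c pC) n z) <-> (exists z, x = kdiff (masked_complex 1 pC) n z).
Proof.
split=> -[z ->].
  by exists (c *: z); rewrite masked_complexZ kdiffZ.
by exists (c^-1 *: z); rewrite masked_complexZ kdiffZ scalerA divff // scale1r.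
Qed.

Lemma acyclic_rescale n : acyclic_at (masked_complex c pC) n -> acyclic_at (masked_complex 1 pC) n.
Proof. by move=> a x /masked_cocycleZ/a/masked_coboundaryZ. Qed.

Lemma one_dim_rescale n : one_dim_at (masked_complex c pC) n -> one_dim_at (masked_complex 1 pC) n.
Proof.
move=> [x0 [/masked_cocycleZ dx0 nx0 X]]; exists x0; split=> //; first by move/masked_coboundaryZ.
move=> x /masked_cocycleZ/X[a [z ->]]; exists a, (c *: z); by rewrite masked_complexZ kdiffZ.
Qed.
End Rescale.

Section FreeComplex.
Variables (k : fieldType) (V : finType) (N : cochain k V).
Variables (J : int -> finType) (R : forall n, J n -> {set V}).
Variable beta : forall n, ghom (N n) (free_gmod k (charv \o @R n)).
Hypothesis beta_bij : forall n b, bijective (beta n b).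

Let crd n b (x : N n b) : {ffun J n -> k^o} := gcoord (beta n) b x.
Let el n (u : {ffun J n -> k^o}) : N n (charv [set: V]) :=
  elt (beta_bij n) (charv [set: V]) u.

(** The matrix is read off in degree V, where every generator is available; by [crd_cdiff] it
    describes the differential in all square free degrees. *)
Definition basis_mx n (j : J n) (j' : J (n + 1)) : k :=
  crd (cdiff N n (n + 1) _ (el (delta k j))) j'.

Let D := basis_mx.

Lemma cdiff_el n u : cdiff N n (n + 1) _ (el u) = el (matop D n u).
Proof.
apply: (gcoord_inj (beta_bij (n + 1))).
rewrite /el eltT_gcoord.
transitivity (\sum_j u j *: crd (cdiff N n (n + 1) _ (el (delta k j)))).
  rewrite {1}(delta_sum u) !linear_sum; apply: eq_bigr => j _.
  by rewrite !linearZ.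
apply/ffunP => j'; rewrite matopE sum_ffunE; apply: eq_bigr => j _.
by rewrite ffunE mulrC.
Qed.

Lemma crd_cdiff n (A : {set V}) (x : N n (charv A)) j' :
  crd (cdiff N n (n + 1) _ x) j' = \sum_j D j j' * crd x j.
Proof.
have le : mle (charv A) (charv [set: V]) by rewrite mle_charvE finset.subsetT.
rewrite /crd -(gcoord_gmul (beta (n + 1)) le) -hcomp_gmul.
rewrite -[gmul _ le x](elt_gcoord (beta_bij n)) gcoord_gmul cdiff_el eltT_gcoord.
by rewrite matopE.
Qed.

(** The image of the generator [j] already lives in degree [R j], where only generators of smaller
    degree occur. *)
Lemma basis_mx_down n (j : J n) (j' : J (n + 1)) : D j j' != 0 -> R j' \subset R j.
Proof.
apply: contraNT => jj'.
have lej : mle (charv (R j)) (charv [set: V]) by rewrite mle_charvE finset.subsetT.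
rewrite /D /basis_mx /el -(@gmul_elt _ _ _ _ _ _ (beta_bij n) _ _ lej _ (mle_refl _)).
rewrite hcomp_gmul /crd gcoord_gmul gcoord0 //.
by rewrite mle_charvE.
Qed.

Lemma basis_mx_mx n (j : J n) (j'' : J (n + 1 + 1)) :
  \sum_j' D j j' * D j' j'' = 0.
Proof.
have := crd_cdiff (cdiff N n (n + 1) _ (el (delta k j))) j''.
rewrite cdiff_cdiff /crd linear0 ffunE => E; rewrite [RHS]E; apply: eq_bigr => j' _.
by rewrite mulrC.
Qed.

Definition basis_functor s := dec_functor basis_mx_down basis_mx_mx s.

Let cmapX A n (x : degree_functor N A n) : basis_functor [::] A n :=
  fcut (dec_mask (@R) [::] A n) (crd x).

Let cmapX_lin A n : linear (@cmapX A n).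
Proof. by move=> a x y; rewrite /cmapX /crd !linearP. Qed.

Let dec_mask_nil A n (j : J n) : dec_mask (@R) [::] A n j = mle (charv (R j)) (charv (~: A)).
Proof.
rewrite mle_charvE -finset.disjoints_subset /dec_mask; apply/andb_idr => _.
by apply/fintype.subsetP => v; rewrite inE.
Qed.

Let cmapXE A n x j : val (@cmapX A n x) j = crd x j.
Proof.
rewrite [LHS]fcutE dec_mask_nil; case: ifPn => // jA.
by rewrite /crd (gcoord0 _ _ jA).
Qed.

Let cmapXd A n x : mklin (@cmapX_lin A (n + 1)) (kdiff (degree_functor N A) n x) =
  kdiff (basis_functor [::] A) n (mklin (@cmapX_lin A n) x).
Proof.
apply: masked_space_eq => j' mj'; rewrite masked_complexE mj' mul1r [LHS]cmapXE crd_cdiff.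
by apply: eq_bigr => j _; rewrite cmapXE.
Qed.

Let fmorX_nat (A B : {set V}) (BA : B \subset A) n x :
  @KMap k (degree_functor N B) (basis_functor [::] B) (fun n => mklin (@cmapX_lin B n))
    (@cmapXd B) n (functor_res (degree_functor N) BA n x) =
  functor_res (basis_functor [::]) BA n
    (@KMap k (degree_functor N A) (basis_functor [::] A) (fun n => mklin (@cmapX_lin A n))
      (@cmapXd A) n x).
Proof.
apply: masked_space_eq => j mj; rewrite [RHS]restrE mj.
by rewrite [LHS]cmapXE [RHS]cmapXE /crd gcoord_gmul.
Qed.

Definition coord_transf : transf (degree_functor N) (basis_functor [::]) :=
  @MkTransf k V (degree_functor N) (basis_functor [::]) _ fmorX_nat.

Lemma coord_transf_qiso A : qiso (coord_transf A).
Proof.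
apply: qiso_bij => n; exists (fun u => elt (beta_bij n) (charv (~: A)) (val u)).
  move=> x; apply: (gcoord_inj (beta_bij n)); apply/ffunP => j.
  have E : val (coord_transf A n x) j = crd x j by exact: cmapXE.
  rewrite gcoord_elt E; case: ifPn => // /gcoord0 h.
  by rewrite h.
move=> u; apply: masked_space_eq => j mj; rewrite [LHS]cmapXE /crd gcoord_elt.
by rewrite -dec_mask_nil mj.
Qed.
End FreeComplex.

(** [- - i] is only propositionally [i]; equating the whole reindexing function allows a
    substitution in all dependent types at once. *)
Lemma reindex_id (k : fieldType) (V : finType) (P : cochain k V) (phi : int -> int)
    (sh : forall i j : int, j != i + 1 -> forall b x, cdiff P (phi i) (phi j) b x = 0)
    (dd : forall i j l b x, cdiff P (phi j) (phi l) b (cdiff P (phi i) (phi j) b x) = 0) :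
  phi = id ->
  @Cochain k V (fun i => P (phi i)) (fun i j => cdiff P (phi i) (phi j)) sh dd = P.
Proof.
move=> E; subst phi; case: P sh dd => t d sh0 dd0 sh dd.
by congr Cochain; exact: Prop_irrelevance.
Qed.

Section DoubleNegation.
Variables (k : fieldType) (V : finType) (P : cochain k V).

Let nn_shape (i j : int) : j != i + 1 ->
  forall b x, cdiff P (- - i) (- - j) b x = 0.
Proof. by move=> ij; apply: cdiff_shape; rewrite !opprK. Qed.

(* The terms of [alex_complex (D_complex P)] are the [alex (gHom (P (- - n)) omega)]. *)
Definition nn_complex : cochain k V :=
  @Cochain k V (fun i => P (- - i)) (fun i j => cdiff P (- - i) (- - j)) nn_shape
    (fun i j l => @cdiff_cdiff k V P (- - i) (- - j) (- - l)).

Lemma nn_complexE : nn_complex = P.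
Proof.
by apply: reindex_id; apply/funext => i; rewrite opprK.
Qed.
End DoubleNegation.

Lemma set_enumE (T : finType) (A : {set T}) : [set x in enum A] = A.
Proof. by apply/setP => x; rewrite inE mem_enum. Qed.

Lemma inj_surj_bij (U W : Type) (f : U -> W) :
  injective f -> (forall y, exists x, f x = y) -> bijective f.
Proof.
move=> fi fs; exists (fun y => sval (cid (fs y))) => [x|y].
  by apply: fi; exact: svalP (cid (fs (f x))).
exact: svalP (cid (fs y)).
Qed.

Section TComplex.
Variables (k : fieldType) (V : finType) (P : cochain k V).
Let N := nn_complex P.
Variables (J : int -> finType) (R : forall n, J n -> {set V}).
Variable beta : forall n, ghom (N n) (free_gmod k (charv \o @R n)).
Hypothesis beta_bij : forall n b, bijective (beta n b).
Let T := alex_complex (D_complex P).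
Let D := basis_mx beta_bij.
Let X := basis_functor beta_bij.

Let tauT n (B : {set V}) : {linear {ffun J n -> k^o} -> T n (charv B)} :=
  tau (beta_bij n) B.

Let tauT_d n B u : cdiff T n (n + 1) _ (tauT n B u) = tauT (n + 1) B (matop D n u).
Proof.
apply: val_inj; apply/funext => h.
exact: (congr1 (fun x : N (n + 1) _ => val (val h (charv [set: V]) x) tt) (cdiff_el beta_bij u)).
Qed.

Let tauT_gmul n (B B' : {set V}) (BB : mle (charv B) (charv B')) u :
  gmul (T n) BB (tauT n B u) = tauT n B' u.
Proof. by apply: val_inj; apply/funext => h. Qed.

Let tauT_surj n B f : exists u, tauT n B u = f.
Proof. exact: tau_surj. Qed.

Let tauT_eq n (B : {set V}) (u w : {ffun J n -> k^o}) :
  (forall j : J n, B \subset R j -> u j = w j) -> tauT n B u = tauT n B w.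
Proof.
move=> E; rewrite -(tau_mask (beta_bij n)) -[RHS](tau_mask (beta_bij n)).
by congr (tau _ _ _); apply/ffunP => j; rewrite !ffunE; case: ifP => // /E.
Qed.

Let tauT_inj n (B : {set V}) (u w : {ffun J n -> k^o}) j : tauT n B u = tauT n B w -> B \subset R j -> u j = w j.
Proof.
move=> E BR; apply/eqP; rewrite -subr_eq0; apply/eqP.
have h : tau (beta_bij n) B (u - w) = 0.
  by rewrite linearB; apply/eqP; rewrite subr_eq0; apply/eqP.
by have := tau_inj h BR; rewrite !ffunE.
Qed.

Let dec_maskE (B : {set V}) n (j : J n) : dec_mask (@R) (enum B) finset.set0 n j = (B \subset R j).
Proof.
rewrite /dec_mask finset.disjoints_subset finset.setC0 finset.subsetT /=.
by rewrite set_enumE.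
Qed.
Let pC (B : {set V}) : complex_mask D (dec_mask (@R) (enum B) finset.set0) :=
  dec_mask_complex (basis_mx_down (beta_bij := beta_bij)) (basis_mx_mx beta_bij)
    (s := enum B) (A := finset.set0).
(** Up to the sign of the differential this is [X (enum B) finset.set0]. *)
Let Y B : kcomplex k := masked_complex 1 (@pC B).

Let psi B n (w : Y B n) : T n (charv B) := tauT n B (val w).

Let psi_lin B n : linear (@psi B n).
Proof. by move=> a u w; rewrite /psi !linearP. Qed.

Let psid B n w : mklin (@psi_lin B (n + 1)) (kdiff (Y B) n w) =
  kdiff (degree_complex T (charv B)) n (mklin (@psi_lin B n) w).
Proof.
rewrite [RHS](tauT_d B (val w)); apply: tauT_eq => j' Bj'.
by rewrite masked_complexE dec_maskE Bj' mul1r matopE.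
Qed.

Let psi_map B : kmap (Y B) (degree_complex T (charv B)) :=
  @KMap k (Y B) (degree_complex T (charv B)) (fun n => mklin (@psi_lin B n)) (@psid B).

Let psi_qiso B : qiso (psi_map B).
Proof.
apply: qiso_bij => n; apply: inj_surj_bij => [w w' E|f].
  by apply: masked_space_eq => j; rewrite dec_maskE; exact: tauT_inj.
have [u <-] := tauT_surj f; exists (fcut _ u); apply: tauT_eq => j Bj.
by rewrite fcutE dec_maskE Bj.
Qed.

Lemma double_dual_acyclic (B : {set V}) n : acyclic_at (X (enum B) finset.set0) n ->
  acyclic_at (degree_complex T (charv B)) n.
Proof.
by move=> /(acyclic_rescale (dec_sign_neq0 _ _)) a; apply/(qiso_acyclic (psi_qiso B)).
Qed.

Lemma double_dual_one_dim (B : {set V}) n : one_dim_at (X (enum B) finset.set0) n ->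
  one_dim_at (degree_complex T (charv B)) n.
Proof.
by move=> /(one_dim_rescale (dec_sign_neq0 _ _)) a; apply/(qiso_one_dim (psi_qiso B)).
Qed.

(* The kernel of [T_B -> T_(v + B)] is the value at [v] of the functor whose value
   at the empty set is [T_B]. *)
Lemma double_dual_gmul_inj (B : {set V}) v (BvB : mle (charv B) (charv (v |: B)%SET)) n
    (x : T (n + 1) (charv B)) :
  acyclic_at (X (enum B) [set v]) n ->
  kdiff (degree_complex T (charv B)) (n + 1) x = 0 ->
  (exists y, gmul (T (n + 1)) BvB x = kdiff (degree_complex T (charv (v |: B)%SET)) n y) ->
  exists z, x = kdiff (degree_complex T (charv B)) n z.
Proof.
move=> aX; have [u <-] := tauT_surj x => du [y].
have [t <-] := tauT_surj y; rewrite tauT_gmul => {y} E.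
have Du j' : B \subset R j' -> matop D (n + 1) u j' = 0.
  move=> Bj'; have : tauT (n + 1 + 1) B (matop D (n + 1) u) = tauT (n + 1 + 1) B 0.
    by rewrite linear0 -tauT_d.
  by move=> /tauT_inj -> //; rewrite ffunE.
have DDt j : matop D (n + 1) (matop D n t) j = 0.
  rewrite matopE; under eq_bigr do rewrite matopE mulr_sumr.
  rewrite exchange_big big1 // => i _.
  under eq_bigr do rewrite mulrA [D _ j * _]mulrC.
  by rewrite -mulr_suml basis_mx_mx mul0r.
pose q := dec_mask (@R) (enum B) [set v].
have qE m (j : J m) : q m j = (v \notin R j) && (B \subset R j).
  by rewrite /q /dec_mask disjoint_sym disjoints1 set_enumE.
(* By [utE], [u] and [D t] agree on the indices whose label contains [v |: B], so in degree [B]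
   their difference is represented in the kernel complex. *)
pose w : X (enum B) [set v] (n + 1) := fcut (q (n + 1)) (u - matop D n t).
have utD j : (u - matop D n t) j = u j - matop D n t j.
  by rewrite ffunE [X in _ + X]ffunE.
have wE j : val w j = if (v \notin R j) && (B \subset R j) then u j - matop D n t j else 0.
  by rewrite -qE -utD [LHS]fcutE.
have utE j : (v |: B)%SET \subset R j -> u j = matop D n t j.
  by apply: tauT_inj; rewrite E; exact: tauT_d.
have [|z wz] := aX w.
  apply: masked_space_eq => j'' qj''; rewrite masked_complexE [RHS]ffunE qj''.
  have /andP[vj'' Bj''] : (v \notin R j'') && (B \subset R j'') by rewrite -qE.
  transitivity (dec_sign k (enum B) * matop D (n + 1) (u - matop D n t) j'').
    rewrite matopE; congr (_ * _); apply: eq_bigr => j _.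
    rewrite /D; have [->|D0] := eqVneq (basis_mx beta_bij j j'') 0.
      by rewrite !mul0r.
    have BRj := fintype.subset_trans Bj'' (basis_mx_down D0).
    congr (_ * _); rewrite wE BRj andbT utD; case: ifPn => // /negPn vj.
    by rewrite utE ?subrr // finset.subUset finset.sub1set vj.
  rewrite linearB ffunE [X in _ + X]ffunE Du // DDt subrr mulr0 //.
(* The sign compensates the factor [dec_sign] in the differential of [X]. *)
pose t' := t + dec_sign k (enum B) *: val z.
exists (tauT n B t'); rewrite [RHS]tauT_d; apply: tauT_eq => j Bj.
have -> : matop D n t' j = matop D n t j + dec_sign k (enum B) * matop D n (val z) j.
  by rewrite linearD linearZ ffunE [X in _ + X]ffunE.
have [vj|vj] := boolP (v \in R j).
  rewrite utE ?finset.subUset ?finset.sub1set ?vj // [X in _ * X]matopE big1 ?mulr0 ?addr0 // => i _.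
  have [->|D0] := eqVneq (D i j) 0; first by rewrite mul0r.
  rewrite masked_space0 ?mulr0 // [X in ~~ X]qE negb_and negbK.
  by rewrite (fintype.subsetP (basis_mx_down D0)).
have := congr1 (fun w : masked_space k (q (n + 1)) => val w j) wz.
rewrite masked_complexE [X in if X then _ else _]qE vj Bj -matopE wE vj Bj [_ && _]/= => <-.
by rewrite addrC subrK.
Qed.
End TComplex.

(** * The dual of the enriched complex as cochains on faces *)

Section Faces.
Variables (R : realType) (k : fieldType) (G : cell_complex R) (eps : incidence G).
Let V := vertex G.
Let S := shift_complex (enriched k eps).
Let C := alex_complex S.

Definition face_mx (f g : face G) : k := (eps f g)%:~R.
(** The cohomological degree of the dual of [f] in the dual of E[-1]; the 1 is the shift. *)
Definition face_gr (f : face G) : int := fdim f + 1.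

Lemma face_mx_up f g : face_mx f g != 0 ->
  vset f \subset vset g /\ face_gr g = face_gr f + 1.
Proof.
rewrite /face_mx => fg; have /(eps_neq0 eps)[fd fg'] : eps f g <> 0.
  by move=> e0; rewrite e0 eqxx in fg.
by split; [exact: vset_sub|rewrite /face_gr fd subrK].
Qed.

Lemma face_mx_mx f g : \sum_h face_mx f h * face_mx h g = 0.
Proof.
transitivity ((\sum_h eps f h * eps h g)%:~R : k); last by rewrite eps_eps.
by rewrite rmorph_sum; apply: eq_bigr => h _; rewrite rmorphM.
Qed.

Definition face_functor s : functor k V := inc_functor face_mx_up face_mx_mx s.

Let fd n : finType := faces_of_dim G (- (- n + 1)).
Let face_elt n b (f : fd n) : S (- n) (charv (~: supp b)) :=
  free_elt k (@face_deg R G _) (charv (~: supp b)) (delta k f).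

Let ev_fun n b (c : C n b) : {ffun face G -> k^o} :=
  [ffun f => if insub f is Some f' then val c (face_elt b (f' : fd n)) else 0].

Let ev_lin n b : linear (@ev_fun n b).
Proof.
move=> a c d; apply/ffunP => f; rewrite !ffunE.
by case: (insub f) => [f'|]; rewrite ?scaler0 ?addr0.
Qed.

(** The values on the generators are extended by zero to all faces, so that the index set is
    independent of [n], as [KernelStep] demands. *)
Definition face_eval n b : {linear C n b -> {ffun face G -> k^o}} := mklin (@ev_lin n b).

Let evE n b (c : C n b) (f : fd n) : face_eval n b c (val f) = val c (face_elt b f).
Proof. by rewrite /= ffunE valK. Qed.

Let gr_fd n (f : fd n) : face_gr (val f) = n.
Proof.
by have /eqP := valP f; rewrite /face_gr => ->; rewrite opprD opprK subrK.
Qed.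

Let fdP n (f : face G) : face_gr f = n -> exists f' : fd n, val f' = f.
Proof.
move=> fn; have fP : fdim f == - (- n + 1).
  by rewrite opprD opprK -fn /face_gr addrK.
by exists (Sub f fP).
Qed.

Let inc_mask_nil A n f : inc_mask (fun f => vset f) face_gr [::] A n f =
  (vset f \subset A) && (face_gr f == n).
Proof.
rewrite /inc_mask addr0 [[set x in [::]]](_ : _ = finset.set0) ?finset.setU0; last first.
  by apply/setP => x; rewrite !inE.
by rewrite disjoint_sym finset.disjoints_subset finset.setC0 finset.subsetT finset.sub0set.
Qed.

Let deg_mle A n (f : fd n) :
  mle (face_deg f) (charv (~: supp (charv (~: A)))) = (vset (val f) \subset A).
Proof. by rewrite supp_charv finset.setCK mle_charvE. Qed.

Let dual_expand n b (c : C n b) x : val c x = \sum_(f : fd n) val x f * val c (face_elt b f).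
Proof.
have /asboolP cl := svalP c; rewrite [in LHS](free_elt_sum x).
have -> : val c (\sum_(f : fd n) val x f *: face_elt b f) =
    \sum_(f : fd n) val c (val x f *: face_elt b f).
  exact: (linear_sum (mklin (cl : linear (val c : S (- n) _ -> k^o)))).
apply: eq_bigr => f _.
by have := cl (val x f) (face_elt b f) 0; rewrite dual_at0 !addr0 => E; exact: E.
Qed.

Let ev0 A n (c : C n (charv (~: A))) f :
  ~~ inc_mask (fun f => vset f) face_gr [::] A n f -> face_eval n _ c f = 0.
Proof.
rewrite inc_mask_nil negb_and => h; rewrite /= ffunE.
case: insubP => // f' _ f'E; move: h; rewrite -f'E gr_fd eqxx orbF => h.
suff -> : face_elt (charv (~: A)) (f' : fd n) = 0 by rewrite dual_at0.
apply: free_eq => g gA; rewrite free_eltE gA !ffunE.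
have [gf|//] := eqVneq g f'; move: gA; rewrite deg_mle gf (negPf h) //.
Qed.

Let mp A n (c : degree_functor C A n) : face_functor [::] A n := fcut _ (face_eval n _ c).

Let mpE A n c f : val (@mp A n c) f = face_eval n _ c f.
Proof. by rewrite [LHS]fcutE; case: ifPn => // /ev0 ->. Qed.

Let mp_lin A n : linear (@mp A n).
Proof. by move=> a x y; rewrite /mp !linearP. Qed.

Let mp_d A n c : mklin (@mp_lin A (n + 1)) (kdiff (degree_functor C A) n c) =
  kdiff (face_functor [::] A) n (mklin (@mp_lin A n) c).
Proof.
apply: masked_space_eq => g gm; rewrite masked_complexE gm mul1r [LHS]mpE.
move: gm; rewrite inc_mask_nil => /andP[gA /eqP gn]; have [g' g'E] := fdP gn.
rewrite -g'E evE.
transitivity (\sum_(f : fd n) face_mx (val f) g * val c (face_elt (charv (~: A)) f)).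
  transitivity (val c (cdiff S (- (n + 1)) (- n) _ (face_elt (charv (~: A)) g'))) => //.
  rewrite dual_expand; apply: eq_bigr => f _; congr (_ * _).
  rewrite [LHS](congr1 (fun u : {ffun _ -> _} => u f) (free_homE _ _)) ffunE.
  rewrite (bigD1 g') //= big1 ?addr0.
    by rewrite !ffunE eqxx deg_mle g'E gA mulr1 /incidence_mx /face_mx g'E.
  by move=> h hg; rewrite !ffunE (negPf hg) if_same mulr0.
rewrite [RHS](bigID (fun f : face G => fdim f == - (- n + 1))) /=.
rewrite [X in _ = _ + X]big1 ?addr0; last first.
  move=> f fn; have [->|] := eqVneq (face_mx f (val g')) 0; first by rewrite mul0r.
  move=> /face_mx_up[_]; rewrite g'E gn => /addIr nf; case/eqP: fn.
  by rewrite opprD opprK nf /face_gr addrK.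
rewrite (reindex_omap (val : fd n -> face G) insub); last first.
  by move=> f fP; rewrite (insubT (fun g : face G => fdim g == _)).
apply: eq_big => [f|f _]; first by rewrite valK eqxx andbT (valP f).
by rewrite g'E -evE; congr (_ * _); exact: esym (mpE _ _).
Qed.

Let mp_nat (A B : {set V}) (BA : B \subset A) n x :
  @KMap k (degree_functor C B) (face_functor [::] B) (fun n => mklin (@mp_lin B n))
    (@mp_d B) n (functor_res (degree_functor C) BA n x) =
  functor_res (face_functor [::]) BA n
    (@KMap k (degree_functor C A) (face_functor [::] A) (fun n => mklin (@mp_lin A n))
      (@mp_d A) n x).
Proof.
apply: masked_space_eq => f mf; rewrite [RHS]restrE mf [LHS]mpE [RHS]mpE.
move: mf; rewrite inc_mask_nil => /andP[fB /eqP fn]; have [f' f'E] := fdP fn.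
rewrite -f'E !evE dual_mapE; congr (val x _).
apply: free_eq => g gA; rewrite [LHS]free_eltE [RHS]free_eltE gA.
case: ifPn => //; rewrite deg_mle !ffunE; case: eqVneq => // ->.
by rewrite f'E fB.
Qed.

Definition face_transf : transf (degree_functor C) (face_functor [::]) :=
  @MkTransf k V (degree_functor C) (face_functor [::]) _ mp_nat.

Let inv_fun A n (y : face_functor [::] A n) (x : S (- n) (charv (~: supp (charv (~: A))))) : k^o :=
  \sum_(f : fd n) val x f * val y (val f).

Let inv_lin A n (y : face_functor [::] A n) : linear (inv_fun y).
Proof.
move=> a u w; rewrite /inv_fun scaler_sumr -big_split; apply: eq_bigr => f _.
by rewrite free_linear mulrDl -mulrA.
Qed.

Let inv_pred A n (y : face_functor [::] A n) : dual_submod _ (inv_fun y).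
Proof. exact/asboolP/inv_lin. Qed.

Lemma face_transf_qiso A : qiso (face_transf A).
Proof.
apply: qiso_bij => n.
exists (fun y => exist _ (inv_fun y) (inv_pred y) : degree_functor C A n).
  move=> c; apply: val_inj; apply/funext => x.
  rewrite [RHS]dual_expand; apply: eq_bigr => f _.
  by congr (_ * _); rewrite [LHS]mpE evE.
move=> y; apply: masked_space_eq => f mf; rewrite [LHS]mpE.
move: mf; rewrite inc_mask_nil => /andP[fA /eqP fn]; have [f' f'E] := fdP fn.
rewrite -f'E evE /= /inv_fun (bigD1 f') //= big1 ?addr0.
  by rewrite !ffunE deg_mle f'E fA eqxx mul1r.
by move=> h hf; rewrite !ffunE (negPf hf) if_same mul0r.
Qed.
End Faces.

(** * Cohomology as a graded module *)

Section CohomologyModules.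
Variables (k : fieldType) (V : finType).
Implicit Types (M N : cochain k V).

Lemma cohom_class M n b (x : cohom M (n + 1) b) :
  exists2 z : sub_of (cocycle M (n + 1) b), kdiff (degree_complex M b) (n + 1) (val z) = 0 &
    x = qclass (coboundary M (n + 1) b) z.
Proof. by exists (qrepr x); [exact/eqP/(svalP (qrepr x))|rewrite qreprK]. Qed.

Lemma cohom_acyclic M n b : acyclic_at (degree_complex M b) n ->
  forall x : cohom M (n + 1) b, x = 0.
Proof.
move=> aM x; have [z dz ->] := cohom_class x; apply/eqP; rewrite qclass_eq0.
by apply/coboundaryP; exact: aM.
Qed.

Lemma cohom_one_dim M n b : one_dim_at (degree_complex M b) n ->
  exists e : cohom M (n + 1) b, e != 0 /\ forall x, exists a, x = a *: e.
Proof.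
move=> [x0 [dx0 nx0 X]]; pose z0 : sub_of (cocycle M (n + 1) b) := Sub x0 (introT eqP dx0).
exists (qclass _ z0); split.
  by rewrite qclass_eq0; apply/negP => /coboundaryP.
move=> x; have [z dz ->] := cohom_class x; have [a [y zE]] := X _ dz.
exists a; rewrite -qclassZ; apply/eqP; rewrite qclass_eq; apply/coboundaryP.
by exists y; rewrite /= zE [LHS]addrAC subrr add0r.
Qed.

Lemma cohom_gmul_bij M n b c (bc : mle b c) : (forall i, bijective (gmul (M i) bc)) ->
  bijective (gmul (cohom M (n + 1)) bc).
Proof.
move=> Mb; apply: inj_surj_bij => [x y|y].
  move=> E; apply/eqP; rewrite -subr_eq0; move: E => /eqP.
  rewrite -subr_eq0 -linearB; move: (x - y) => {x y} x.
  have [z dz ->] := cohom_class x.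
  rewrite [gmul _ _ _]quot_mapE qclass_eq0 => /coboundaryP[y yz].
  rewrite qclass_eq0; apply/coboundaryP; have [g gK fK] := Mb n.
  exists (g y); apply: (bij_inj (Mb (n + 1))); apply: etrans yz _.
  by rewrite -{1}(fK y); exact: (hcomp_gmul (cdiff M n (n + 1))).
have [z dz ->] := cohom_class y; have [g gK fK] := Mb (n + 1).
have dgz : cocycle M (n + 1) b (g (val z)).
  apply/eqP; apply: (bij_inj (Mb (n + 1 + 1))).
  by rewrite -hcomp_gmul fK linear0.
exists (qclass _ (Sub (g (val z)) dgz)); rewrite [LHS]quot_mapE; congr qclass.
by apply: val_inj => /=; rewrite fK.
Qed.

Section Map.
Variables (M N : cochain k V) (f : chom M N) (i : int).

Let cohom_map_gmul b c (bc : mle b c) x :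
  cohom_map f i c (gmul (cohom M i) bc x) = gmul (cohom N i) bc (cohom_map f i b x).
Proof.
rewrite -[x]qreprK [gmul _ _ _]quot_mapE !quot_mapE; congr qclass.
by rewrite qreprK; apply: val_inj; rewrite /= hcomp_gmul.
Qed.

Definition cohom_ghom : ghom (cohom M i) (cohom N i) := Ghom cohom_map_gmul.
End Map.

(** The dual depends only on the support of the degree, which x_v leaves unchanged; multiplications
    of [M] both ways between the two equal degrees replace a transport. *)
Lemma alex_square_free_bij (M : gmod k V) v b : v \in supp b -> bijective (xmul (alex M) v b).
Proof.
move=> vb; have E : supp (madd1 v b) = supp b.
  apply/setP => w; rewrite !inE ffunE; case: (eqVneq w v) => [->|_]; last by rewrite addn0.
  by move: vb; rewrite inE addn1 => ->.
have le : mle (charv (~: supp b)) (charv (~: supp (madd1 v b))) by rewrite E mle_refl.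
have le' : mle (charv (~: supp (madd1 v b))) (charv (~: supp b)) by rewrite E mle_refl.
exists (dual_map (gmul M le)) => x; apply: val_inj; apply/funext => y.
  by rewrite !dual_mapE (gmul_comp _ _ (mle_refl _)) gmul_id.
by rewrite !dual_mapE (gmul_comp _ _ (mle_refl _)) gmul_id.
Qed.

Lemma cohom_alex_square_free (M : cochain k V) n :
  square_free (cohom (alex_complex M) (n + 1)).
Proof.
by move=> v b vb; apply: cohom_gmul_bij => i; exact: alex_square_free_bij.
Qed.
End CohomologyModules.

Section Transport.
Variables (R : realType) (k : fieldType) (G : cell_complex R).
Let V := vertex G.

Lemma is_k_module_iso (i : int) (M K : gmod k V) (f : ghom M K) :
  (forall b, bijective (f b)) -> is_k_module i K -> is_k_module i M.
Proof.
move=> fb [sK [e [e1 e2 e3]]]; split=> [v b vb|].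
  have [h hK Kh] := fb b; have [h' h'K Kh'] := fb (madd1 v b).
  have [q qK Kq] := sK v b vb; exists (h \o q \o f _) => x /=.
    by rewrite hcomp_gmul qK hK.
  by apply: (can_inj h'K); rewrite hcomp_gmul Kh Kq.
have [g] : exists g : forall F : {set V}, M (charv F), forall F, f _ (g F) = e F.
  have ex (F : {set V}) : exists x : M (charv F), f _ x = e F.
    by have [h _ hK] := fb (charv F); exists (h (e F)).
  by exists (fun F => sval (cid (ex F))) => F; exact: svalP (cid (ex F)).
move=> gE; exists g; split=> [F iF|F niF x|F v FvF vF iF ivF].
- have [eF0 eFs] := e1 F iF; split.
    by apply: contraNneq eF0 => g0; rewrite -gE g0 linear0.
  move=> x; have [a xa] := eFs (f _ x); exists a; apply: (bij_inj (fb _)).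
  by rewrite linearZ /= gE.
- by apply: (bij_inj (fb _)); rewrite (e2 F niF (f _ x)) linear0.
- by apply: (bij_inj (fb _)); rewrite hcomp_gmul !gE; exact: e3.
Qed.
End Transport.

(** * Cochains on the faces with prescribed vertices *)

Section FaceCohomology.
Variables (R : realType) (k : fieldType) (G : cell_complex R) (eps : incidence G).
Let V := vertex G.
Implicit Types (F : {set V}) (f g : face G).
Let Y F := face_functor k eps (enum F).

Let maskE F A n f :
  inc_mask (fun f => vset f) (@face_gr R G) (enum F) A n f =
  [&& [disjoint F & A], F \subset vset f, vset f \subset A :|: F & face_gr f == n + #|F|%:Z].
Proof. by rewrite /inc_mask set_enumE cardE. Qed.

Let mask0E F n f :
  inc_mask (fun f => vset f) (@face_gr R G) (enum F) finset.set0 n f =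
  (vset f == F) && (face_gr f == n + #|F|%:Z).
Proof.
rewrite maskE finset.disjoints_subset finset.setC0 finset.subsetT finset.set0U.
by rewrite finset.eqEsubset /= andbA; congr (_ && _); exact: andbC.
Qed.

(** By [vset_inj] the only basis element is [f], in a single degree, so all differentials vanish. *)
Lemma face_one_dim F f n : vset f = F -> fdim f + 1 = n + 1 + #|F|%:Z ->
  one_dim_at (Y F finset.set0) n.
Proof.
move=> fF fd; pose x0 : Y F finset.set0 (n + 1) := fcut _ (delta k f).
have x0f : val x0 f = 1.
  by rewrite [LHS]fcutE mask0E fF eqxx /face_gr fd eqxx ffunE eqxx.
have only g m : inc_mask (fun f => vset f) (@face_gr R G) (enum F) finset.set0 m g ->
    g = f /\ m = n + 1.
  rewrite mask0E => /andP[/eqP gF /eqP gd].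
  have gf : g = f by apply: (vset_inj eps); rewrite gF fF.
  split=> //; move: gd; rewrite gf /face_gr fd => /addIr //.
have d0 m (x : Y F finset.set0 m) : kdiff (Y F finset.set0) m x = 0.
  apply: masked_space_eq => g gm; rewrite masked_complexE gm mul1r [RHS]ffunE big1 // => h _.
  have [hm|hm] := boolP (inc_mask (fun f => vset f) (@face_gr R G) (enum F) finset.set0 m h).
    have [_ m1] := only _ _ gm; have [_ m2] := only _ _ hm.
    by exfalso; lia.
  by rewrite masked_space0 // mulr0.
exists x0; split=> // [[z x0z]|x _].
  by move: x0f; rewrite x0z d0 ffunE => /esym/eqP; rewrite oner_eq0.
exists (val x f), 0; rewrite d0 addr0; apply: masked_space_eq => g gm.
by have [-> _] := only _ _ gm; rewrite masked_spaceZ x0f mulr1.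
Qed.

Lemma face_acyclic F n : (forall f, vset f = F -> fdim f + 1 <> n + 1 + #|F|%:Z) ->
  acyclic_at (Y F finset.set0) n.
Proof.
move=> nF x _; exists 0; rewrite linear0; apply: masked_space_eq => f.
by rewrite mask0E => /andP[/eqP fF /eqP/(nF _ fF)].
Qed.

(** The complex has the two basis elements [f] and [f'] in consecutive degrees, joined by an
    incidence number 1 or -1, which is invertible in [k]. *)
Lemma face_pair_acyclic F v f f' n : v \notin F -> vset f = F ->
  vset f' = (v |: F)%SET -> fdim f' = fdim f + 1 -> acyclic_at (Y F [set v]) n.
Proof.
move=> vF fF f'F f'd x dx.
have ff' : subface f f' by apply: (vset_subface eps); rewrite fF f'F finset.subsetUr.
have e0 : face_mx k eps f f' != 0.
  have en0 : eps f f' != 0 by apply: eps_codim1 => //; lia.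
  have := eps_val eps f f'; rewrite (negPf en0) /face_mx /=.
  by case/orP => /eqP ->; rewrite ?rmorphN ?oppr_eq0 oner_eq0.
have maskP m g : inc_mask (fun f => vset f) (@face_gr R G) (enum F) [set v] m g =
    ((g == f) || (g == f')) && (face_gr g == m + #|F|%:Z).
  rewrite maskE disjoint_sym disjoints1 vF /= andbA; congr (_ && _).
  apply/andP/orP => [[Fg gvF]|[/eqP->|/eqP->]]; last 2 first.
  - by rewrite fF subxx finset.subsetUr.
  - by rewrite f'F finset.subsetUr subxx.
  have [vg|vg] := boolP (v \in vset g); [right|left]; apply/eqP/(vset_inj eps).
    apply/eqP; rewrite f'F finset.eqEsubset gvF finset.subUset Fg.
    by rewrite finset.sub1set vg.
  apply/eqP; rewrite fF finset.eqEsubset Fg andbT; apply/fintype.subsetP => u ug.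
  have := fintype.subsetP gvF u ug; rewrite in_setU1 => /orP[/eqP uv|//].
  by rewrite -uv ug in vg.
have gr' : face_gr f' = face_gr f + 1 by rewrite /face_gr f'd.
have f'Nf : f' != f by apply/eqP => E; move: f'd; rewrite E; lia.
have [fn|fn] := eqVneq (face_gr f) (n + 1 + #|F|%:Z).
  have f'n : face_gr f' = n + 1 + 1 + #|F|%:Z by rewrite gr' fn addrAC.
  have := congr1 (fun x : Y F [set v] (n + 1 + 1) => val x f') dx.
  rewrite masked_complexE maskP eqxx orbT f'n eqxx mul1r (bigD1 f) // big1 => [|g gf].
    rewrite [LHS]addr0 [RHS]ffunE => /eqP; rewrite mulf_eq0 (negPf e0) => /eqP xf.
    exists 0; rewrite linear0; apply: masked_space_eq => g; rewrite maskP.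
    case/andP => /orP[/eqP->|/eqP->]; first by rewrite xf ffunE.
    by rewrite f'n => /eqP; move: (#|F|%:Z) => c; lia.
  have [->|] := eqVneq (face_mx k eps g f') 0; first by rewrite mul0r.
  move=> _; rewrite masked_space0 ?mulr0 // maskP (negPf gf) /=.
  by apply/negP => /andP[/eqP ->]; rewrite f'n => /eqP; move: (#|F|%:Z) => c; lia.
have [f'n|f'n] := eqVneq (face_gr f') (n + 1 + #|F|%:Z).
  have fn' : face_gr f = n + #|F|%:Z by apply: (addIr 1); rewrite -gr' f'n addrAC.
  pose z : Y F [set v] n := fcut _ ((val x f' / face_mx k eps f f') *: delta k f).
  exists z; apply: masked_space_eq => g gm; rewrite masked_complexE gm mul1r.
  move: (gm); rewrite maskP => /andP[/orP[/eqP->|/eqP->]]; first by rewrite (negPf fn).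
  move=> _; rewrite (bigD1 f) // big1 => [|h hf].
    rewrite [RHS]addr0 [val z f]fcutE maskP eqxx fn' eqxx !ffunE eqxx.
    by rewrite -[_ *: _]/(_ * _) mulr1 mulrC divfK.
  by rewrite [val z h]fcutE !ffunE (negPf hf) scaler0 if_same mulr0.
exists 0; rewrite linear0; apply: masked_space_eq => g; rewrite maskP.
by case/andP => /orP[/eqP->|/eqP->]; rewrite ?(negPf fn) ?(negPf f'n).
Qed.
End FaceCohomology.

Section Comparison.
Variables (R : realType) (k : fieldType) (G : cell_complex R) (eps : incidence G).
Let V := vertex G.
Variables (N : cochain k V) (J : int -> finType) (L : forall n, J n -> {set V}).
Variable beta : forall n, ghom (N n) (free_gmod k (charv \o @L n)).
Hypothesis beta_bij : forall n b, bijective (beta n b).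
Variable f : chom N (alex_complex (shift_complex (enriched k eps))).
Hypothesis qf : quasi_iso f.

Lemma basis_face_zigzag s A : uniq s -> exists (Z Z' : kcomplex k) (a : kmap Z (basis_functor beta_bij s A))
  (b : kmap Z Z') (c : kmap (face_functor k eps s A) Z'), [/\ qiso a, qiso b & qiso c].
Proof.
move=> us.
have [phi qphi] := cones_dec_functor (basis_mx_down (beta_bij := beta_bij)) (basis_mx_mx beta_bij) s.
have [psi qpsi] := inc_functor_cones (@face_mx_up R k G eps) (face_mx_mx k eps) us.
pose a1 := transf_cones s (coord_transf beta_bij).
pose a2 := transf_cones s (degree_transf f).
pose a3 := transf_cones s (face_transf k eps).
exists (functor_cones s (degree_functor N) A), (functor_cones s (face_functor k eps [::]) A).
exists (kmap_comp (a1 A) (phi A)), (kmap_comp (a2 A) (a3 A)), (psi A).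
split; last exact: qpsi; apply: qiso_comp => //; try exact: qphi;
  apply: transf_cones_qiso => B.
- exact: coord_transf_qiso.
- exact: degree_transf_qiso.
- exact: face_transf_qiso.
Qed.

Lemma basis_acyclic s A n : uniq s ->
  acyclic_at (face_functor k eps s A) n -> acyclic_at (basis_functor beta_bij s A) n.
Proof.
move=> /(@basis_face_zigzag _ A)[Z [Z' [a [b [c [qa qb qc]]]]]] h.
by apply/(qiso_acyclic qa)/(qiso_acyclic qb)/(qiso_acyclic qc).
Qed.

Lemma basis_one_dim s A n : uniq s ->
  one_dim_at (face_functor k eps s A) n -> one_dim_at (basis_functor beta_bij s A) n.
Proof.
move=> /(@basis_face_zigzag _ A)[Z [Z' [a [b [c [qa qb qc]]]]]] h.
by apply/(qiso_one_dim qa)/(qiso_one_dim qb)/(qiso_one_dim qc).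
Qed.
End Comparison.

Lemma free_bases (k : fieldType) (V : finType) (N : cochain k V) :
  (forall i, free_square_free (N i)) ->
  exists (J : int -> finType) (L : forall n, J n -> {set V})
    (beta : forall n, ghom (N n) (free_gmod k (charv \o @L n))),
    forall n b, bijective (beta n b).
Proof.
move=> H; pose J n := sval (cid (H n)); have HJ n := svalP (cid (H n)).
pose L n := sval (cid (HJ n)); have HL n := svalP (cid (HJ n)).
exists J, L, (fun n => sval (cid (HL n))) => n; exact: svalP (cid (HL n)).
Qed.

(** * The module structure of the cohomology of the double dual *)

Section Dual.
Variables (R : realType) (k : fieldType) (G : cell_complex R) (eps : incidence G).
Let V := vertex G.
Variable P : cochain k V.
Hypothesis AP : is_A_complex (shift_complex (enriched k eps)) P.
Let T := alex_complex (D_complex P).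
Variable n : int.
Let i : int := - (n + 1).
Let H (F : {set V}) := cohom T (n + 1) (charv F).

Let faceE (F : {set V}) (f : face G) : (#|F|%:Z = fdim f + i + 1) <-> (fdim f + 1 = n + 1 + #|F|%:Z).
Proof. rewrite /i; move: (#|F|%:Z) (fdim f) => c d; lia. Qed.

Lemma cohom_dual_eq0 (F : {set V}) : ~~ is_iface i F -> forall x : H F, x = 0.
Proof.
move=> nF; apply: cohom_acyclic.
(* The double dual is built from the terms [P (- - n)], so the bases and the quasi-isomorphism are
   moved to [nn_complex P]. *)
have [[_ free] _ [g]] := AP; move: free g; rewrite -{1 2 3}(nn_complexE P) => free g qg.
have [J [L [beta beta_bij]]] := free_bases free.
apply: (double_dual_acyclic (beta_bij := beta_bij)); apply: (basis_acyclic qg) => //; first exact: enum_uniq.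
apply: face_acyclic => f fF /faceE fd; case/negP: nF; apply/is_ifaceP.
by exists f.
Qed.

Lemma cohom_dual_one_dim (F : {set V}) : is_iface i F ->
  exists e : H F, e != 0 /\ forall x, exists a, x = a *: e.
Proof.
move=> /is_ifaceP[f fF /faceE fd]; apply: cohom_one_dim.
have [[_ free] _ [g]] := AP; move: free g; rewrite -{1 2 3}(nn_complexE P) => free g qg.
have [J [L [beta beta_bij]]] := free_bases free.
apply: (double_dual_one_dim (beta_bij := beta_bij)); refine (basis_one_dim beta_bij qg (enum_uniq _) _).
exact: face_one_dim fF fd.
Qed.

Lemma cohom_dual_gmul_inj (F : {set V}) v (le : mle (charv F) (charv (v |: F)%SET)) : v \notin F ->
  is_iface i F -> is_iface i (v |: F)%SET ->
  forall x : H F, gmul (cohom T (n + 1)) le x = 0 -> x = 0.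
Proof.
move=> vF /is_ifaceP[f fF fd] /is_ifaceP[f' f'F f'd] x.
have [z dz ->] := cohom_class x => /eqP.
rewrite [gmul _ _ _]quot_mapE qclass_eq0 => /coboundaryP gz.
apply/eqP; rewrite qclass_eq0; apply/coboundaryP.
have [[_ free] _ [g]] := AP; move: free g; rewrite -{1 2 3}(nn_complexE P) => free g qg.
have [J [L [beta beta_bij]]] := free_bases free.
apply: (double_dual_gmul_inj (beta_bij := beta_bij) _ dz gz).
apply: (basis_acyclic qg); first exact: enum_uniq.
apply: (face_pair_acyclic vF fF f'F).
move: f'd; rewrite cardsU1 vF PoszD fd; move: (fdim f) (fdim f') => d d'; lia.
Qed.

(* Multiplying basis vectors chosen in the degrees [core F] makes the choice
   compatible with all the products, since [core (v |: F) = core F]. *)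
Let core (F : {set V}) : {set V} := F :\: apexes i F.

Let core_sub (F : {set V}) : mle (charv (core F)) (charv F).
Proof. by rewrite mle_charvE finset.subsetDl. Qed.

Let gen_ex (F : {set V}) : exists e : H F, is_iface i F -> e != 0 /\ forall x, exists a, x = a *: e.
Proof.
by have [/cohom_dual_one_dim[e]|_] := boolP (is_iface i F); [exists e|exists 0].
Qed.

Let gen (F : {set V}) : H F := sval (cid (gen_ex F)).

Let basis_elt (F : {set V}) : H F :=
  if is_iface i F then gmul (cohom T (n + 1)) (core_sub F) (gen (core F)) else 0.

Let core_add (F : {set V}) v : v \notin F -> is_iface i F -> is_iface i (v |: F)%SET ->
  core (v |: F)%SET = core F.
Proof.
move=> vF iF ivF; rewrite /core (apexesU1 eps vF iF ivF).
apply/setP => u; rewrite !finset.in_setD !in_setU1.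
by case: eqVneq => [->|] //=; rewrite (negPf vF) andbF.
Qed.

Let gen_cast (A A' F : {set V}) (le : mle (charv A) (charv F))
    (le' : mle (charv A') (charv F)) : A = A' ->
  gmul (cohom T (n + 1)) le (gen A) = gmul (cohom T (n + 1)) le' (gen A').
Proof. by move=> E; subst A'; rewrite (bool_irrelevance le le'). Qed.

Let basis_elt_gmul (F : {set V}) v (le : mle (charv F) (charv (v |: F)%SET)) : v \notin F ->
  is_iface i F -> is_iface i (v |: F)%SET ->
  gmul (cohom T (n + 1)) le (basis_elt F) = basis_elt (v |: F)%SET.
Proof.
move=> vF iF ivF; rewrite /basis_elt iF ivF.
rewrite (gmul_comp _ _ (mle_trans (core_sub F) le)); apply: gen_cast.
by rewrite core_add.
Qed.

(** Induction on the size of [F]: multiplication by x_w is injective for an apex [w], and without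
    apexes the element is the chosen generator itself. *)
Let basis_elt_neq0 (F : {set V}) : is_iface i F -> basis_elt F != 0.
Proof.
have [m] := ubnP #|F|; elim: m F => // m IHm F /ltnSE Fm iF.
have [ap0|[w wap]] := set_0Vmem (apexes i F).
  rewrite /basis_elt iF.
  have cF : core F = F by rewrite /core ap0 finset.setD0.
  rewrite (@gen_cast _ F _ (core_sub F) (mle_refl _) cF) gmul_id.
  by have [] := svalP (cid (gen_ex F)) iF.
move: wap; rewrite inE => /andP[wF iFw].
have wFw : w \notin F :\ w by rewrite !inE eqxx.
move: iF Fm; rewrite -(finset.setD1K wF) cardsU1 wFw => iF Fm.
have le : mle (charv (F :\ w)) (charv (w |: F :\ w)%SET).
  by rewrite mle_charvE finset.subsetUr.
rewrite -(basis_elt_gmul le wFw iFw iF); apply: contraTneq (IHm _ Fm iFw).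
by move=> /(cohom_dual_gmul_inj wFw iFw iF) ->; rewrite eqxx.
Qed.

Lemma cohom_dual_k_module : is_k_module i (cohom T (n + 1)).
Proof.
split; first exact: cohom_alex_square_free.
exists basis_elt; split=> [F iF|F niF|F v le vF iF ivF].
- have e0 := basis_elt_neq0 iF; split=> // x.
  have [g [g0 gs]] := cohom_dual_one_dim iF; have [a ->] := gs x; have [b eb] := gs (basis_elt F).
  have b0 : b != 0 by apply: contraNneq e0 => b0; rewrite eb b0 scale0r.
  by exists (a / b); rewrite eb scalerA divfK.
- exact: cohom_dual_eq0.
- exact: basis_elt_gmul.
Qed.
End Dual.

Theorem theorem4p4 (R : realType) (k : fieldType) (G : cell_complex R)
    (eps : incidence G) (P Q : cochain k (vertex G)) :
  is_A_complex (shift_complex (enriched k eps)) P ->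
  is_A_complex (D_complex P) Q ->
  forall i : int,
    exists K : gmod k (vertex G), is_k_module i K /\ gisom (cohom Q (- i)) K.
Proof.
(* [is_k_module] characterizes [k^i] up to isomorphism, so the cohomology itself serves as [K]; its
   structure is pulled back along the isomorphism induced by [g]. *)
move=> AP [_ _ [g qg]] i; exists (cohom Q (- i)); split; last first.
  by exists (Ghom (hcomp := fun b => idfun) (fun b c bc x => erefl)) => b; exists id.
have [n ->] : exists n, i = - (n + 1) by exists (- i - 1); rewrite subrK opprK.
rewrite opprK; apply: (is_k_module_iso (f := cohom_ghom g (n + 1))); first exact: qg.
exact: (cohom_dual_k_module AP).
Qed.
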